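(* Let $(M,g)$ be a closed connected Riemannian manifold of dimension $n\ge3$ with smooth metric. Let $\nu>0$, set $\mu:=\frac{2n\nu}{(n-1)(n-2)}$, and let $a>0$. There exists a constant $c>0$ depending only on $(M,g)$, $\nu$ and $a$ such that the following holds. Let $\lambda>0$ be an eigenvalue of $-\Delta$, let $\varphi_\lambda$ be an eigenfunction with $-\Delta\varphi_\lambda=\lambda\varphi_\lambda$, let $\Omega_\lambda$ be a nodal domain of $\varphi_\lambda$, and let $x_0\in\Omega_\lambda$ be a point with $\varphi_\lambda(x_0)=\|\varphi_\lambda\|_{L^\infty(\Omega_\lambda)}$. If $$|\varphi_\lambda(x_0)|\ \ge\ a\,e^{-\lambda^{\mu}}\,\|\varphi_\lambda\|_{L^\infty(M)},$$ then $\varphi_\lambda$ does not change sign in the geodesic ball centered at $x_0$ of radius $\dfrac{c}{\lambda^{1/2+\nu}}$.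
   Context: $\Delta$ is the Laplace--Beltrami operator of $(M,g)$, with the sign convention that $-\Delta$ is positive semidefinite; eigenfunctions are real-valued and not identically zero. ''Closed'' means compact without boundary. A nodal domain of $\varphi_\lambda$ is a connected component of $M\setminus\{x\in M:\varphi_\lambda(x)=0\}$. *)

(* Defs.v *)
From HB Require Import structures.
From mathcomp Require Import all_boot all_order all_algebra.
From mathcomp Require Import all_classical all_reals all_analysis.
Set Implicit Arguments.
Unset Strict Implicit.
Unset Printing Implicit Defensive.
Import Order.TTheory GRing.Theory Num.Theory.
Import numFieldNormedType.Exports.
Local Open Scope classical_set_scope.
Local Open Scope ring_scope.

Section Euclidean.
Variables (R : realType) (n : nat).
Implicit Types (U : set 'rV[R]_n) (f : 'rV[R]_n -> R).

Definition partial (i : 'I_n) f (x : 'rV[R]_n) : R := 'D_(delta_mx 0 i) f x.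

Fixpoint Ck (k : nat) U f : Prop :=
  (forall x, U x -> {for x, continuous f}) /\
  if k is k'.+1 then
    forall i, (forall x, U x -> derivable f x (delta_mx 0 i)) /\
              Ck k' U (partial i f)
  else True.

(* Only used on open sets U. *)
Definition smooth_on U f : Prop := forall k, Ck k U f.

(* Sets of n-dimensional Lebesgue measure zero, by countable box covers. *)
Definition null_set (A : set 'rV[R]_n) : Prop :=
  forall e : R, 0 < e ->
  exists a b : nat -> 'rV[R]_n,
    [/\ forall k i, a k 0 i <= b k 0 i,
        A `<=` \bigcup_k [set x | forall i, a k 0 i <= x 0 i <= b k 0 i] &
        (\sum_(0 <= k <oo) (\prod_(i < n) (b k 0 i - a k 0 i))%:E <= e%:E)%E].

End Euclidean.

Section Manifold.
Variables (R : realType) (n : nat) (M : topologicalType).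

(* cinv is total; only its values on cimage below matter. *)
Record chart := Chart {
  cdom : set M ;
  cmap :> M -> 'rV[R]_n ;
  cinv : 'rV[R]_n -> M ;
  chart_open_dom : open cdom ;
  chart_open_image : open (cmap @` cdom) ;
  chart_cancel : forall p, cdom p -> cinv (cmap p) = p ;
  chart_continuous : forall p, cdom p -> {for p, continuous cmap} ;
  chart_inv_continuous :
    forall x, (cmap @` cdom) x -> {for x, continuous cinv} }.

Definition cimage (c : chart) : set 'rV[R]_n := c @` cdom c.

Definition transition (c d : chart) (k : 'I_n) (x : 'rV[R]_n) : R :=
  d (cinv c x) 0 k.

(* Row i, column k holds the derivative along the i-th coordinate of c of the
   k-th coordinate of d: row vectors are transformed by right multiplication. *)
Definition jacobian_mx (c d : chart) (p : M) : 'M[R]_n :=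
  \matrix_(i, k) partial i (transition c d k) (c p).

(* A smooth n-manifold structure on M, without boundary. *)
Record smooth_manifold := SmoothManifold {
  atlas : set chart ;
  manifold_hausdorff : hausdorff_space M ;
  manifold_second_countable : @second_countable M ;
  atlas_cover : forall p : M, exists2 c, atlas c & cdom c p ;
  atlas_smooth : forall c d, atlas c -> atlas d ->
    forall k, smooth_on (c @` (cdom c `&` cdom d)) (transition c d k) }.

Variable A : smooth_manifold.

Definition chart_at (p : M) : chart := s2val (cid2 (atlas_cover A p)).

Definition smooth (u : M -> R) : Prop :=
  forall c, atlas A c -> smooth_on (cimage c) (u \o cinv c).

(* metric c x is the matrix (g_ij) in the chart c at the point of
   coordinates x. *)
Record riemannian_metric := RiemannianMetric {
  metric : chart -> 'rV[R]_n -> 'M[R]_n ;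
  metric_smooth : forall c, atlas A c ->
    forall i j, smooth_on (cimage c) (fun x => metric c x i j) ;
  metric_sym : forall c, atlas A c ->
    forall x, cimage c x -> (metric c x)^T = metric c x ;
  metric_posdef : forall c, atlas A c ->
    forall x, cimage c x ->
    forall v : 'rV[R]_n, v != 0 -> 0 < (v *m metric c x *m v^T) 0 0 ;
  metric_compatible : forall c d, atlas A c -> atlas A d ->
    forall p, cdom c p -> cdom d p ->
    metric c (c p) =
      jacobian_mx c d p *m metric d (d p) *m (jacobian_mx c d p)^T }.

Variable g : riemannian_metric.

(* det(g)^(-1/2) sum_i d_i (det(g)^(1/2) sum_j g^ij d_j u) in the chart c *)
Definition laplace_in_chart (c : chart) (u : M -> R) (x : 'rV[R]_n) : R :=
  let vol y := Num.sqrt (\det (metric g c y)) in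
  (vol x)^-1 *
  \sum_(i < n) partial i (fun y =>
    vol y * \sum_(j < n) invmx (metric g c y) i j *
                         partial j (u \o cinv c) y) x.

(* For smooth u the value does not depend on the chart around p. *)
Definition laplace_beltrami (u : M -> R) (p : M) : R :=
  laplace_in_chart (chart_at p) u (chart_at p p).

Definition is_eigenfunction (lam : R) (phi : M -> R) : Prop :=
  [/\ smooth phi, (exists p, phi p != 0) &
      forall p, - laplace_beltrami phi p = lam * phi p].

Definition is_eigenvalue (lam : R) : Prop :=
  exists phi, is_eigenfunction lam phi.

Definition nodal_domain (phi : M -> R) (Omega : set M) : Prop :=
  exists2 p, phi p != 0 &
    Omega = connected_component [set q | phi q != 0] p.

(* Sets of measure zero for the Riemannian volume, whose density in each chart
   is positive and continuous. *)
Definition negligible_set (B : set M) : Prop :=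
  forall c, atlas A c -> null_set (c @` (B `&` cdom c)).

(* The essential supremum of |u| over B, for u essentially bounded on B. *)
Definition Linfty_norm (B : set M) (u : M -> R) : R :=
  inf [set m : R | 0 <= m /\ negligible_set [set p | B p /\ m < `|u p|]].

Definition C1_curve (s : R -> M) : Prop :=
  continuous s /\
  forall c, atlas A c -> forall t, cdom c (s t) ->
    derivable (c \o s) t 1 /\ {for t, continuous (derive1 (c \o s))}.

(* Each closed piece is the restriction of a C^1 curve; since consecutive
   pieces share an endpoint, gamma is continuous on [0, 1]. *)
Definition piecewise_C1 (gamma : R -> M) : Prop :=
  exists2 s : seq R, itv_partition 0 1 s &
    forall i, (i < size s)%N ->
    exists2 sigma, C1_curve sigma &
      forall t, nth 0 (0 :: s) i <= t <= nth 0 (0 :: s) i.+1 ->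
        gamma t = sigma t.

(* The norm of gamma'(t), which does not depend on the chart around gamma t. *)
Definition speed (gamma : R -> M) (t : R) : R :=
  let c := chart_at (gamma t) in
  let v := derive1 (c \o gamma) t in
  Num.sqrt ((v *m metric g c (c (gamma t)) *m v^T) 0 0).

Definition curve_length (gamma : R -> M) : \bar R :=
  (\int[lebesgue_measure]_(t in `[0%R, 1%R]) (speed gamma t)%:E)%E.

Definition geodesic_distance (p q : M) : \bar R :=
  ereal_inf [set curve_length gamma | gamma in
    [set gamma | [/\ piecewise_C1 gamma, gamma 0 = p & gamma 1 = q]]].

Definition geodesic_ball (p : M) (r : R) : set M :=
  [set q | (geodesic_distance p q < r%:E)%E].

Definition changes_sign_on (B : set M) (u : M -> R) : Prop :=
  exists p q, [/\ B p, B q, u p < 0 & 0 < u q].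

End Manifold.

(* Main.v *)
(** Everything is deduced from the maximum principle. Around each point there are
    coordinates in which the metric is nearly Euclidean, so the eigenvalue
    equation becomes an elliptic equation with Lipschitz coefficients. Doubling
    the variables along coupled directions bounds the oscillation of solutions,
    and comparison with powers |x - y|^(-p), p = n - 2 + 2/n, turns this into a
    Harnack inequality.

    Suppose phi < 0 somewhere near x0, and put T boxes of radii comparable to
    rho = c lambda^(-1/2 - nu) around x0, with T of order lambda^mu. On the
    innermost box sup (-phi) is comparable to phi x0 by the Harnack inequality,
    and on the outermost one it is at most e^(lambda^mu) phi x0 / a; hence it
    grows by at most a factor e across half of the T steps. For these steps phi
    is negative on a ball of radius comparable to rho / T around a point y_k of
    the k-th box, so y_k is far from the nodal domain. Adding to phi a small
    multiple of the sum over k of |x - y_k|^(-p) and a small quadratic term gives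
    a strict subsolution on the part of the nodal domain in the box, which
    therefore has its maximum on the boundary, against phi <= phi x0. The
    condition for this is that lambda rho^2 T^(p - 1) be small, and
    p - 1 = (n - 1)(n - 2)/n is where mu comes from.

    The constants are uniform because eigenvalues are bounded below: Harnack's
    inequality, chained over the compact connected manifold, applies to
    phi - min phi + n^2 lambda sup |phi|. *)

Require Import Defs.
From HB Require Import structures.
From mathcomp Require Import all_boot all_order all_algebra.
From mathcomp Require Import all_classical all_reals all_analysis.
From mathcomp Require Import ring lra perm measurable_realfun.
Set Implicit Arguments.
Unset Strict Implicit.
Unset Printing Implicit Defensive.
Import Order.TTheory GRing.Theory Num.Theory.
Import numFieldNormedType.Exports.
Local Open Scope classical_set_scope.
Local Open Scope ring_scope.

(** All estimates on solutions are pointwise: a solution enters only through its first and second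
    derivatives along lines, at a point where an auxiliary function is extremal.

    The power T^(p - 1) arises as follows. The nodal domain stays at distance of order rho / T from
    each [y_k], and on it the sum of all the poles is still of order (rho / T)^(-p): [y_k] lies
    exactly on the boundary of the k-th box, so a point is close to few poles, and the others
    contribute a convergent series because p > 1. The poles may therefore be weighted by a number of
    order (rho / T)^p without spoiling the value phi x0. About T / 2 of them raise the value at x0
    above that on the boundary of the big box by T * (rho / T)^p * rho^(-p) = T^(1 - p), and this
    has to beat the quadratic term, of order lambda rho^2. With rho^2 = c^2 lambda^(-1 - 2 nu) and T
    of order lambda^mu the balance is mu * (p - 1) = 2 nu.

    The lower bound on lambda keeps T comparable with lambda^mu and rho inside the coordinate
    box. *)

Section OneDim.
Variable R : realType.
Implicit Types (f g v : R -> R) (a b : R).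

(** First derivative [a] and second derivative [b] at 0. The derivative [v] stays existential, so
    the rules below state its value only at 0, and nothing is asked of second derivatives
    elsewhere. *)
Definition D2 f a b : Prop :=
  exists2 v : R -> R, (\forall t \near (0:R), is_derive (t : R) (1 : R) f (v t)) &
    v 0 = a /\ is_derive (0:R) (1:R) v b.

Lemma D2_near f g a b : (\forall t \near (0:R), f t = g t) -> D2 f a b -> D2 g a b.
Proof.
move=> fg [v fv [va vb]]; exists v => //.
have fg2 : \forall t \near (0:R), \forall s \near t, f s = g s by exact: near_join.
near=> t; apply: (@near_eq_is_derive _ _ _ f g).
  by near: t.
by near: t.
Unshelve. all: by end_near. Qed.

Lemma D2_ext f g a b : f =1 g -> D2 f a b -> D2 g a b.
Proof. by move=> fg; apply: D2_near; near=> t; exact: fg. Unshelve. all: by end_near. Qed.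

Lemma D2_eq f a b a' b' : D2 f a b -> a = a' -> b = b' -> D2 f a' b'.
Proof. by move=> ? <- <-. Qed.

Lemma D2D f g a b a' b' : D2 f a b -> D2 g a' b' ->
  D2 (fun t => f t + g t) (a + a') (b + b').
Proof.
move=> [v fv [va vb]] [w gw [wa wb]]; exists (v + w).
  by near=> t; apply: is_deriveD; near: t.
by split; [rewrite /= -va -wa | exact: is_deriveD].
Unshelve. all: by end_near. Qed.

Lemma D2Z f a b k : D2 f a b -> D2 (fun t => k * f t) (k * a) (k * b).
Proof.
move=> [v fv [va vb]]; exists (k \*: v).
  by near=> t; apply: is_deriveZ; near: t.
by split; [rewrite /= -va | exact: is_deriveZ].
Unshelve. all: by end_near. Qed.

Lemma D2N f a b : D2 f a b -> D2 (fun t => - f t) (- a) (- b).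
Proof.
by move=> /(D2Z (-1)); rewrite !mulN1r; apply: D2_ext => t; rewrite mulN1r.
Qed.

Lemma D2_cst c : D2 (fun=> c) 0 0.
Proof.
by exists (cst 0); [near=> t; apply: is_derive_cst | split => //; exact: is_derive_cst].
Unshelve. all: by end_near. Qed.

Lemma D2_quadratic a b c : D2 (fun t => a + b * t + c * t ^+ 2) b (2 * c).
Proof.
exists (fun t => b + 2 * c * t).
  near=> t; apply: is_derive_eq; rewrite /GRing.scale/=; ring.
split; first by ring.
apply: is_derive_eq; rewrite /GRing.scale/=; ring.
Unshelve. all: by end_near. Qed.

Lemma D2_continuous f a b : D2 f a b -> {for 0, continuous f}.
Proof.
move=> [v /nbhs_singleton fv _]; apply: differentiable_continuous.
by apply/derivable1_diffP; exact: ex_derive.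
Qed.

Lemma D2_powR f a b s : 0 < f 0 -> D2 f a b ->
  D2 (fun t => f t `^ s) (s * f 0 `^ (s - 1) * a)
    (s * (s - 1) * f 0 `^ (s - 2) * a ^+ 2 + s * f 0 `^ (s - 1) * b).
Proof.
move=> f0 fD; have fc := D2_continuous fD.
have fpos : \forall t \near (0:R), 0 < f t.
  by have := fc; move=> /(_ [set x | 0 < x]); apply; apply: open_nbhs_nbhs; split => //; exact: open_gt.
case: fD => v fv [va vb].
exists (fun t => s * f t `^ (s - 1) * v t).
  near=> t; have ft : is_derive t 1 f (v t) by near: t.
  have p : 0 < f t by near: t.
  by have := is_derive1_comp (is_derive1_powR s p) ft.
split; first by rewrite va.
have f1 := nbhs_singleton fv.
have h1 := is_derive1_comp (is_derive1_powR (s - 1) f0) f1.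
have h2 := is_deriveM (is_deriveZ s h1) vb.
apply: (is_derive_eq h2); rewrite /GRing.scale/= va.
have -> : s - 1 - 1 = s - 2 by ring.
by rewrite /GRing.scale/=; ring.
Unshelve. all: by end_near. Qed.

(** Were [b] positive, the derivative [v], which vanishes at 0, would be positive just after 0, and
    the mean value theorem would give a value above [f 0] there. *)
Lemma D2_max f a b : (\forall t \near (0:R), f t <= f 0) -> D2 f a b -> a = 0 /\ b <= 0.
Proof.
move=> fmax [v fv [va vb]].
have [e /= e0 he] : exists2 e : R, 0 < e & forall t, `|t| < e -> f t <= f 0 /\ is_derive t 1 f (v t).
  have : \forall t \near (0:R), f t <= f 0 /\ is_derive t 1 f (v t).
    by near=> t; split; near: t.
  by move=> /nbhs_ballP[e e0 h]; exists e => // t te; apply: h; rewrite /ball/= sub0r normrN.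
have inI t : t \in `]-e, e[ -> `|t| < e by rewrite in_itv/= => /andP[? ?]; rewrite ltr_norml; apply/andP.
have a0 : a = 0.
  rewrite -va.
  have h0 : is_derive (0:R) 1 f 0.
    apply: (@derive1_at_max _ f (-e) e); first lra.
    - by move=> t /inI /he[_ h]; exact: ex_derive.
    - by rewrite in_itv/=; apply/andP; split; lra.
    - by move=> t /inI /he[].
  have [_ h1] := he 0 ltac:(by rewrite normr0).
  have <- := @derive_val _ _ _ _ _ _ _ h1.
  exact: (@derive_val _ _ _ _ _ _ _ h0).
split => //; rewrite leNgt; apply/negP => b0.
have [d /= d0 hd] : exists2 d : R, 0 < d & forall t, 0 < t < d -> 0 < v t.
  have dv := @ex_derive _ _ _ _ _ _ _ vb.
  have : (fun h => h^-1 *: (v (h *: 1 + 0) - v 0)) h @[h --> 0^'] --> b.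
    have := dv; rewrite /derivable => /cvg_ex[l hl].
    have := @derive_val _ _ _ _ _ _ _ vb; rewrite /derive => <-.
    have -> : (fun h => h^-1 *: (v (h *: 1 + 0) - v 0)) = (fun h => h^-1 *: ((v \o shift 0) (h *: 1) - v 0)) by [].
    by apply/cvg_ex; exists l; exact: hl.
  move=> /(_ [set x | 0 < x]) /= h.
  have /h : nbhs b [set x | 0 < x] by apply: open_nbhs_nbhs; split => //; exact: open_gt.
  move=> /nbhs_ballP[d d0 hd]; exists d => // t /andP[t0 td].
  have := hd t; rewrite /ball/= sub0r normrN gtr0_norm// => /(_ td) /(_ (lt0r_neq0 t0)).
  rewrite va a0 subr0 addr0 /GRing.scale/= mulr1 => h2.
  by rewrite -(pmulr_rgt0 _ (_ : 0 < t^-1)) ?invr_gt0.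
pose m := Num.min e d / 2.
have m0 : 0 < m by rewrite divr_gt0// lt_min e0.
have mm : m < Num.min e d by rewrite /m; move: m0; rewrite /m; set M := Num.min e d => ?; lra.
have [me md] : m < e /\ m < d by move: mm; rewrite lt_min => /andP.
have inm t : 0 < t < m -> `|t| < e by move=> /andP[? ?]; rewrite gtr0_norm; lra.
have := @MVT _ f v 0 m m0.
case.
- move=> t; rewrite in_itv/= => /inm /he[_ h]; exact: h.
- apply: continuous_in_subspaceT => t; rewrite inE/= in_itv/= => /andP[t1 t2].
  have [_ h] := he t ltac:(by rewrite ger0_norm; lra).
  by apply: differentiable_continuous; apply/derivable1_diffP; exact: ex_derive.
- move=> c; rewrite in_itv/= => /andP[c0 cm].
  have [h _] := he m ltac:(by rewrite gtr0_norm; lra).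
  have vc : 0 < v c by apply: hd; apply/andP; split; lra.
  move=> E; have : 0 < v c * (m - 0) by rewrite subr0 mulr_gt0.
  by rewrite -E; lra.
Unshelve. all: by end_near. Qed.

End OneDim.

(** * Quadratic forms and nearly scalar matrices *)

Section Vectors.
Variables (R : realType) (n : nat).
Notation V := 'rV[R]_n.
Implicit Types (x y z p d b : V) (H a : 'M[R]_n).

Lemma mx_norm_le x (c : R) : 0 <= c -> (`|x| <= c) = [forall i, `|x 0 i| <= c].
Proof.
move=> c0; rewrite [`|x|]mx_normrE; apply/bigmax_leP/forallP => [[_ h] i|h].
  exact: (h (0, i)).
by split => // -[i j] _ /=; rewrite ord1.
Qed.

Lemma coord_norm_le x i : `|x 0 i| <= `|x|.
Proof. by move: (lexx `|x|); rewrite {1}mx_norm_le// => /forallP. Qed.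

Lemma mx_norm_leP x (c : R) : 0 <= c -> (forall i, `|x 0 i| <= c) -> `|x| <= c.
Proof. by move=> c0 h; rewrite mx_norm_le//; apply/forallP. Qed.

Lemma mx_norm_attained x : (0 < n)%N -> exists i, `|x| = `|x 0 i|.
Proof.
move=> n0; have [m hm] : exists m : 'I_n, forall i, `|x 0 i| <= `|x 0 m|.
  have [m _ hm] := @arg_maxP _ R _ (Ordinal n0) xpredT (fun i => `|x 0 i|) isT.
  by exists m => i; exact: hm.
by exists m; apply/eqP; rewrite eq_le coord_norm_le andbT; exact: mx_norm_leP.
Qed.

Definition dot x y : R := \sum_i x 0 i * y 0 i.
(* [`|x|] is the sup norm of a row vector. *)
Definition sqn x : R := \sum_i x 0 i ^+ 2.
Definition quad H p : R := \sum_i \sum_j p 0 i * H i j * p 0 j.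

Lemma dotDl x y z : dot (x + y) z = dot x z + dot y z.
Proof. by rewrite -big_split; apply: eq_bigr => i _; rewrite !mxE mulrDl. Qed.
Lemma dotZl c x z : dot (c *: x) z = c * dot x z.
Proof. by rewrite mulr_sumr; apply: eq_bigr => i _; rewrite !mxE mulrA. Qed.
Lemma dotC x y : dot x y = dot y x.
Proof. by apply: eq_bigr => i _; rewrite mulrC. Qed.
Lemma dotDr x y z : dot z (x + y) = dot z x + dot z y.
Proof. by rewrite !(dotC z) dotDl. Qed.
Lemma dotZr c x z : dot z (c *: x) = c * dot z x.
Proof. by rewrite !(dotC z) dotZl. Qed.
Lemma dotNl x z : dot (- x) z = - dot x z.
Proof. by rewrite -scaleN1r dotZl mulN1r. Qed.
Lemma dotNr x z : dot z (- x) = - dot z x.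
Proof. by rewrite !(dotC z) dotNl. Qed.
Lemma dotBl x y z : dot (x - y) z = dot x z - dot y z.
Proof. by rewrite dotDl dotNl. Qed.
Lemma dotBr x y z : dot z (x - y) = dot z x - dot z y.
Proof. by rewrite dotDr dotNr. Qed.
Lemma dot0l z : dot 0 z = 0.
Proof. by rewrite /dot big1// => i _; rewrite mxE mul0r. Qed.
Lemma dot0r z : dot z 0 = 0.
Proof. by rewrite dotC dot0l. Qed.
Lemma dot_delta x i : dot x (delta_mx 0 i) = x 0 i.
Proof.
rewrite /dot (bigD1 i)//= mxE !eqxx mulr1 big1 ?addr0// => j ji.
by rewrite mxE (negbTE ji) andbF mulr0.
Qed.
Lemma sqn_dot x : sqn x = dot x x.
Proof. by apply: eq_bigr => i _; rewrite expr2. Qed.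

Lemma sqn_ge0 x : 0 <= sqn x.
Proof. by apply: sumr_ge0 => i _; exact: sqr_ge0. Qed.

Lemma sqn_ge x : (0 < n)%N -> `|x| ^+ 2 <= sqn x.
Proof.
move=> /(mx_norm_attained x)[i ->]; rewrite real_normK ?num_real// /sqn (bigD1 i)//=.
by rewrite lerDl; apply: sumr_ge0 => j _; exact: sqr_ge0.
Qed.

Lemma sum_ord_const (c : R) : \sum_(i < n) c = n%:R * c.
Proof. by rewrite sumr_const card_ord mulr_natl. Qed.

Lemma sqn_le x : sqn x <= n%:R * `|x| ^+ 2.
Proof.
rewrite -sum_ord_const; apply: ler_sum => i _.
by rewrite -(real_normK (num_real (x 0 i))) lerXn2r ?nnegrE// coord_norm_le.
Qed.

Lemma sqn_gt0 x : (0 < n)%N -> x != 0 -> 0 < sqn x.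
Proof.
by move=> n0 x0; apply: lt_le_trans (sqn_ge x n0); rewrite exprn_gt0// normr_gt0.
Qed.

Lemma sqnZ c x : sqn (c *: x) = c ^+ 2 * sqn x.
Proof. by rewrite mulr_sumr; apply: eq_bigr => i _; rewrite mxE exprMn. Qed.

Lemma sqn0 : sqn 0 = 0.
Proof. by rewrite sqn_dot dot0l. Qed.

Lemma sqn_line z p (t : R) : sqn (z + t *: p) = sqn z + 2 * dot z p * t + sqn p * t ^+ 2.
Proof. by rewrite !sqn_dot !(dotDl, dotDr, dotZl, dotZr) (dotC p z); ring. Qed.

Lemma dot_norm_le x y : `|dot x y| <= n%:R * `|x| * `|y|.
Proof.
apply: le_trans (ler_norm_sum _ _ _) _.
rewrite -mulrA -sum_ord_const; apply: ler_sum => i _.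
by rewrite normrM ler_pM ?coord_norm_le.
Qed.

Lemma quad_delta H i : quad H (delta_mx 0 i) = H i i.
Proof.
rewrite /quad (bigD1 i)//= (bigD1 i)//= !mxE !eqxx mul1r mulr1 !big1 ?addr0//.
  by move=> j ji; rewrite big1// => k _; rewrite !mxE (negbTE ji) andbF !mul0r.
by move=> j ji; rewrite !mxE (negbTE ji) andbF mulr0.
Qed.

Lemma quadD H H' p : quad (H + H') p = quad H p + quad H' p.
Proof.
rewrite -big_split; apply: eq_bigr => i _; rewrite -big_split; apply: eq_bigr => j _ /=.
by rewrite mxE mulrDr mulrDl.
Qed.

Lemma quadZl c H p : quad (c *: H) p = c * quad H p.
Proof.
rewrite mulr_sumr; apply: eq_bigr => i _; rewrite mulr_sumr; apply: eq_bigr => j _ /=.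
by rewrite mxE; ring.
Qed.

Lemma quadN H p : quad (- H) p = - quad H p.
Proof. by rewrite -scaleN1r quadZl mulN1r. Qed.

Lemma quad_scalar c p : quad c%:M p = c * sqn p.
Proof.
rewrite mulr_sumr; apply: eq_bigr => i _.
rewrite (bigD1 i)//= big1 ?addr0; last by move=> j ji; rewrite mxE eq_sym (negbTE ji) mulr0 mul0r.
by rewrite mxE eqxx mulr1n; ring.
Qed.

Definition tens z : 'M[R]_n := \matrix_(i, j) (z 0 i * z 0 j).

Lemma quad_tens z p : quad (tens z) p = dot z p ^+ 2.
Proof.
rewrite expr2 big_distrl /=; apply: eq_bigr => i _; rewrite mulr_sumr; apply: eq_bigr => j _.
by rewrite mxE; ring.
Qed.

Lemma quadDv H p q : quad H (p + q) = quad H p + quad H q +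
  \sum_i \sum_j (p 0 i * H i j * q 0 j + q 0 i * H i j * p 0 j).
Proof.
rewrite -!big_split; apply: eq_bigr => i _; rewrite -!big_split; apply: eq_bigr => j _ /=.
by rewrite !mxE; ring.
Qed.

Lemma quadNv H p : quad H (- p) = quad H p.
Proof. by apply: eq_bigr => i _; apply: eq_bigr => j _; rewrite !mxE; ring. Qed.

Lemma quadZv H c p : quad H (c *: p) = c ^+ 2 * quad H p.
Proof.
rewrite mulr_sumr; apply: eq_bigr => i _; rewrite mulr_sumr; apply: eq_bigr => j _ /=.
by rewrite !mxE; ring.
Qed.

Lemma bil_delta H i j :
  \sum_k \sum_l ((delta_mx 0 i : V) 0 k * H k l * (delta_mx 0 j : V) 0 l
    + (delta_mx 0 j : V) 0 k * H k l * (delta_mx 0 i : V) 0 l) = H i j + H j i.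
Proof.
have h (i' j' : 'I_n) : \sum_k \sum_l (delta_mx 0 i' : V) 0 k * H k l * (delta_mx 0 j' : V) 0 l = H i' j'.
  rewrite (bigD1 i')//= (bigD1 j')//= !mxE !eqxx mul1r mulr1 !big1 ?addr0//.
    by move=> k ki; rewrite big1// => l _; rewrite !mxE (negbTE ki) andbF !mul0r.
  by move=> l lj; rewrite !mxE (negbTE lj) andbF mulr0.
by rewrite -!h -big_split; apply: eq_bigr => k _; rewrite -big_split.
Qed.

Lemma quad_deltaD H i j : quad H (delta_mx 0 i + delta_mx 0 j) = H i i + H j j + (H i j + H j i).
Proof. by rewrite quadDv !quad_delta bil_delta. Qed.

Lemma quad_deltaB H i j : quad H (delta_mx 0 i - delta_mx 0 j) = H i i + H j j - (H i j + H j i).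
Proof.
rewrite quadDv quadNv !quad_delta -bil_delta -sumrN; congr (_ + _); apply: eq_bigr => k _.
by rewrite -sumrN; apply: eq_bigr => l _; rewrite !mxE; ring.
Qed.

Definition mxdot a H : R := \sum_i \sum_j a i j * H i j.

Lemma mxdotDr a H H' : mxdot a (H + H') = mxdot a H + mxdot a H'.
Proof.
rewrite -big_split; apply: eq_bigr => i _; rewrite -big_split; apply: eq_bigr => j _ /=.
by rewrite mxE mulrDr.
Qed.

Lemma mxdotZr c a H : mxdot a (c *: H) = c * mxdot a H.
Proof.
rewrite mulr_sumr; apply: eq_bigr => i _; rewrite mulr_sumr; apply: eq_bigr => j _ /=.
by rewrite mxE; ring.
Qed.

Lemma mxdot_scalar c a : mxdot a c%:M = c * \tr a.
Proof.
rewrite mulr_sumr; apply: eq_bigr => i _.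
rewrite (bigD1 i)//= big1 ?addr0; last by move=> j ji; rewrite mxE eq_sym (negbTE ji) mulr0.
by rewrite mxE eqxx mulr1n mulrC.
Qed.

(** A nearly scalar matrix is a positive combination of squares of the fixed
    vectors e_i + e_j, e_i - e_j and e_k, with coefficients affine in the
    entries of the matrix. *)
Definition offw : R := (16 * n%:R)^-1.
Definition dirw a (i j : 'I_n) : R :=
  if i == j then (a i i - 2^-1 - 4 * (n%:R - 1) * offw - \sum_(k | k != i) a i k) / 4
  else offw + a i j / 2.

(** Compare coefficients: an off-diagonal [H i j] occurs with weight [2 * dirw a i j - 2 * offw],
    which has to be [a i j], and the diagonal weight is what then remains of [a i i]. The share
    [2^-1] of the basis vectors is kept apart because a sum over an orthonormal basis can be rotated
    freely; [e_i - e_j] also has a constant weight, so that only [e_i + e_j] sees how [a] varies. *)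
Lemma mxdot_dirw a H : a^T = a ->
  mxdot a H = 2^-1 * \sum_k quad H (delta_mx 0 k)
    + \sum_i \sum_j dirw a i j * quad H (delta_mx 0 i + delta_mx 0 j)
    + \sum_i \sum_j offw * quad H (delta_mx 0 i - delta_mx 0 j).
Proof.
move=> aT; have asym i j : a j i = a i j by rewrite -[in LHS]aT mxE.
have dsym i j : dirw a j i = dirw a i j.
  by rewrite /dirw eq_sym; case: eqP => [->//|_]; rewrite asym.
under [X in 2^-1 * X]eq_bigr do rewrite quad_delta.
under [X in _ + X + _]eq_bigr do under eq_bigr do rewrite quad_deltaD !mulrDr.
under [X in _ + _ + X]eq_bigr do under eq_bigr do rewrite quad_deltaB mulrBr !mulrDr.
pose S1 := \sum_i \sum_j dirw a i j * H i i.
pose S2 := \sum_i \sum_j dirw a i j * H i j.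
pose S3 := \sum_i H i i. pose S4 := \sum_i \sum_j H i j.
have -> : \sum_i \sum_j (dirw a i j * H i i + dirw a i j * H j j + (dirw a i j * H i j + dirw a i j * H j i)) = 2 * S1 + 2 * S2.
  under eq_bigr do rewrite !big_split/=.
  rewrite !big_split/= -/S1 -/S2.
  rewrite [X in _ + X + _]exchange_big/= [X in _ + (_ + X)]exchange_big/=.
  have -> : \sum_j \sum_i dirw a i j * H j j = S1 by apply: eq_bigr => i _; apply: eq_bigr => j _; rewrite dsym.
  have -> : \sum_j \sum_i dirw a i j * H j i = S2 by apply: eq_bigr => i _; apply: eq_bigr => j _; rewrite dsym.
  by ring.
have -> : \sum_i \sum_j (offw * H i i + offw * H j j - (offw * H i j + offw * H j i)) = offw * (2 * n%:R * S3 - 2 * S4).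
  under eq_bigr do rewrite sumrB !big_split/=.
  rewrite sumrB !big_split/=.
  have h1 : \sum_(i < n) \sum_(j < n) offw * H i i = offw * (n%:R * S3).
    under eq_bigr do rewrite sum_ord_const.
    by rewrite -!mulr_sumr -/S3; ring.
  rewrite h1 [X in _ + X - _]exchange_big/= h1 [X in _ - (_ + X)]exchange_big/=.
  have -> : \sum_(i < n) \sum_(j < n) offw * H i j = offw * S4.
    by rewrite mulr_sumr; apply: eq_bigr => i _; rewrite mulr_sumr.
  by ring.
have E i : \sum_j a i j * H i j = 2^-1 * H i i + 2 * (\sum_j dirw a i j) * H i i + 2 * \sum_j dirw a i j * H i j
   + offw * (2 * n%:R * H i i - 2 * \sum_j H i j).
  have h2 : \sum_(j | j != i) dirw a i j = (n%:R - 1) * offw + (\sum_(j | j != i) a i j) / 2.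
    rewrite (eq_bigr (fun j => offw + a i j / 2)); last by move=> j ji; rewrite /dirw eq_sym (negbTE ji).
    rewrite big_split/= -mulr_suml sumr_const; congr (_ + _).
    have -> : #|[pred j | j != i]| = n.-1.
      by rewrite cardC1 card_ord.
    have n0 : (0 < n)%N by exact: leq_ltn_trans (ltn_ord i).
    by rewrite -[LHS]mulr_natl; congr (_ * _); rewrite -subn1 natrB.
  have h3 : \sum_(j | j != i) dirw a i j * H i j = offw * (\sum_(j | j != i) H i j) + (\sum_(j | j != i) a i j * H i j) / 2.
    rewrite mulr_sumr mulr_suml -big_split; apply: eq_bigr => j ji /=.
    by rewrite /dirw eq_sym (negbTE ji); ring.
  rewrite ![\sum_j _](bigD1 i)//= h2 h3 /dirw eqxx. by field.
rewrite /mxdot (eq_bigr _ (fun i _ => E i)) !big_split/=.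
rewrite -!mulr_sumr sumrB -!mulr_sumr -/S3 -/S4.
have -> : \sum_i 2 * (\sum_j dirw a i j) * H i i = 2 * S1.
  by rewrite mulr_sumr; apply: eq_bigr => i _; rewrite -mulrA mulr_suml.
by rewrite -/S2; ring.
Qed.

Definition near_id (e : R) a : Prop := forall i j, `|a i j - (i == j)%:R| <= e.

Lemma sum_off_le a i (e : R) : 0 <= e -> near_id e a ->
   `|\sum_(k | k != i) a i k| <= n%:R * e.
Proof.
move=> e0 ha; apply: le_trans (ler_norm_sum _ _ _) _.
apply: (@le_trans _ _ (\sum_(k | k != i) e)).
  apply: ler_sum => k ki; have := ha i k.
  by rewrite eq_sym (negbTE ki) subr0.
rewrite sumr_const -[X in X <= _]mulr_natl ler_wpM2r// ler_nat.
by rewrite -[X in (_ <= X)%N]card_ord max_card.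
Qed.

(** The factor 16 in [offw] pays for what is subtracted on the diagonal: [4 * (n - 1) * offw] is
    below 1/4 and the row sum at most 1/16. Off the diagonal, [a i j / 2] takes at most half of
    [offw]. A bound away from 0 is wanted because square roots of these weights are compared
    later. *)
Lemma dirw_ge a i j : near_id offw a -> offw / 2 <= dirw a i j.
Proof.
move=> ha; have n0 : (0 < n)%N by exact: leq_ltn_trans (ltn_ord i).
have nR : 1 <= n%:R :> R by rewrite ler1n.
have w0 : 0 < offw by rewrite invr_gt0; lra.
have wn : n%:R * offw = 16^-1 by rewrite /offw; field; lra.
have w16 : offw <= 16^-1 by rewrite -wn ler_peMl// ltW.
have := ha i j; rewrite /dirw; case: eqP => [<-|_].
  rewrite ler_norml => /andP[h _].
  have := sum_off_le i (ltW w0) ha; rewrite ler_norml => /andP[_ h2].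
  rewrite wn in h2.
  have -> : 4 * (n%:R - 1) * offw = 4 * (n%:R * offw) - 4 * offw by ring.
  rewrite wn; move: h; rewrite /= => h; set s := \sum_(_ | _) _ in h2 *; lra.
by rewrite subr0 ler_norml => /andP[h _]; lra.
Qed.

Lemma dirw_lip a a' i j (t : R) : 0 <= t -> (forall i j, `|a i j - a' i j| <= t) ->
  `|dirw a i j - dirw a' i j| <= n%:R * t.
Proof.
move=> t0 h; have n0 : (0 < n)%N by exact: leq_ltn_trans (ltn_ord i).
have nR : 1 <= n%:R :> R by rewrite ler1n.
rewrite /dirw; case: (i == j).
  set s := \sum_(k | k != i) a i k; set s' := \sum_(k | k != i) a' i k.
  have -> : (a i i - 2^-1 - 4 * (n%:R - 1) * offw - s) / 4 - (a' i i - 2^-1 - 4 * (n%:R - 1) * offw - s') / 4 =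
    (a i i - a' i i - (s - s')) / 4 by field.
  have : `|s - s'| <= n%:R * t.
    rewrite -sumrB; apply: le_trans (ler_norm_sum _ _ _) _.
    apply: (@le_trans _ _ (\sum_(k | k != i) t)); first by apply: ler_sum => k _; exact: h.
    rewrite sumr_const -[X in X <= _]mulr_natl ler_wpM2r// ler_nat.
    by rewrite -[X in (_ <= X)%N]card_ord max_card.
  have := h i i; have : t <= n%:R * t by rewrite ler_peMl.
  by rewrite !ler_norml => ? /andP[? ?] /andP[? ?]; apply/andP; split; lra.
have := h i j; have : t <= n%:R * t by rewrite ler_peMl.
by rewrite !ler_norml => ? /andP[? ?]; apply/andP; split; lra.
Qed.

(** The trace inequality behind the maximum principle, read off the decomposition into squares with
    nonnegative weights, without diagonalizing [a]. *)
Lemma mxdot_le0 a H : (0 < n)%N -> a^T = a -> near_id offw a -> (forall p, quad H p <= 0) -> mxdot a H <= 0.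
Proof.
move=> n0 aT ha hH; have w0 : 0 < offw by rewrite invr_gt0 mulr_gt0// ltr0n.
rewrite mxdot_dirw// -oppr_ge0 !opprD !addr_ge0// ?oppr_ge0.
- rewrite mulr_ge0_le0 ?sumr_le0//.
- apply: sumr_le0 => i _; apply: sumr_le0 => j _; rewrite mulr_ge0_le0//.
  by apply: le_trans (dirw_ge i j ha); rewrite ltW// divr_gt0.
- by apply: sumr_le0 => i _; apply: sumr_le0 => j _; rewrite mulr_ge0_le0// ltW.
Qed.

End Vectors.

(** * Second-order jets and comparison functions *)

Section Jets.
Variables (R : realType) (n : nat).
Notation V := 'rV[R]_n.
Implicit Types (x y z p d b : V) (H a : 'M[R]_n) (u w : V -> R).

(** Derivatives along each line through [x] separately, which is all that a test at an extremum
    sees. [H] matters only through [quad H]: by the decomposition into squares, so does [mxdot a H]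
    for symmetric [a]. *)
Definition jet u x d H : Prop :=
  forall p, D2 (fun t : R => u (x + t *: p)) (dot d p) (quad H p).

Lemma jet_eq u x d H d' H' : jet u x d H -> d = d' -> H = H' -> jet u x d' H'.
Proof. by move=> ? <- <-. Qed.

Lemma jetD u w x d H d' H' : jet u x d H -> jet w x d' H' ->
  jet (fun y => u y + w y) x (d + d') (H + H').
Proof. by move=> ju jw p; rewrite dotDl quadD; apply: D2D. Qed.

Lemma jetZ c u x d H : jet u x d H -> jet (fun y => c * u y) x (c *: d) (c *: H).
Proof. by move=> ju p; rewrite dotZl quadZl; apply: D2Z. Qed.

Lemma jetN u x d H : jet u x d H -> jet (fun y => - u y) x (- d) (- H).
Proof. by move=> ju p; rewrite dotNl quadN; apply: D2N. Qed.

Lemma jet_cst c x : jet (fun=> c) x 0 0.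
Proof.
move=> p; rewrite dot0l; have -> : quad 0 p = 0.
  by rewrite /quad big1// => i _; rewrite big1// => j _; rewrite mxE mulr0 mul0r.
exact: D2_cst.
Qed.

Lemma jet_sum (I : Type) (r : seq I) (P : pred I) (f : I -> V -> R) x (d : I -> V) (H : I -> 'M[R]_n) :
  (forall i, P i -> jet (f i) x (d i) (H i)) ->
  jet (fun y => \sum_(i <- r | P i) f i y) x (\sum_(i <- r | P i) d i) (\sum_(i <- r | P i) H i).
Proof.
move=> fi; elim: r => [|i r IH].
  rewrite !big_nil => p; apply: D2_ext (jet_cst 0 x p) => t.
  by rewrite big_nil.
rewrite !big_cons; case: ifPn => Pi p; last first.
  by apply: D2_ext (IH p) => t; rewrite big_cons (negbTE Pi).
apply: D2_ext (jetD (fi i Pi) IH p) => t.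
by rewrite big_cons Pi.
Qed.

Lemma sqn_jet x y : jet (fun x => sqn (x - y)) x (2 *: (x - y)) 2%:M.
Proof.
move=> p; apply: (@D2_ext _ (fun t => sqn (x - y) + 2 * dot (x - y) p * t + sqn p * t ^+ 2)).
  by move=> t /=; rewrite (addrAC x) sqn_line.
by apply: D2_eq (D2_quadratic _ _ _) _ _; rewrite ?dotZl ?quad_scalar.
Qed.

Lemma powR_sqn_jet x y (s : R) : 0 < sqn (x - y) ->
  jet (fun x => sqn (x - y) `^ s) x ((2 * s * sqn (x - y) `^ (s - 1)) *: (x - y))
    ((2 * s * sqn (x - y) `^ (s - 1))%:M
      + (4 * s * (s - 1) * sqn (x - y) `^ (s - 2)) *: tens (x - y)).
Proof.
move=> q0 p; have := @D2_powR _ _ _ _ s _ (sqn_jet x y p).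
rewrite /= scale0r addr0 => /(_ q0) h; apply: (D2_eq h).
  by rewrite !dotZl; ring.
by rewrite dotZl quadD quadZl !quad_scalar quad_tens; ring.
Qed.

Lemma nbhs_line (A : set V) x p : nbhs x A -> \forall t \near (0 : R), A (x + t *: p).
Proof.
have : x + t *: p @[t --> (0:R)] --> x.
  have : x + t *: p @[t --> (0:R)] --> x + (0 : R) *: p.
    by apply: cvgD; [exact: cvg_cst | apply: cvgZr_tmp; exact: cvg_id].
  by rewrite scale0r addr0.
by apply.
Qed.

Lemma jet_near u w x d H : (\forall y \near x, u y = w y) -> jet u x d H -> jet w x d H.
Proof.
move=> uw ju p; apply: D2_near (ju p).
exact: (@nbhs_line [set y | u y = w y] x p uw).
Qed.

Lemma jet_max u x d H : jet u x d H -> (\forall y \near x, u y <= u x) ->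
  d = 0 /\ forall p, quad H p <= 0.
Proof.
move=> ju mx.
have h p : dot d p = 0 /\ quad H p <= 0.
  apply: (@D2_max _ (fun t => u (x + t *: p))) => //.
  by rewrite scale0r addr0; exact: (@nbhs_line [set y | u y <= u x] x p mx).
split; last by move=> p; case: (h p).
by apply/rowP => i; rewrite mxE -dot_delta; case: (h (delta_mx 0 i)).
Qed.

Definition Lop a b d H : R := mxdot a H + dot b d.

Lemma LopD a b d H d' H' : Lop a b (d + d') (H + H') = Lop a b d H + Lop a b d' H'.
Proof. by rewrite /Lop mxdotDr dotDr; ring. Qed.

Lemma LopZ a b c d H : Lop a b (c *: d) (c *: H) = c * Lop a b d H.
Proof. by rewrite /Lop mxdotZr dotZr; ring. Qed.

Lemma LopN a b d H : Lop a b (- d) (- H) = - Lop a b d H.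
Proof. by rewrite -(scaleN1r d) -(scaleN1r H) LopZ mulN1r. Qed.

Lemma Lop0 a b : Lop a b 0 0 = 0.
Proof. by rewrite -[in LHS](scale0r (0 : V)) -[in LHS](scale0r (0 : 'M[R]_n)) LopZ mul0r. Qed.

Lemma Lop_sum a b (I : Type) (r : seq I) (P : pred I) (d : I -> V) (H : I -> 'M[R]_n) :
  Lop a b (\sum_(i <- r | P i) d i) (\sum_(i <- r | P i) H i) = \sum_(i <- r | P i) Lop a b (d i) (H i).
Proof.
elim: r => [|i r IH]; first by rewrite !big_nil Lop0.
by rewrite !big_cons; case: ifP => // _; rewrite LopD IH.
Qed.

Hypothesis n0 : (0 < n)%N.

Lemma offw_gt0 : 0 < offw R n.
Proof. by rewrite invr_gt0 mulr_gt0// ltr0n. Qed.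

Lemma Lop_max a b u x d H : a^T = a -> near_id (offw R n) a -> jet u x d H ->
  (\forall y \near x, u y <= u x) -> Lop a b d H <= 0.
Proof.
move=> aT ha ju /(jet_max ju)[-> hH]; rewrite /Lop dot0r addr0.
exact: mxdot_le0.
Qed.

Lemma Lop_min a b u x d H : a^T = a -> near_id (offw R n) a -> jet u x d H ->
  (\forall y \near x, u x <= u y) -> 0 <= Lop a b d H.
Proof.
move=> aT ha /jetN ju mn; rewrite -oppr_le0 -LopN.
by apply: (Lop_max b aT ha ju); near=> y; rewrite lerN2; near: y.
Unshelve. all: by end_near. Qed.

Lemma tr_near_id a (e : R) : near_id e a -> `|\tr a - n%:R| <= n%:R * e.
Proof.
move=> ha; have -> : \tr a - n%:R = \sum_i (a i i - 1) by rewrite sumrB sum_ord_const mulr1.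
rewrite -sum_ord_const.
apply: le_trans (ler_norm_sum _ _ _) _; apply: ler_sum => i _.
by have := ha i i; rewrite eqxx.
Qed.

Lemma mxdot_tens a z : mxdot a (tens z) = quad a z.
Proof. by apply: eq_bigr => i _; apply: eq_bigr => j _; rewrite mxE; ring. Qed.

Lemma quad_near_id a (e : R) z : 0 <= e -> near_id e a -> `|quad a z - sqn z| <= n%:R * e * sqn z.
Proof.
move=> e0 ha; rewrite -[X in _ - X]mul1r -quad_scalar -quadN -quadD.
apply: (@le_trans _ _ (\sum_i \sum_j e * ((z 0 i ^+ 2 + z 0 j ^+ 2) / 2))).
  apply: le_trans (ler_norm_sum _ _ _) _; apply: ler_sum => i _.
  apply: le_trans (ler_norm_sum _ _ _) _; apply: ler_sum => j _.
  rewrite 2!mxE mxE -[X in X *+ _]/1 mulrAC normrM mulrC ler_pM ?ha//.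
  rewrite ler_norml; apply/andP; split; rewrite -subr_ge0.
    have -> : z 0 i * z 0 j - - ((z 0 i ^+ 2 + z 0 j ^+ 2) / 2) = (z 0 i + z 0 j) ^+ 2 / 2 by field.
    by rewrite divr_ge0// sqr_ge0.
  have -> : (z 0 i ^+ 2 + z 0 j ^+ 2) / 2 - z 0 i * z 0 j = (z 0 i - z 0 j) ^+ 2 / 2 by field.
  by rewrite divr_ge0// sqr_ge0.
under eq_bigr do rewrite -mulr_sumr -mulr_suml big_split/= sum_ord_const -/(sqn z).
rewrite -mulr_sumr -mulr_suml big_split/= sum_ord_const -mulr_sumr -/(sqn z).
by rewrite le_eqVlt; apply/orP; left; apply/eqP; field.
Qed.

(** The exponent n - 2 + 2/n exceeds the harmonic exponent n - 2, so the
    corresponding power of the distance is a strict subsolution of every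
    operator close to the Laplacian; the excess 2/n is exactly what the
    exponent mu of the theorem can absorb. *)
Definition pexp : R := n%:R - 2 + 2 / n%:R.
(** The cube gives [n^2 * eps0 = (16 * n)^-1], so that a deviation [eps0] of the coefficients costs
    only a small part of the excess 2 / n of the exponent. *)
Definition eps0 : R := (16 * n%:R ^+ 3)^-1.

Lemma near_id_eps0 a : near_id eps0 a -> near_id (offw R n) a.
Proof.
move=> h i j; apply: le_trans (h i j) _.
have nR : 1 <= n%:R :> R by rewrite ler1n.
rewrite /eps0 /offw lef_pV2 ?posrE ?mulr_gt0 ?exprn_gt0 ?ltr0n//.
by rewrite ler_pM2l// -[X in X <= _]expr1 ler_weXn2l.
Qed.

(** With p for [pexp], the Laplacian of |z|^(-p) is p * (p + 2 - n) * |z|^(-p - 2), and p + 2 - n =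
    2 / n. The deviation of [a] from the identity and the drift leave at least 1 / n of the factor 2
    / n, and p >= 1. *)
Lemma Lop_powR a b x y (K r : R) : (3 <= n)%N -> near_id eps0 a -> 0 <= K -> `|b| <= K ->
  `|x - y| <= r -> 2 * n%:R ^+ 2 * K * r <= 1 -> 0 < sqn (x - y) ->
  n%:R^-1 * sqn (x - y) `^ (- (pexp / 2) - 1) <=
  Lop a b ((2 * - (pexp / 2) * sqn (x - y) `^ (- (pexp / 2) - 1)) *: (x - y))
    ((2 * - (pexp / 2) * sqn (x - y) `^ (- (pexp / 2) - 1))%:M
      + (4 * - (pexp / 2) * (- (pexp / 2) - 1) * sqn (x - y) `^ (- (pexp / 2) - 2)) *: tens (x - y)).
Proof.
move=> n3 ha K0 bK xr Kr q0.
have nR : 3 <= n%:R :> R by rewrite ler_nat.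
have e0 : 0 < eps0 by rewrite invr_gt0 mulr_gt0// exprn_gt0// ltr0n.
set z := x - y in xr q0 *; set s := - (pexp / 2).
have -> : sqn z `^ (s - 2) = sqn z `^ (s - 1) / sqn z.
  have -> : s - 2 = s - 1 - 1 by ring.
  by rewrite [LHS]powRB ?(gt_eqF q0) ?implybT// powRr1 ?sqn_ge0.
set P := sqn z `^ (s - 1); have P0 : 0 < P by exact: powR_gt0.
rewrite /Lop mxdotDr mxdot_scalar mxdotZr mxdot_tens dotZr.
have := tr_near_id ha; have := quad_near_id z (ltW e0) ha.
set tr := \tr a; set Q := quad a z; set q := sqn z in q0 *; set m := n%:R in nR Kr *.
have mE : m * (16 * m ^+ 3 * eps0) = m by rewrite /eps0 mulfV ?mulr1// -/m; apply/eqP; nra.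
have em : m * (m * eps0) * m = 16^-1.
  rewrite /eps0 -/m; field; lra.
have bz : `|dot b z| <= (2 * m)^-1.
  apply: le_trans (dot_norm_le _ _) _; rewrite -/m.
  have : m * `|b| * `|z| <= m * K * r.
    by apply: ler_pM => //; [rewrite mulr_ge0//; lra | rewrite ler_wpM2l//; lra].
  move=> /le_trans; apply; rewrite -div1r ler_pdivlMr; last lra.
  by apply: le_trans Kr; rewrite le_eqVlt; apply/orP; left; apply/eqP; ring.
have pE : pexp * m = m ^+ 2 - 2 * m + 2 by rewrite /pexp -/m; field; lra.
have p0 : 0 < pexp.
  have h : 0 < pexp * m by rewrite pE; nra.
  by move: h; rewrite pmulr_lgt0//; lra.
have -> : 2 * s * P * tr + 4 * s * (s - 1) * (P / q) * Q + 2 * s * P * dot b z =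
    pexp * P * ((pexp + 2) * (Q / q) - tr - dot b z).
  by rewrite /s; field; lra.
have m0 : m != 0 by rewrite gt_eqF//; lra.
have := mulVf m0; set mi := m^-1 => mi1.
rewrite !ler_norml => /andP[Ql _] /andP[_ tl].
have Qq : 1 - m * eps0 <= Q / q by rewrite ler_pdivlMr//; lra.
have mi0 : 0 < mi by rewrite invr_gt0; lra.
have bz' : dot b z <= mi / 2.
  move: bz; rewrite ler_norml => /andP[_]; rewrite invfM -/mi; lra.
have h1 : mi <= (pexp + 2) * (Q / q) - tr - dot b z.
  have h2 : (pexp + 2) * (1 - m * eps0) <= (pexp + 2) * (Q / q) by rewrite ler_wpM2l//; lra.
  have pe : pexp = m - 2 + 2 * mi by [].
  have h3 : m * eps0 * m = 16^-1 * mi by rewrite -em; nra.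
  have h4 : mi <= 3^-1 by rewrite /mi lef_pV2 ?posrE; lra.
  have h5 : m * eps0 * mi <= m * eps0 * m.
    rewrite ler_wpM2l//; last lra.
    by apply: mulr_ge0; [lra | exact: ltW].
  have h6 : m * eps0 * 1 <= m * eps0 * m.
    by apply: ler_wpM2l; [apply: mulr_ge0; [lra | exact: ltW] | lra].
  rewrite pe in h2 *; lra.
have h6 : 1 <= pexp.
  have : m <= pexp * m by rewrite pE; nra.
  by rewrite -[X in X <= _]mul1r ler_pM2r//; lra.
rewrite mulrC; have -> : P * mi = 1 * (P * mi) by rewrite mul1r.
rewrite -[pexp * P * _]mulrA; apply: ler_pM => //; first by rewrite ltW// mulr_gt0.
by rewrite ler_pM2l.
Qed.

Lemma pexp_gt1 : (3 <= n)%N -> 3 / 2 <= pexp.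
Proof.
move=> n3; have nR : 3 <= n%:R :> R by rewrite ler_nat.
have : 3 / 2 * n%:R <= pexp * n%:R.
  have -> : pexp * n%:R = n%:R ^+ 2 - 2 * n%:R + 2 by rewrite /pexp; field; lra.
  nra.
by rewrite ler_pM2r//; lra.
Qed.

End Jets.

(** * Oscillation of solutions by doubling the variables *)

Section Oscillation.
Variables (R : realType) (n : nat).
Hypothesis n0 : (0 < n)%N.
Notation V := 'rV[R]_n.
Implicit Types (x y z p d : V) (H : 'M[R]_n) (u : V -> R).

Lemma sub_cst_continuous z : continuous (fun x => x - z).
Proof. by move=> x; apply: (@cvgB _ _ V (nbhs x) _ id (cst z)); [exact: cvg_id | exact: cvg_cst]. Qed.

Lemma box_compact z (r : R) : compact [set x : V | `|x - z| <= r].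
Proof.
have [r0|r0] := ltP r 0.
  have -> : [set x : V | `|x - z| <= r] = set0.
    by apply/seteqP; split => // x /= h; have := le_lt_trans h r0; rewrite normr_lt0.
  exact: compact0.
apply: bounded_closed_compact.
  exists (r + `|z|); split; first exact: num_real.
  move=> M rM x /= h; apply: ltW; apply: le_lt_trans rM.
  by rewrite -[x](subrK z); apply: le_trans (ler_normD _ _) _; rewrite lerD2r.
have -> : [set x : V | `|x - z| <= r] = (fun x => `|x - z|) @^-1` [set y | y <= r] by [].
apply: closed_comp; last exact: closed_le.
move=> x _; apply: (@continuous_comp _ _ _ (fun x : V => x - z) (fun x => `|x|)).
  exact: sub_cst_continuous.
exact: norm_continuous.
Qed.

Lemma box_nbhs z x (r : R) : `|x - z| < r -> \forall y \near x, `|y - z| < r.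
Proof.
move=> h; have e0 : 0 < r - `|x - z| by rewrite subr_gt0.
apply/nbhs_ballP; exists (r - `|x - z|) => //= y; rewrite -ball_normE/= => xy.
have -> : y - z = (x - z) - (x - y) by apply/rowP => i; rewrite !mxE; ring.
by apply: le_lt_trans (ler_normB _ _) _; rewrite -ltrBrDl.
Qed.

Lemma sqn_continuous : continuous (@sqn R n).
Proof.
apply: continuous_big => [|i _ x]; first exact: add_continuous.
apply: (@continuous_comp _ _ _ (fun x : V => x 0 i) (fun t => t ^+ 2)).
  exact: coord_continuous.
exact: exprn_continuous.
Qed.

Lemma sqn_sub_continuous z : continuous (fun x : V => sqn (x - z)).
Proof.
move=> x; apply: (@continuous_comp _ _ _ (fun x : V => x - z) (@sqn R n)).
  exact: sub_cst_continuous.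
exact: sqn_continuous.
Qed.

(** The vectors on the left are the images of the standard basis under the reflection that sends [z]
    to [- z], hence another orthonormal basis, and both sides are the trace of [H]. Pairing a basis
    vector with its reflection makes their difference a multiple of [z]. *)
Lemma quad_reflection H z : 0 < sqn z ->
  \sum_k quad H (delta_mx 0 k - (2 * z 0 k / sqn z) *: z) = \sum_k quad H (delta_mx 0 k).
Proof.
move=> q0; have qE : \sum_k z 0 k ^+ 2 = sqn z by [].
set q := sqn z in q0 qE *.
have E k : quad H (delta_mx 0 k - (2 * z 0 k / q) *: z) = quad H (delta_mx 0 k)
   + (4 / q ^+ 2 * z 0 k ^+ 2 * quad H z - 2 / q * (\sum_j z 0 k * H k j * z 0 j + \sum_j z 0 j * H j k * z 0 k)).
  rewrite quadDv quadNv quadZv -addrA; congr (_ + _).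
  have -> : \sum_i \sum_j ((delta_mx 0 k : V) 0 i * H i j * (- ((2 * z 0 k / q) *: z)) 0 j +
      (- ((2 * z 0 k / q) *: z)) 0 i * H i j * (delta_mx 0 k : V) 0 j) =
     - (2 / q) * (\sum_j z 0 k * H k j * z 0 j + \sum_j z 0 j * H j k * z 0 k).
    under eq_bigr do rewrite big_split/=.
    rewrite big_split/= mulrDr; congr (_ + _).
      rewrite (bigD1 k)//= [X in _ + X]big1 ?addr0; last first.
        by move=> j jk; rewrite big1// => l _; rewrite !mxE (negbTE jk) andbF !mul0r.
      by rewrite mulr_sumr; apply: eq_bigr => j _; rewrite !mxE !eqxx /= ?mulr1n; field; exact: lt0r_neq0.
    rewrite mulr_sumr; apply: eq_bigr => j _.
    rewrite (bigD1 k)//= [X in _ + X]big1 ?addr0; last first.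
      by move=> l lk; rewrite !mxE (negbTE lk) andbF mulr0.
    by rewrite !mxE !eqxx /= ?mulr1n; field; exact: lt0r_neq0.
  by field; exact: lt0r_neq0.
rewrite (eq_bigr _ (fun k _ => E k)) big_split/= sumrB -mulr_suml -!mulr_sumr qE.
rewrite big_split/= [X in _ * (_ + X)]exchange_big/=.
have -> : \sum_i \sum_j z 0 i * H i j * z 0 j = quad H z by [].
by field; exact: lt0r_neq0.
Qed.

Lemma sqn_delta k : sqn (delta_mx 0 k : V) = 1.
Proof. by rewrite sqn_dot dot_delta mxE !eqxx. Qed.

Lemma sqn_reflection k z : 0 < sqn z -> sqn (delta_mx 0 k - (2 * z 0 k / sqn z) *: z) = 1.
Proof.
move=> q0; rewrite sqn_dot !(dotBl, dotBr, dotZl, dotZr) -!sqn_dot sqn_delta dot_delta dotC dot_delta.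
by field; exact: lt0r_neq0.
Qed.

Lemma norm_delta_mx k : `|delta_mx 0 k : V| <= 1.
Proof.
by apply: mx_norm_leP => // i; rewrite mxE; case: (_ && _); rewrite ?normr1// normr0.
Qed.

Lemma sqn_delta_pm k l : sqn (delta_mx 0 k + delta_mx 0 l : V) + sqn (delta_mx 0 k - delta_mx 0 l : V) = 4.
Proof.
by rewrite !sqn_dot !(dotBl, dotBr, dotDl, dotDr) -!sqn_dot !sqn_delta; ring.
Qed.

Lemma dirw_le (a : 'M[R]_n) i j : near_id (offw R n) a -> dirw a i j <= 1.
Proof.
have nR : 1 <= n%:R :> R by rewrite ler1n.
move=> ha; have w0 := offw_gt0 R n0.
have wn : n%:R * offw R n = 16^-1 by rewrite /offw; field; lra.
have w16 : offw R n <= 16^-1 by rewrite -wn ler_peMl// ltW.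
have := ha i j; rewrite /dirw; case: eqP => [<-|_].
  rewrite ler_norml => /andP[_ h].
  have := sum_off_le i (ltW w0) ha; rewrite ler_norml => /andP[h2 _].
  rewrite wn in h2.
  have -> : 4 * (n%:R - 1) * offw R n = 4 * (n%:R * offw R n) - 4 * offw R n by ring.
  rewrite wn; move: h; rewrite /= => h; set s := \sum_(_ | _) _ in h2 *; lra.
by rewrite subr0 ler_norml => /andP[_ h]; lra.
Qed.

(** [s - t] is the product of the difference and the sum of the roots, and the square of that sum is
    at least [s + t >= c]. For Lipschitz weights, the squared difference of the roots is therefore
    quadratic in the distance. *)
Lemma sqrt_sub_sqr_le (s t c : R) : 0 < c -> c / 2 <= s -> c / 2 <= t ->
  (Num.sqrt s - Num.sqrt t) ^+ 2 <= (s - t) ^+ 2 / c.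
Proof.
move=> c0 cs ct; have s0 : 0 <= s by lra.
have t0 : 0 <= t by lra.
have -> : s - t = (Num.sqrt s - Num.sqrt t) * (Num.sqrt s + Num.sqrt t).
  by rewrite -subr_sqr !sqr_sqrtr.
rewrite ler_pdivlMr// exprMn.
rewrite ler_wpM2l ?sqr_ge0//.
have : 0 <= Num.sqrt s * Num.sqrt t by rewrite mulr_ge0 ?sqrtr_ge0.
by have := sqr_sqrtr s0; have := sqr_sqrtr t0; nra.
Qed.

Definition elliptic (e R0 K : R) (a : V -> 'M[R]_n) (b : V -> V) : Prop :=
  (forall x, `|x| <= R0 -> [/\ (a x)^T = a x, near_id e (a x) & `|b x| <= K]) /\
  (forall x y, `|x| <= R0 -> `|y| <= R0 -> forall i j, `|a x i j - a y i j| <= K * `|x - y|).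

(** Continuity is asked for separately: derivatives along lines do not imply it, and extrema on
    boxes require it. *)
Definition regular u (du : V -> V) (Hu : V -> 'M[R]_n) z (r : R) : Prop :=
  forall x, `|x - z| <= r -> {for x, continuous u} /\ jet u x (du x) (Hu x).

(** The fourth root s of the squared distance is half a power of the distance:
    the modulus of continuity is its square root. *)
Lemma fourth_root_jet x y : 0 < sqn (x - y) ->
  let s := Num.sqrt (Num.sqrt (sqn (x - y))) in
  [/\ 0 < s, sqn (x - y) = s ^+ 4 &
   jet (fun x => Num.sqrt (Num.sqrt (sqn (x - y)))) x ((2 * s ^+ 3)^-1 *: (x - y))
    ((2 * s ^+ 3)^-1%:M - (3 / (4 * s ^+ 7)) *: tens (x - y))].
Proof.
move=> q0 s.
have s0 : 0 < s by rewrite !sqrtr_gt0.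
have qs : sqn (x - y) = s ^+ 4.
  by rewrite (_ : s ^+ 4 = (s ^+ 2) ^+ 2); [rewrite !sqr_sqrtr ?sqrtr_ge0 ?sqn_ge0 | rewrite -exprM].
split => //.
have sE (t : R) : 0 <= t -> t `^ (4^-1) = Num.sqrt (Num.sqrt t).
  move=> t0; rewrite -!powR12_sqrt ?powR_ge0// -powRrM; congr (_ `^ _).
  by field.
have := powR_sqn_jet 4^-1 q0; set J := jet _ _ _ _; move=> hJ.
have s3 : sqn (x - y) `^ (4^-1 - 1) = (s ^+ 3)^-1.
  by rewrite powRB ?(gt_eqF q0) ?implybT// powRr1 ?sqn_ge0// sE ?sqn_ge0// -/s qs; field; exact: lt0r_neq0.
have s7 : sqn (x - y) `^ (4^-1 - 2) = (s ^+ 7)^-1.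
  have -> : 4^-1 - 2 = 4^-1 - 1 - 1 :> R by field.
  by rewrite powRB ?(gt_eqF q0) ?implybT// powRr1 ?sqn_ge0// s3 qs; field; exact: lt0r_neq0.
have : jet (fun x => sqn (x - y) `^ 4^-1) x ((2 * s ^+ 3)^-1 *: (x - y))
    ((2 * s ^+ 3)^-1%:M - (3 / (4 * s ^+ 7)) *: tens (x - y)).
  apply: (jet_eq hJ); rewrite ?s3 ?s7.
    by congr (_ *: _); field; exact: lt0r_neq0.
  rewrite -scaleNr; congr (_%:M + _ *: _); field; exact: lt0r_neq0.
move=> /= j4; apply: jet_near j4; near=> w.
by rewrite sE// sqn_ge0.
Unshelve. all: by end_near. Qed.

Section Doubling.
Variables (e K R0 : R) (a : V -> 'M[R]_n) (b : V -> V).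
Variables (u : V -> R) (du : V -> V) (Hu : V -> 'M[R]_n).
Variables (z x y : V) (M k : R).
Hypothesis u_x : jet u x (du x) (Hu x).
Hypothesis u_y : jet u y (du y) (Hu y).
Hypothesis q0 : 0 < sqn (x - y).
Let F X Y := u X - u Y - M * Num.sqrt (Num.sqrt (sqn (X - Y))) - k * (sqn (X - z) + sqn (Y - z)).
Let w := x - y.
Let s := Num.sqrt (Num.sqrt (sqn w)).
Hypothesis Fmax : forall p p', \forall t \near (0 : R), F (x + t *: p) (y + t *: p') <= F x y.

(** The conditions of first and second order for the maximum of [F] in the direction [(p, p')] of
    the product space. As [p] and [p'] are independent, each later comparison may choose its own
    pairing of directions at [x] with directions at [y]. *)
Lemma doubling_max p p' :
  dot (du x) p - dot (du y) p' =
    M * ((2 * s ^+ 3)^-1 * dot w (p - p')) + 2 * k * (dot (x - z) p + dot (y - z) p') /\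
  quad (Hu x) p - quad (Hu y) p' <=
    M * ((2 * s ^+ 3)^-1 * sqn (p - p') - 3 / (4 * s ^+ 7) * dot w (p - p') ^+ 2)
      + 2 * k * (sqn p + sqn p').
Proof.
have [s0 qs J] := fourth_root_jet q0.
have h := D2D (D2D (D2D (u_x p) (D2N (u_y p'))) (D2N (D2Z M (J (p - p')))))
  (D2N (D2Z k (D2D (sqn_jet x z p) (sqn_jet y z p')))).
have FE : (fun t : R => F (x + t *: p) (y + t *: p')) =1 (fun t => u (x + t *: p) - u (y + t *: p')
    - M * Num.sqrt (Num.sqrt (sqn (x + t *: (p - p') - y)))
    - k * (sqn (x + t *: p - z) + sqn (y + t *: p' - z))).
  move=> t; rewrite /F.
  have -> // : x + t *: p - (y + t *: p') = x + t *: (p - p') - y.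
  by apply/rowP => i; rewrite !mxE; ring.
have {}h := D2_ext (fsym FE) h.
have := D2_max _ h; rewrite !scale0r !addr0 => /(_ (Fmax p p')).
rewrite !dotZl quadD quadN quadZl quad_tens !quad_scalar -/s -/w => -[h1 h2].
by split; lra.
Qed.

Lemma doubling_grad : du x = (M / (2 * s ^+ 3)) *: w + (2 * k) *: (x - z) /\
  du y = (M / (2 * s ^+ 3)) *: w - (2 * k) *: (y - z).
Proof.
split; apply/rowP => i; rewrite -!dot_delta.
  have [] := doubling_max (delta_mx 0 i) 0.
  rewrite subr0 !dot0r subr0 addr0 => -> _; rewrite !(dotDl, dotNl, dotZl); ring.
have [] := doubling_max 0 (delta_mx 0 i).
rewrite sub0r !dot0r sub0r add0r dotNr => /eqP; rewrite eqr_oppLR => /eqP -> _.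
by rewrite !(dotDl, dotNl, dotZl); ring.
Qed.

Hypothesis M0 : 0 <= M.
Hypothesis k0 : 0 <= k.
Hypothesis K0 : 0 <= K.
Hypothesis Ax : [/\ (a x)^T = a x, near_id (offw R n) (a x) & `|b x| <= K].
Hypothesis Ay : [/\ (a y)^T = a y, near_id (offw R n) (a y) & `|b y| <= K].
Hypothesis Axy : forall i j, `|a x i j - a y i j| <= K * `|w|.
Hypothesis xz : `|x - z| <= 1.
Hypothesis yz : `|y - z| <= 1.

(** The squares composing [a x] and [a y] are paired one by one. Basis vectors are paired with their
    reflections, and this alone yields the negative term, from the concavity of the square root of
    the distance; [e_i + e_j] is scaled by the roots of its two weights, which costs the square of a
    Lipschitz difference; [e_i - e_j] is paired with itself and feels only the term in [k]. *)
Lemma doubling_mxdot :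
  mxdot (a x) (Hu x) - mxdot (a y) (Hu y) <=
   M / s ^+ 3 * (- 2^-1 + 2 * n%:R ^+ 4 * K ^+ 2 / offw R n * s ^+ 4) + (2 * n%:R + 32 * n%:R ^+ 2) * k.
Proof.
have nR : 1 <= n%:R :> R by rewrite ler1n.
have [s0 qs _] := fourth_root_jet q0; rewrite -/w -/s in s0 qs.
have w0 := offw_gt0 R n0.
have w1 : offw R n <= 1 by rewrite invf_le1; lra.
case: Ax => xT xi xb; case: Ay => yT yi yb.
rewrite (mxdot_dirw _ xT) (mxdot_dirw _ yT) -(quad_reflection (Hu y) q0) -/w.
have s3 : 0 < s ^+ 3 by rewrite exprn_gt0.
(* Here [p - p' = (2 * w_j / sqn w) * w], and the two contributions of the fourth root are 2 and -3
   times [M * w_j^2 / s^7]; the sum over j is [- M / s^3] since [sqn w = s^4]. *)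
have T1 : \sum_j quad (Hu x) (delta_mx 0 j) - \sum_j quad (Hu y) (delta_mx 0 j - (2 * w 0 j / sqn w) *: w)
   <= - (M / s ^+ 3) + 4 * n%:R * k.
  rewrite -sumrB.
  apply: (@le_trans _ _ (\sum_j (- (M / s ^+ 3) / sqn w * w 0 j ^+ 2 + 4 * k))).
    apply: ler_sum => j _; have [_ h] := doubling_max (delta_mx 0 j) (delta_mx 0 j - (2 * w 0 j / sqn w) *: w).
    apply: le_trans h _; rewrite sqn_delta sqn_reflection//.
    rewrite (subKr (delta_mx 0 j)) sqnZ dotZr -sqn_dot qs le_eqVlt; apply/orP; left; apply/eqP.
    by field; exact: lt0r_neq0.
  rewrite big_split/= -mulr_sumr sum_ord_const -/(sqn w) le_eqVlt; apply/orP; left; apply/eqP.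
  by rewrite qs; field; rewrite lt0r_neq0.
have T2 : \sum_i \sum_j dirw (a x) i j * quad (Hu x) (delta_mx 0 i + delta_mx 0 j)
   - \sum_i \sum_j dirw (a y) i j * quad (Hu y) (delta_mx 0 i + delta_mx 0 j)
   <= n%:R * (n%:R * (M / s ^+ 3 * (2 * n%:R ^+ 2 * K ^+ 2 / offw R n * s ^+ 4) + 16 * k)).
  rewrite -sumrB -sum_ord_const; apply: ler_sum => i _.
  rewrite -sumrB -sum_ord_const; apply: ler_sum => j _.
  set bx := dirw (a x) i j; set by' := dirw (a y) i j; set ee := delta_mx 0 i + delta_mx 0 j.
  have bx1 : bx <= 1 by exact: dirw_le.
  have by1 : by' <= 1 by exact: dirw_le.
  have bx0 := dirw_ge i j xi; have by0 := dirw_ge i j yi; rewrite -/bx -/by' in bx0 by0.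
  have [_ h] := doubling_max (Num.sqrt bx *: ee) (Num.sqrt by' *: ee).
  rewrite !quadZv -scalerBl !sqnZ !sqr_sqrtr in h; try by lra.
  apply: le_trans h _.
  have e4 : sqn ee <= 4.
    by rewrite -(sqn_delta_pm i j) lerDl sqn_ge0.
  have e0 := sqn_ge0 ee.
  have d1 : (Num.sqrt bx - Num.sqrt by') ^+ 2 <= (n%:R ^+ 2 * K ^+ 2 / offw R n) * s ^+ 4.
    apply: le_trans (sqrt_sub_sqr_le w0 bx0 by0) _.
    rewrite ler_pdivrMr// -qs.
    have l1 : `|bx - by'| <= n%:R * (K * `|w|).
      by apply: dirw_lip => //; rewrite mulr_ge0.
    rewrite -(real_normK (num_real _)).
    have l2 := sqn_ge w n0.
    apply: (@le_trans _ _ ((n%:R * (K * `|w|)) ^+ 2)).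
      by rewrite lerXn2r ?nnegrE// !mulr_ge0//; lra.
    have -> : (n%:R * (K * `|w|)) ^+ 2 = n%:R ^+ 2 * K ^+ 2 * `|w| ^+ 2 by ring.
    have -> : n%:R ^+ 2 * K ^+ 2 / offw R n * sqn w * offw R n = n%:R ^+ 2 * K ^+ 2 * sqn w by field; exact: lt0r_neq0.
    by rewrite ler_wpM2l// mulr_ge0// sqr_ge0.
  apply: lerD.
    apply: (@le_trans _ _ (M * ((2 * s ^+ 3)^-1 * ((Num.sqrt bx - Num.sqrt by') ^+ 2 * sqn ee)))).
      rewrite ler_wpM2l// lerBlDr lerDl mulr_ge0 ?sqr_ge0//.
      by rewrite divr_ge0// mulr_ge0// exprn_ge0// ltW.
    have -> : M / s ^+ 3 * (2 * n%:R ^+ 2 * K ^+ 2 / offw R n * s ^+ 4) =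
        M * ((2 * s ^+ 3)^-1 * (((n%:R ^+ 2 * K ^+ 2 / offw R n) * s ^+ 4) * 4)).
      by field; rewrite !lt0r_neq0.
    rewrite ler_wpM2l// ler_wpM2l//; first by rewrite invr_ge0 mulr_ge0// ltW.
    by apply: ler_pM => //; exact: sqr_ge0.
  have : bx * sqn ee + by' * sqn ee <= 8.
    have h1 : bx * sqn ee <= 1 * 4 by apply: ler_pM => //; lra.
    have h2 : by' * sqn ee <= 1 * 4 by apply: ler_pM => //; lra.
    lra.
  move=> h8; have -> : 16 * k = 2 * k * 8 by ring.
  by rewrite ler_wpM2l// mulr_ge0.
have T3 : \sum_i \sum_j offw R n * quad (Hu x) (delta_mx 0 i - delta_mx 0 j)
   - \sum_i \sum_j offw R n * quad (Hu y) (delta_mx 0 i - delta_mx 0 j)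
   <= n%:R * (n%:R * (16 * k)).
  rewrite -sumrB -sum_ord_const; apply: ler_sum => i _.
  rewrite -sumrB -sum_ord_const; apply: ler_sum => j _.
  set ee := delta_mx 0 i - delta_mx 0 j.
  have e4 : sqn ee <= 4.
    by rewrite -(sqn_delta_pm i j) lerDr sqn_ge0.
  have e0 := sqn_ge0 ee.
  have [_ h] := doubling_max ee ee.
  rewrite subrr sqn0 dot0r expr0n/= !mulr0 subr0 mulr0 add0r in h.
  rewrite -mulrBr.
  apply: (@le_trans _ _ (offw R n * (2 * k * (sqn ee + sqn ee)))); first by rewrite ler_pM2l.
  have h16 : 2 * k * (sqn ee + sqn ee) <= 16 * k.
    have -> : 16 * k = 2 * k * 8 by ring.
    by rewrite ler_wpM2l ?mulr_ge0//; lra.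
  rewrite -[X in _ <= X]mul1r; apply: ler_pM => //; first exact: ltW.
  by rewrite !mulr_ge0//; lra.
move: T1 T2 T3; set A1 := \sum_j quad _ _; set A2 := \sum_j quad _ _.
set B1 := \sum_i _; set B2 := \sum_i _; set C1 := \sum_i _; set C2 := \sum_i _ => T1 T2 T3.
have -> : M / s ^+ 3 * (- 2^-1 + 2 * n%:R ^+ 4 * K ^+ 2 / offw R n * s ^+ 4) + (2 * n%:R + 32 * n%:R ^+ 2) * k =
  2^-1 * (- (M / s ^+ 3) + 4 * n%:R * k) + n%:R * (n%:R * (M / s ^+ 3 * (2 * n%:R ^+ 2 * K ^+ 2 / offw R n * s ^+ 4) + 16 * k))
   + n%:R * (n%:R * (16 * k)).
  by field; rewrite !lt0r_neq0.
by lra.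
Qed.

(** The two gradients share the vector [M / (2 * s^3) * w], of size at most [M / (2 * s)]. This is
    of lower order than the gain [M / s^3], so the two drift terms can be bounded separately. *)
Lemma doubling_drift :
  dot (b x) (du x) - dot (b y) (du y) <= M / s ^+ 3 * (n%:R * K * s ^+ 2) + 4 * n%:R * K * k.
Proof.
have nR : 1 <= n%:R :> R by rewrite ler1n.
have [s0 qs _] := fourth_root_jet q0; rewrite -/w -/s in s0 qs.
case: Ax => _ _ xb; case: Ay => _ _ yb; have [-> ->] := doubling_grad.
have wn : `|w| <= s ^+ 2.
  rewrite -(ler_pXn2r (_ : (0 < 2)%N)) ?nnegrE ?sqr_ge0//.
  by rewrite -exprM -qs sqn_ge.
have g0 : 0 <= M / (2 * s ^+ 3) by rewrite divr_ge0// mulr_ge0// exprn_ge0// ltW.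
have B (v d : V) : `|d| <= K -> `|v| <= 1 -> `|dot d ((M / (2 * s ^+ 3)) *: w + (2 * k) *: v)| <=
   n%:R * K * (M / (2 * s ^+ 3) * s ^+ 2 + 2 * k).
  move=> dK v1; apply: le_trans (dot_norm_le _ _) _.
  apply: ler_pM => //; first by rewrite ler_wpM2l.
  apply: le_trans (ler_normD _ _) _; rewrite (normrZ (M / (2 * s ^+ 3)) w) (normrZ (2 * k) v).
  rewrite (ger0_norm g0) (ger0_norm (_ : 0 <= 2 * k)) ?mulr_ge0//.
  by rewrite lerD ?ler_wpM2l// -[X in _ <= X]mulr1 ler_wpM2l// mulr_ge0.
have := B (x - z) _ xb xz; rewrite ler_norml => /andP[_ h1].
have := B (- (y - z)) _ yb; rewrite normrN => /(_ yz); rewrite scalerN ler_norml => /andP[h2 _].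
have -> : M / s ^+ 3 * (n%:R * K * s ^+ 2) + 4 * n%:R * K * k = 2 * (n%:R * K * (M / (2 * s ^+ 3) * s ^+ 2 + 2 * k)).
  by field; rewrite lt0r_neq0.
lra.
Qed.

End Doubling.

End Oscillation.

(** * Oscillation and Harnack estimates *)

(** Here [t^2] is the radius. [M * s <= 2 * N] forces [C * s <= 2 * t], which makes the errors
    [A * s^4 + B * s^2] at most 1/4, so that [M / s^3] is at most [8 * (1 + c1 + c2)] times
    [N / t^4]. The same inequality makes [M / s^3] at least [C^4 / 8] times [N / t^4], which is more
    for this [C]. *)
Lemma modulus_contradiction (R : realType) (A B c1 c2 C N t s M k X Y : R) :
  0 <= A -> 0 <= B -> 0 <= c1 + c2 -> C = 16 * (A + B + 1) + 64 * (1 + (c1 + c2)) + 1 ->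
  0 < N -> 0 < t -> t <= 1 -> 0 < s -> M = C * N / t -> k = 2 * N / (t ^+ 2) ^+ 2 -> M * s <= 2 * N ->
  X <= M / s ^+ 3 * (- 2^-1 + A * s ^+ 4) + c1 * k ->
  Y <= M / s ^+ 3 * (B * s ^+ 2) + c2 * k ->
  - (2 * (N / (t ^+ 2) ^+ 2)) <= X + Y -> False.
Proof.
move=> A0 B0 c0 CE N0 t0 t1 s0 ME kE sM XE YE XY.
have C1 : 1 <= C by lra.
have C0 : 0 < C by lra.
have CA : 16 * (A + B) <= C by lra.
have C16 : 16 <= C by lra.
have Cc : 64 * (1 + (c1 + c2)) < C by lra.
clear CE; set c := c1 + c2 in c0 Cc.
have sC : C * s <= 2 * t.
  rewrite -(ler_pM2l N0); have : M * s * t <= 2 * N * t by rewrite ler_wpM2r// ltW.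
  have -> : M * s * t = N * (C * s) by rewrite ME; field; rewrite lt0r_neq0.
  by rewrite [2 * N]mulrC -[N * 2 * t]mulrA.
have s20 : 0 <= s ^+ 2 by exact: sqr_ge0.
have Cs0 : 0 <= C * s by rewrite mulr_ge0 ?ltW.
have s1 : s ^+ 2 * C <= 4.
  have h1 : (C * s) * (C * s) <= 2 * 2.
    have Cs2 : C * s <= 2 by clear -sC t1; lra.
    by apply: ler_pM.
  have h2 : s ^+ 2 * C <= (C * s) * (C * s).
    have -> : (C * s) * (C * s) = s ^+ 2 * C * C by ring.
    by rewrite ler_peMr// mulr_ge0// ltW.
  by clear -h1 h2; lra.
have sE1 : (A + B) * s ^+ 2 <= 4^-1.
  have h : s ^+ 2 * (16 * (A + B)) <= s ^+ 2 * C by rewrite ler_wpM2l.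
  by clear -h s1; lra.
have s2le1 : s ^+ 2 <= 1.
  have h : s ^+ 2 * 16 <= s ^+ 2 * C by rewrite ler_wpM2l.
  by clear -h s1; lra.
have err : A * s ^+ 4 + B * s ^+ 2 <= 4^-1.
  apply: le_trans sE1; rewrite mulrDl lerD2r; apply: ler_wpM2l => //.
  by rewrite -[4%N]/(2 * 2)%N exprM -[X in _ <= X]expr1 ler_wiXn2l.
have s30 : 0 < s ^+ 3 by rewrite exprn_gt0.
have M0 : 0 < M by rewrite ME divr_gt0// mulr_gt0.
have Ms0 : 0 <= M / s ^+ 3 by rewrite ltW// divr_gt0.
have {}kE : k = 2 * (N / (t ^+ 2) ^+ 2) by rewrite kE; ring.
set P := N / (t ^+ 2) ^+ 2 in kE XY.
have P0 : 0 < P by rewrite divr_gt0// !exprn_gt0.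
have main : 4^-1 * (M / s ^+ 3) <= (2 + 2 * c) * P.
  have h1 : M / s ^+ 3 * (A * s ^+ 4 + B * s ^+ 2) <= M / s ^+ 3 * 4^-1 by rewrite ler_wpM2l.
  rewrite mulrDr in h1; rewrite mulrDr in XE.
  have h2 : (2 + 2 * c) * P = 2 * P + (c1 * k + c2 * k) by rewrite kE /c; ring.
  rewrite h2; clear -h1 XE YE XY; set T := M / _ in h1 XE YE *; lra.
have big : C ^+ 4 * P <= 8 * (M / s ^+ 3).
  have Ct : (C * s) ^+ 3 <= (2 * t) ^+ 3.
    by rewrite lerXn2r ?nnegrE// mulr_ge0// ltW.
  rewrite /P ME.
  have -> : C ^+ 4 * (N / (t ^+ 2) ^+ 2) = (C * N / (t ^+ 4 * s ^+ 3)) * (C * s) ^+ 3.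
    by field; rewrite !lt0r_neq0.
  have -> : 8 * (C * N / t / s ^+ 3) = (C * N / (t ^+ 4 * s ^+ 3)) * (2 * t) ^+ 3.
    by field; rewrite !lt0r_neq0.
  by rewrite ler_wpM2l// ltW// divr_gt0// mulr_gt0// exprn_gt0.
have h3 : C * P <= C ^+ 4 * P by rewrite ler_pM2r// -[X in X <= _]expr1 ler_weXn2l.
have h4 : 64 * (1 + c) * P < C * P by rewrite ltr_pM2r.
clear -h3 h4 main big; set T := M / _ in main big; lra.
Qed.

Section OscillationBound.
Variables (R : realType) (n : nat).
Hypothesis n0 : (0 < n)%N.
Notation V := 'rV[R]_n.
Implicit Types (x y z p d : V) (H : 'M[R]_n) (u : V -> R).

Lemma box_product_max (z : V) (r : R) (F : V -> V -> R) : 0 <= r ->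
  (forall x y, `|x - z| <= r -> `|y - z| <= r -> {for (x, y), continuous (fun p : V * V => F p.1 p.2)}) ->
  exists x y, [/\ `|x - z| <= r, `|y - z| <= r &
    forall X Y, `|X - z| <= r -> `|Y - z| <= r -> F X Y <= F x y].
Proof.
move=> r0 cF; pose D := [set x : V | `|x - z| <= r].
have [|||[x y]] := @compact_EVT_max _ R (fun p : V * V => F p.1 p.2) (D `*` D).
- by exists (z, z); rewrite /D /= subrr normr0.
- by apply: compact_setX; exact: box_compact.
- by apply: continuous_in_subspaceT => -[x y]; rewrite inE => -[/= hx hy]; exact: cF.
rewrite inE => -[/= hx hy] h; exists x, y; split => // X Y hX hY.
by apply: (h (X, Y)); rewrite inE.
Qed.

(** [F] is shown to be nonpositive on pairs of points of the box; with one point at the centre [z]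
    this bounds the oscillation by [M] times the square root of the distance plus [k] times its
    square. A positive maximum of [F] would lie off the diagonal, where [F] is nonpositive, and
    inside the box, because of [k]; there the two derivative inequalities contradict the bound on
    the operator. *)
Lemma oscillation_bound (K : R) : 0 <= K -> forall th : R, 0 < th -> exists2 c : R, 0 < c <= 1 &
  forall R0 a b, elliptic (offw R n) R0 K a b ->
  forall u du Hu z (r N : R), 0 < r <= 1 -> (forall x, `|x - z| <= r -> `|x| <= R0) ->
  regular u du Hu z r ->
  (forall x, `|x - z| <= r -> `|u x| <= N) ->
  (forall x, `|x - z| <= r -> `|Lop (a x) (b x) (du x) (Hu x)| <= N / r ^+ 2) ->
  forall x, `|x - z| <= c * r -> `|u x - u z| <= th * N.
Proof.
move=> K0 th th0.
have nR : 1 <= n%:R :> R by rewrite ler1n.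
have w0 := offw_gt0 R n0.
pose E1 : R := 2 * n%:R ^+ 4 * K ^+ 2 / offw R n + n%:R * K.
pose C2 : R := 2 * n%:R + 32 * n%:R ^+ 2 + 4 * n%:R * K.
have E10 : 0 <= E1.
  by rewrite addr_ge0// ?mulr_ge0// ?invr_ge0 ?exprn_ge0// ?sqr_ge0// ltW.
have C20 : 0 <= C2 by rewrite !addr_ge0// !mulr_ge0.
pose C : R := 16 * (E1 + 1) + 64 * (1 + C2) + 1.
have C1 : 1 <= C by rewrite /C; lra.
have C1E : C = 16 * (2 * n%:R ^+ 4 * K ^+ 2 / offw R n + n%:R * K + 1) + 64 * (1 + (2 * n%:R + 32 * n%:R ^+ 2 + 4 * n%:R * K)) + 1 by [].
(* Gives [4 * C * n * c0 <= th] and [c0 <= 1]. The radius is shrunk by [c0^2] because the modulus is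
   a square root. *)
pose c0 : R := th / (4 * C * n%:R + th).
have c0d : 0 < 4 * C * n%:R + th by rewrite ltr_wpDl// !mulr_ge0//; lra.
have c0_gt0 : 0 < c0 by rewrite divr_gt0.
have c0_le1 : c0 <= 1.
  by rewrite ler_pdivrMr// mul1r lerDr !mulr_ge0//; lra.
have Cc : 4 * C * n%:R * c0 <= th.
  rewrite mulrA ler_pdivrMr// [X in X <= _]mulrC ler_wpM2l ?ltW//; lra.
clearbody c0; clear c0d E10 C20; clearbody C; clear E1 C2.
exists (c0 ^+ 2); first by rewrite exprn_gt0//= expr_le1// ltW.
move=> R0 a b [ell lip] u du Hu z r N /andP[r0 r1] sub reg uN LN.
have zz : `|z - z| <= r by rewrite subrr normr0 ltW.
have N0 : 0 <= N by apply: le_trans (uN z zz).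
pose k : R := 2 * N / r ^+ 2.
pose t : R := Num.sqrt r.
have t0 : 0 < t by rewrite sqrtr_gt0.
have tr : t ^+ 2 = r by rewrite sqr_sqrtr// ltW.
pose M : R := C * N / t.
have k0 : 0 <= k by apply: divr_ge0; [exact: mulr_ge0 | exact: sqr_ge0].
have M0 : 0 <= M by apply: divr_ge0; [apply: mulr_ge0 => //; lra | exact: ltW].
pose rt x y : R := Num.sqrt (Num.sqrt (sqn (x - y))).
pose F x y : R := u x - u y - M * rt x y - k * (sqn (x - z) + sqn (y - z)).
have Fle0 X Y : `|X - z| <= r -> `|Y - z| <= r -> F X Y <= 0.
  have [|x [y [xr yr mx]]] := @box_product_max z r F (ltW r0).
    move=> x y xr yr; rewrite /F.
    have cf : (fst : V * V -> V) @ (x, y) --> x by exact: cvg_fst.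
    have cs : (snd : V * V -> V) @ (x, y) --> y by exact: cvg_snd.
    apply: cvgB; [apply: cvgB; [apply: cvgB|]|].
    - exact: (cvg_comp _ _ cf (proj1 (reg x xr))).
    - exact: (cvg_comp _ _ cs (proj1 (reg y yr))).
    - apply: cvgMl_tmp; rewrite /rt.
      have cxy : (fun p : V * V => p.1 - p.2) @ (x, y) --> x - y by exact: cvgB.
      apply: (cvg_comp _ _ (cvg_comp _ _ (cvg_comp _ _ cxy (@sqn_continuous _ _ (x - y))) (@sqrt_continuous R _)) (@sqrt_continuous R _)).
    - apply: cvgMl_tmp; apply: cvgD.
      + exact: (cvg_comp _ _ cf (@sqn_sub_continuous _ _ z x)).
      + exact: (cvg_comp _ _ cs (@sqn_sub_continuous _ _ z y)).
  move=> Xr Yr; apply: le_trans (mx X Y Xr Yr) _; rewrite leNgt; apply/negP => Fpos.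
  have rt0 X' Y' : 0 <= rt X' Y' by exact: sqrtr_ge0.
  have u2 : u x - u y <= 2 * N.
    have := uN x xr; have := uN y yr; rewrite !ler_norml => /andP[? ?] /andP[? ?]; lra.
  have [sx sy] := (sqn_ge0 (x - z), sqn_ge0 (y - z)).
  have Mrt : 0 <= M * rt x y by exact: mulr_ge0.
  have kr : k * r ^+ 2 = 2 * N by rewrite /k; field; rewrite lt0r_neq0.
  (* [k * r^2 = 2 * N] outweighs the whole oscillation of [u], so a positive value of [F] excludes
     the boundary of the box. *)
  have inner w : sqn (w - z) <= sqn (x - z) + sqn (y - z) -> `|w - z| <= r -> `|w - z| < r.
    move=> ws wr; rewrite lt_neqAle wr andbT; apply/eqP => wE.
    have : k * r ^+ 2 <= k * (sqn (x - z) + sqn (y - z)).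
      by rewrite ler_wpM2l//; apply: le_trans ws; rewrite -wE sqn_ge.
    by rewrite kr; move: Fpos; rewrite /F; lra.
  have {}xr' : `|x - z| < r by apply: inner => //; lra.
  have {}yr' : `|y - z| < r by apply: inner => //; lra.
  have kk : 0 <= k * (sqn (x - z) + sqn (y - z)) by rewrite mulr_ge0// addr_ge0.
  have q0 : 0 < sqn (x - y).
    apply: sqn_gt0 => //; apply/eqP => /subr0_eq xy.
    by move: Fpos; rewrite /F -xy subrr; rewrite -xy in Mrt kk; lra.
  have [s0 qs _] := fourth_root_jet q0; set s := Num.sqrt (Num.sqrt _) in s0 qs.
  have sM : M * s <= 2 * N by move: Fpos; rewrite /F /rt -/s; lra.
  have Fmax p p' : \forall h \near (0 : R), F (x + h *: p) (y + h *: p') <= F x y.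
    have nx := nbhs_line p (box_nbhs xr').
    have ny := nbhs_line p' (box_nbhs yr').
    by near=> h; apply: mx; apply: ltW; near: h.
  have N_gt0 : 0 < N.
    rewrite lt_neqAle N0 andbT; apply/eqP => N00.
    have := uN x xr; have := uN y yr; rewrite -N00 !normr_le0 => /eqP uy /eqP ux.
    by move: Fpos; rewrite /F ux uy; lra.
  have Ax := ell x (sub x xr); have Ay := ell y (sub y yr).
  have Axy := lip x y (sub x xr) (sub y yr).
  have xz1 : `|x - z| <= 1 by exact: le_trans r1.
  have yz1 : `|y - z| <= 1 by exact: le_trans r1.
  have D1 := @doubling_mxdot _ _ n0 K a b u du Hu z x y M k (proj2 (reg x xr)) (proj2 (reg y yr)) q0 Fmax M0 k0 K0 Ax Ay Axy.
  have D2' := @doubling_drift _ _ n0 K a b u du Hu z x y M k (proj2 (reg x xr)) (proj2 (reg y yr)) q0 Fmax M0 k0 Ax Ay xz1 yz1.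
  rewrite -/s in D1 D2'.
  have Lx := LN x xr; have Ly := LN y yr; move: Lx Ly; rewrite !ler_norml /Lop => /andP[Lx _] /andP[_ Ly].
  apply: (@modulus_contradiction _ _ _ _ _ C N t s M k _ _ _ _ _ C1E N_gt0 t0 _ s0 erefl _ sM D1 D2').
  - by rewrite !mulr_ge0 ?invr_ge0 ?exprn_ge0 ?sqr_ge0// ltW.
  - exact: mulr_ge0.
  - by rewrite !addr_ge0// !mulr_ge0.
  - by rewrite leNgt; apply/negP => t1; have := tr; clear -t1 t0 r1; nra.
  - by rewrite tr.
  - by rewrite tr; clear -Lx Ly; lra.
move=> x xc.
have cr : c0 ^+ 2 * r <= r by apply: ler_piMl; [exact: ltW | rewrite expr_le1// ltW].
have xr : `|x - z| <= r by exact: le_trans cr.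
have xq : sqn (x - z) <= n%:R ^+ 4 * (c0 * t) ^+ 4.
  apply: le_trans (sqn_le _) _; apply: ler_pM => //; first by rewrite -[X in X <= _]expr1 ler_weXn2l.
  have -> : (c0 * t) ^+ 4 = (c0 ^+ 2 * r) ^+ 2 by rewrite -tr; ring.
  by rewrite lerXn2r ?nnegrE// mulr_ge0 ?sqr_ge0// ltW.
have xrt : rt x z <= n%:R * (c0 * t).
  have s4 : (n%:R * (c0 * t)) ^+ 4 = n%:R ^+ 4 * (c0 * t) ^+ 4 by ring.
  have p0 : 0 <= n%:R * (c0 * t) by rewrite mulr_ge0// mulr_ge0// ltW.
  rewrite /rt; have := ler_wsqrtr (ler_wsqrtr xq).
  rewrite -s4 (_ : (n%:R * (c0 * t)) ^+ 4 = ((n%:R * (c0 * t)) ^+ 2) ^+ 2); last by rewrite -exprM.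
  by rewrite sqrtr_sqr ger0_norm ?sqr_ge0// sqrtr_sqr ger0_norm.
have bnd : M * rt x z + k * sqn (x - z) <= th * N.
  have h1 : M * rt x z <= C * n%:R * c0 * N.
    have -> : C * n%:R * c0 * N = M * (n%:R * (c0 * t)) by rewrite /M; field; rewrite lt0r_neq0.
    by rewrite ler_wpM2l.
  have h2 : k * sqn (x - z) <= 2 * n%:R * c0 * N.
    apply: (@le_trans _ _ (k * (n%:R * (c0 ^+ 2 * r) ^+ 2))).
      rewrite ler_wpM2l//; apply: le_trans (sqn_le _) _; rewrite ler_wpM2l//.
      by rewrite lerXn2r ?nnegrE// mulr_ge0 ?sqr_ge0// ltW.
    have -> : k * (n%:R * (c0 ^+ 2 * r) ^+ 2) = 2 * n%:R * N * c0 ^+ 4 by rewrite /k; field; rewrite lt0r_neq0.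
    have -> : 2 * n%:R * c0 * N = 2 * n%:R * N * c0 ^+ 1 by ring.
    by apply: ler_wpM2l; [rewrite !mulr_ge0 | rewrite ler_wiXn2l// ltW].
  have h3 : 4 * C * n%:R * c0 * N <= th * N by rewrite ler_wpM2r.
  have h4 : n%:R * c0 * N <= C * (n%:R * c0 * N) by rewrite ler_peMl// !mulr_ge0// ltW.
  have h5 : 0 <= n%:R * c0 * N by rewrite mulr_ge0// mulr_ge0// ltW.
  clear -h1 h2 h3 h4 h5; clearbody k M; lra.
have := Fle0 x z xr zz; have := Fle0 z x zz xr.
rewrite /F subrr sqn0 addr0 add0r (_ : rt z x = rt x z); last first.
  by rewrite /rt -opprB -[- (x - z)]scaleN1r sqnZ sqrrN expr1n mul1r.
by move=> f1 f2; clear -f1 f2 bnd; clearbody M k rt; rewrite ler_norml; apply/andP; split; lra.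
Unshelve. all: by end_near. Qed.

End OscillationBound.

(** * Comparison with radial powers and the Harnack inequality *)

Section Harnack.
Variables (R : realType) (n : nat).
Hypothesis n3 : (3 <= n)%N.
Notation V := 'rV[R]_n.
Implicit Types (x y z p d : V) (H : 'M[R]_n) (u w : V -> R).

Let n0 : (0 < n)%N. Proof. exact: leq_trans n3. Qed.
Let nR : 3 <= n%:R :> R. Proof. by rewrite ler_nat. Qed.
Let be : R := pexp R n / 2.

Lemma norm_sub_continuous z : continuous (fun x : V => `|x - z|).
Proof.
move=> x; apply: (@continuous_comp _ _ _ (fun x : V => x - z) (fun x => `|x|)).
  exact: sub_cst_continuous.
exact: norm_continuous.
Qed.

Lemma powR_sqn_continuous y (s : R) x : 0 < sqn (x - y) ->
  {for x, continuous (fun x : V => sqn (x - y) `^ s)}.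
Proof.
move=> q0; apply: (@continuous_comp _ _ _ (fun x : V => sqn (x - y)) (fun t : R => t `^ s)).
  exact: sqn_sub_continuous.
apply: differentiable_continuous; apply/derivable1_diffP.
by have /@ex_derive := is_derive1_powR s q0.
Qed.

Lemma half_pexp_gt0 : 0 < be.
Proof. by have := pexp_gt1 R n3; rewrite /be; lra. Qed.

Lemma pexp_le_n : pexp R n <= n%:R.
Proof.
have h := nR; rewrite /pexp; have : n%:R^-1 <= 1 :> R by rewrite invf_le1; lra.
lra.
Qed.

Lemma powRN_le (s x y : R) : 0 <= s -> 0 < x -> x <= y -> y `^ (- s) <= x `^ (- s).
Proof.
move=> s0 x0 xy; have y0 : 0 < y by exact: lt_le_trans xy.
rewrite !powRN lef_pV2 ?posrE ?powR_gt0//.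
by apply: ge0_ler_powR => //; rewrite nnegrE ltW.
Qed.

Lemma elliptic_offw (R0 K : R) (a : V -> 'M[R]_n) (b : V -> V) : elliptic (eps0 R n) R0 K a b -> elliptic (offw R n) R0 K a b.
Proof.
move=> [h1 h2]; split => // x xR; have [aT ai bK] := h1 x xR; split => //.
exact: near_id_eps0.
Qed.

Lemma ler_wiXn2l_powR (x s t : R) : 0 < x -> x <= 1 -> s <= t -> x `^ t <= x `^ s.
Proof.
move=> x0 x1 st; have : (x^-1) `^ s <= (x^-1) `^ t by apply: ler_powR => //; rewrite invf_ge1.
by rewrite -(powR_inv1 (ltW x0)) -!powRrM !mulN1r !powRN lef_pV2 ?posrE ?powR_gt0.
Qed.

Section Fixed.
Variables (R0 K : R) (a : V -> 'M[R]_n) (b : V -> V).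
Hypothesis K0 : 0 <= K.
Hypothesis KR : 4 * n%:R ^+ 2 * K * R0 <= 1.
Hypothesis ell : elliptic (eps0 R n) R0 K a b.

Lemma radial_subsolution x y : `|x| <= R0 -> `|y| <= R0 -> 0 < sqn (x - y) ->
  exists d H, [/\ jet (fun x => sqn (x - y) `^ (- be)) x d H &
    n%:R^-1 * sqn (x - y) `^ (- be - 1) <= Lop (a x) (b x) d H].
Proof.
move=> xR yR q0; eexists; eexists; split; first exact: powR_sqn_jet.
have [_ ai bK] := (proj1 ell) x xR.
apply: (@Lop_powR _ _ n0 _ _ x y K (2 * R0)) => //.
  by apply: le_trans (ler_normB _ _) _; lra.
by have := KR; lra.
Qed.

(** [w - e * psi] cannot have a negative minimum between the boxes of radii [de] and [r]. On both
    boundaries it is nonnegative, as the Euclidean norm dominates the sup norm. At an interior point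
    where [w < e * psi], the operator is at least [n^-2 * psi / r^2] on [psi], hence larger on
    [e * psi] than on [w], which a minimum forbids. *)
Lemma barrier w dw Hw y (r de m : R) : 0 < de < r -> 0 < m ->
  (forall x, `|x - y| <= r -> `|x| <= R0) -> regular w dw Hw y r ->
  (forall x, `|x - y| <= r -> 0 < w x) ->
  (forall x, `|x - y| <= r -> Lop (a x) (b x) (dw x) (Hw x) <= n%:R ^- 2 * (w x / r ^+ 2)) ->
  (forall x, `|x - y| <= de -> m <= w x) ->
  forall x, sqn (x - y) <= r ^+ 2 / 4 -> m * ((de / r) ^+ 2) `^ be <= w x.
Proof.
have aux (A B C : R) : 2 * A <= B -> B <= C -> A <= C - A by move=> *; lra.
move=> /andP[de0 der] m0 sub reg w0 Lw wm.
have r0 : 0 < r by exact: lt_trans der.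
have be0 := half_pexp_gt0.
pose psi x := sqn (x - y) `^ (- be) - (r ^+ 2) `^ (- be).
pose e := m * (de ^+ 2) `^ be.
have e0 : 0 < e by rewrite mulr_gt0// powR_gt0// exprn_gt0.
have y_in : `|y| <= R0 by apply: sub; rewrite subrr normr0 ltW.
have q_gt0 x : de <= `|x - y| -> 0 < sqn (x - y).
  by move=> h; apply: sqn_gt0 => //; rewrite -normr_gt0; exact: lt_le_trans h.
have main x : de <= `|x - y| -> `|x - y| <= r -> e * psi x <= w x.
  move=> x1 x2; pose D := [set x : V | de <= `|x - y| <= r].
  have cD : compact D.
    have -> : D = [set x | `|x - y| <= r] `&` [set x | de <= `|x - y|].
      by apply/seteqP; split => z /=; [move=> /andP[] | move=> [? ?]; apply/andP].
    apply: compact_closedI; first exact: box_compact.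
    have -> : [set x : V | de <= `|x - y|] = (fun x => `|x - y|) @^-1` [set t | de <= t] by [].
    apply: closed_comp; last exact: closed_ge.
    by move=> z _; exact: norm_sub_continuous.
  have [||z] := @compact_EVT_min _ R (fun x => w x - e * psi x) D _ cD.
  - by exists x; rewrite /D /= x1.
  - apply: continuous_in_subspaceT => z; rewrite inE => /andP[z1 z2].
    apply: (cvgB (proj1 (reg z z2))).
    apply: cvgMl_tmp; apply: cvgB; last exact: cvg_cst.
    by apply: powR_sqn_continuous; exact: q_gt0.
  rewrite inE => /andP[z1 z2] mz.
  have := mz x; rewrite inE /D /= x1 x2 => /(_ isT) hx.
  suff : 0 <= w z - e * psi z by move=> /le_trans /(_ hx); rewrite subr_ge0.
  rewrite leNgt; apply/negP => neg.
  have z1' : de < `|z - y|.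
    rewrite lt_neqAle z1 andbT; apply/eqP => dz.
    have : psi z <= (de ^+ 2) `^ (- be).
      rewrite /psi lerBlDr; apply: ler_wpDr; first exact: powR_ge0.
      by apply: powRN_le; [exact: ltW | rewrite exprn_gt0 | rewrite dz sqn_ge].
    have := wm z; rewrite -dz lexx => /(_ isT) wz.
    rewrite -(ler_pM2l e0) /e -[X in _ <= X]mulrA -powRD; last by rewrite addrN eqxx/= gt_eqF// exprn_gt0.
    by rewrite addrN powRr0 mulr1 -/e; lra.
  have z2' : `|z - y| < r.
    rewrite lt_neqAle z2 andbT; apply/eqP => zr.
    have : psi z <= 0.
      by rewrite /psi subr_le0; apply: powRN_le; [exact: ltW | rewrite exprn_gt0 | rewrite -zr sqn_ge].
    by rewrite -(ler_pM2l e0) mulr0; have := w0 z z2; lra.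
  have [d [H [J LJ]]] := radial_subsolution (sub z z2) y_in (q_gt0 z z1).
  have [cw jw] := reg z z2.
  have JJ := jetD jw (jetN (jetZ e (jetD J (jetN (jet_cst ((r ^+ 2) `^ (- be)) z))))).
  have [aT ai _] := (proj1 (elliptic_offw ell)) z (sub z z2).
  have nearD : \forall x \near z, D x.
    have h1 := box_nbhs z2'.
    have h2 : \forall x \near z, de < `|x - y|.
      have := @norm_sub_continuous y z; move=> /(_ [set t | de < t]); apply; apply: open_nbhs_nbhs; split => //; exact: open_gt.
    by near=> t; apply/andP; split; apply: ltW; near: t.
  have := Lop_min n0 (b z) aT ai JJ; rewrite !oppr0 !addr0 LopD LopN LopZ => L.
  have /L{L} : \forall x \near z, w z + - (e * (sqn (z - y) `^ (- be) + - (r ^+ 2) `^ (- be)))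
     <= w x + - (e * (sqn (x - y) `^ (- be) + - (r ^+ 2) `^ (- be))).
    by near=> t; apply: mz; rewrite inE; near: t.
  have LW := Lw z z2.
  have h1 : n%:R ^- 2 * (w z / r ^+ 2) < n%:R ^- 2 * (e * psi z / r ^+ 2).
    rewrite ltr_pM2l ?invr_gt0 ?exprn_gt0 ?ltr0n//.
    by rewrite ltr_pM2r ?invr_gt0 ?exprn_gt0// -subr_lt0.
  have q0 := q_gt0 z z1.
  have h2 : n%:R ^- 2 * (psi z / r ^+ 2) <= n%:R^-1 * sqn (z - y) `^ (- be - 1).
    have -> : sqn (z - y) `^ (- be - 1) = sqn (z - y) `^ (- be) / sqn (z - y).
      by rewrite powRB ?powRr1 ?sqn_ge0// (gt_eqF q0) implybT.
    have qn : sqn (z - y) <= n%:R * r ^+ 2.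
      by apply: le_trans (sqn_le _) _; rewrite ler_wpM2l// lerXn2r ?nnegrE// ltW.
    have -> : n%:R ^- 2 * (psi z / r ^+ 2) = n%:R ^-1 * (psi z / (n%:R * r ^+ 2)).
      by field; rewrite !lt0r_neq0// ltr0n.
    rewrite ler_pM2l ?invr_gt0 ?ltr0n//.
    apply: (@le_trans _ _ (sqn (z - y) `^ (- be) / (n%:R * r ^+ 2))).
      rewrite ler_pM2r ?invr_gt0 ?mulr_gt0 ?exprn_gt0 ?ltr0n//.
      by rewrite /psi lerBlDr lerDl powR_ge0.
    rewrite ler_wpM2l ?powR_ge0// lef_pV2 ?posrE ?mulr_gt0 ?exprn_gt0 ?ltr0n//.
  have h3 : e * (n%:R ^- 2 * (psi z / r ^+ 2)) <= e * Lop (a z) (b z) d H.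
    by rewrite ler_pM2l//; exact: le_trans LJ.
  have h4 : e * (n%:R ^- 2 * (psi z / r ^+ 2)) = n%:R ^- 2 * (e * psi z / r ^+ 2) by ring.
  rewrite h4 in h3; have := le_lt_trans LW (lt_le_trans h1 h3).
  by rewrite -subr_lt0 => /lt_le_trans h /h; rewrite ltxx.
move=> x xq.
have dr : ((de / r) ^+ 2) `^ be = (de ^+ 2) `^ be * (r ^+ 2) `^ (- be).
  rewrite exprMn powRM ?sqr_ge0// powRN; congr (_ * _).
  by rewrite exprVn -(powR_inv1 (sqr_ge0 r)) -powRrM mulN1r powRN.
have [xd|xd] := ltP (`|x - y|) de.
  apply: le_trans (wm x (ltW xd)); rewrite -[X in _ <= X]mulr1 ler_pM2l//.
  have : ((de / r) ^+ 2) `^ be <= 1 `^ be.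
    have dr0 : 0 <= de / r by rewrite divr_ge0// ltW.
    apply: ge0_ler_powR; rewrite ?nnegrE ?sqr_ge0//; first exact: ltW.
    by rewrite expr_le1// ler_pdivrMr// mul1r ltW.
  by rewrite powR1.
have xr : `|x - y| <= r.
  rewrite -(ler_pXn2r (_ : (0 < 2)%N)) ?nnegrE//; last exact: ltW.
  apply: le_trans (sqn_ge _ n0) _; apply: le_trans xq _.
  by have : 0 <= r ^+ 2 by [exact: sqr_ge0]; lra.
apply: le_trans (main x xd xr); rewrite dr mulrA -/e ler_pM2l//.
(* Within Euclidean distance [r / 2] of [y] the constant subtracted in [psi] is at most half of the
   power, since [4^be >= 2]. *)
have : (r ^+ 2 / 4) `^ (- be) <= sqn (x - y) `^ (- be).
  by apply: powRN_le => //; [exact: ltW | exact: q_gt0].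
have -> : (r ^+ 2 / 4) `^ (- be) = 4 `^ be * (r ^+ 2) `^ (- be).
  rewrite mulrC powRM ?sqr_ge0// ?invr_ge0//; congr (_ * _).
  by rewrite -powR_inv1// -powRrM mulN1r opprK.
have : 2 * (r ^+ 2) `^ (- be) <= 4 `^ be * (r ^+ 2) `^ (- be).
  rewrite ler_wpM2r ?powR_ge0//.
  have : 4 `^ 2^-1 <= 4 `^ be :> R.
    apply: ler_powR; first by lra.
    by have := pexp_gt1 R n3; rewrite /be; lra.
  have -> : 4 `^ 2^-1 = 2 :> R.
    rewrite powR12_sqrt// (_ : 4 = 2 ^+ 2 :> R); last by ring.
    by rewrite sqrtr_sqr ger0_norm.
  by [].
by move=> h1 h2; exact: aux h1 h2.
Unshelve. all: by end_near. Qed.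

End Fixed.

(** [w] weighted by the n-th power of the distance to the boundary attains its maximum at some [xs],
    at distance [d] from the boundary, and [w <= 2^n * w xs] within [d / 2] of [xs]. The oscillation
    bound keeps [w] above half of [w xs] on a box of size [c * d / 2], and the barrier carries this
    to [z] with a loss of order [(d / r)^pexp]. The weight [d^n] absorbs the loss because
    [pexp <= n]. *)
Lemma harnack (K : R) : 0 <= K -> exists2 CH : R, 1 <= CH &
  forall R0 a b, 4 * n%:R ^+ 2 * K * R0 <= 1 -> elliptic (eps0 R n) R0 K a b ->
  forall w dw Hw z (r : R), 0 < r <= 1 -> (forall x, `|x - z| <= r -> `|x| <= R0) ->
  regular w dw Hw z r -> (forall x, `|x - z| <= r -> 0 < w x) ->
  (forall x, `|x - z| <= r -> `|Lop (a x) (b x) (dw x) (Hw x)| <= n%:R ^- 2 * (w x / r ^+ 2)) ->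
  forall x, `|x - z| <= r / (8 * n%:R) -> w x <= CH * w z.
Proof.
move=> K0; have nR' := nR.
(* This accuracy turns the bound [2^n * w xs] into an oscillation of at most [w xs / 2]. *)
have [|c /andP[c0 c1] osc] := @oscillation_bound R n n0 K K0 (2 ^- n / 2).
  by rewrite divr_gt0// invr_gt0 exprn_gt0.
pose CH : R := 2 * (8 * n%:R / c) ^+ n.
have c8 : 1 <= 8 * n%:R / c by rewrite ler_pdivlMr//; lra.
exists CH; first by have : 1 <= (8 * n%:R / c) ^+ n by [exact: exprn_ege1]; rewrite /CH; lra.
move=> R0 a b KR ell w dw Hw z r /andP[r0 r1] sub reg w0 Lw.
(* Small enough that [z] is within Euclidean distance [r / 4] of every point of the box, the range
   in which the barrier of radius [r / 2] is effective. *)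
pose rho := r / (4 * n%:R).
have n4 : 0 < 4 * n%:R :> R by lra.
have nge1 : 1 <= n%:R :> R by lra.
have nn0 : n%:R != 0 :> R by rewrite gt_eqF//; lra.
have rho0 : 0 < rho by rewrite divr_gt0.
have rhon : 4 * n%:R * rho = r by rewrite /rho mulrC divfK// gt_eqF.
have rho4 : 12 * rho <= r.
  by rewrite -rhon ler_pM2r//; lra.
pose G x := w x * (rho - `|x - z|) ^+ n.
have zz : `|z - z| <= rho by rewrite subrr normr0 ltW.
have [||xs] := @EVT_max_rV R n G [set x | `|x - z| <= rho] _ (@box_compact R n z rho).
- by exists z.
- apply: continuous_in_subspaceT => x; rewrite inE /= => xz.
  have xr : `|x - z| <= r by lra.
  apply: (cvgM (proj1 (reg x xr))).
  apply: (@continuous_comp _ _ _ (fun x : V => rho - `|x - z|) (fun t => t ^+ n)); last exact: exprn_continuous.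
  exact: (cvgB (cvg_cst rho) (@norm_sub_continuous z x)).
rewrite inE /= => xsz mx.
have {}mx x : `|x - z| <= rho -> G x <= G xs by move=> h; apply: mx; rewrite inE.
have xsr : `|xs - z| <= r by lra.
pose d := rho - `|xs - z|.
have Gz : 0 < G z.
  by rewrite /G mulr_gt0 ?w0 ?subrr ?normr0 ?subr0 ?exprn_gt0// ltW.
have d0 : 0 < d.
  rewrite lt_neqAle subr_ge0 xsz andbT; apply/eqP => dE.
  by have := mx z zz; rewrite leNgt /G -/d -dE expr0n gtn_eqF// mulr0 Gz.
have Kv0 : 0 < w xs by exact: w0.
have drho : d <= rho by rewrite /d lerBlDr lerDl.
have tri x y (s : R) : `|x - y| <= s -> `|x - z| <= s + `|y - z|.
  by move=> h; rewrite -(subrK y x) -addrA; apply: le_trans (ler_normD _ _) _; rewrite lerD2r.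
have inr x (s : R) : s <= r / 2 -> `|x - xs| <= s -> `|x - z| <= r.
  by move=> sr /tri h; apply: le_trans h _; clear -sr xsz rho4 rho0; lra.
have d2r : d / 2 <= r / 2 by clear -drho rho4 rho0; lra.
have wb x : `|x - xs| <= d / 2 -> w x <= 2 ^+ n * w xs.
  move=> xd; have xz := tri _ _ _ xd.
  have dx : d / 2 <= rho - `|x - z| by clear -xz; rewrite /d in xz *; lra.
  have xz' : `|x - z| <= rho by clear -xz d0; rewrite /d in xz d0 *; lra.
  have h1 : w x * (d / 2) ^+ n <= w xs * d ^+ n.
    apply: le_trans (mx x xz'); rewrite ler_pM2l; last by apply: w0; apply: inr xd.
    by rewrite lerXn2r// nnegrE; [exact: ltW (divr_gt0 d0 _) | rewrite subr_ge0].
  have d2 : 0 < (d / 2) ^+ n by rewrite exprn_gt0// divr_gt0.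
  rewrite -(ler_pM2r d2); apply: le_trans h1 _.
  by rewrite exprMn exprVn [2 ^+ n * _]mulrC -mulrA [2 ^+ n * _]mulrCA mulfV ?mulr1// gt_eqF// exprn_gt0.
have n1 : n%:R ^- 2 <= 1 :> R by rewrite invf_le1 ?exprn_ege1 ?exprn_gt0//; lra.
have d_le1 : 0 < d / 2 <= 1.
  by rewrite divr_gt0//=; clear -r1 d2r r0; lra.
have L2 x : `|x - xs| <= d / 2 -> `|Lop (a x) (b x) (dw x) (Hw x)| <= 2 ^+ n * w xs / (d / 2) ^+ 2.
  move=> xd; have xr := inr _ _ d2r xd; apply: le_trans (Lw x xr) _.
  have d2 : 0 < d / 2 by rewrite divr_gt0.
  have wr0 : 0 <= w x / r ^+ 2 by rewrite divr_ge0 ?sqr_ge0// ltW// w0.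
  apply: le_trans (_ : w x / r ^+ 2 <= _); first by rewrite -[X in _ <= X]mul1r ler_wpM2r.
  apply: ler_pM; rewrite ?invr_ge0 ?sqr_ge0//; [by rewrite ltW// w0 | exact: wb |].
  rewrite lef_pV2 ?posrE ?exprn_gt0// lerXn2r ?nnegrE ?ltW//; lra.
have osc2 x : `|x - xs| <= c * (d / 2) -> w xs / 2 <= w x.
  move=> xc; have := osc R0 a b (elliptic_offw ell) w dw Hw xs (d / 2) (2 ^+ n * w xs) d_le1.
  have -> : 2 ^- n / 2 * (2 ^+ n * w xs) = w xs / 2.
    by field; rewrite lt0r_neq0// exprn_gt0.
  case/(_ _ _ _ L2 x xc)/ler_normlP => //.
  - by move=> y yd; apply: sub; apply: inr yd.
  - by move=> y yd; apply: reg; apply: inr yd.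
  - move=> y yd; rewrite ger0_norm; first exact: wb.
    by rewrite ltW// w0//; apply: inr yd.
  - by move=> h _; clear -h; lra.
have r20 : 0 < r / 2 by rewrite divr_gt0.
have r2r : r / 2 <= r by clear -r0 rho0; lra.
have [bd1 bd2] : 0 < c * (d / 2) /\ c * (d / 2) < r / 2.
  split; first by rewrite mulr_gt0// divr_gt0.
  apply: (@le_lt_trans _ _ (1 * (d / 2))); first by rewrite ler_pM2r// divr_gt0.
  by clear -drho rho4 rho0; lra.
have /andP bd12 := conj bd1 bd2.
have := @barrier R0 K a b K0 KR ell w dw Hw xs (r / 2) (c * (d / 2)) (w xs / 2) bd12.
rewrite divr_gt0// => /(_ isT) bar.
have {}bar : w xs / 2 * ((c * (d / 2) / (r / 2)) ^+ 2) `^ be <= w z.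
  apply: bar => //.
  - by move=> y yd; apply: sub; apply: inr yd.
  - by move=> y yd; apply: reg; apply: inr yd.
  - by move=> y yd; apply: w0; apply: inr yd.
  - move=> y yd; have yr := inr _ _ (lexx _) yd.
    apply: le_trans (ler_norm _) _; apply: le_trans (Lw y yr) _.
    rewrite ler_pM2l ?invr_gt0 ?exprn_gt0//; last lra.
    rewrite ler_pM2l ?w0// lef_pV2 ?posrE ?exprn_gt0//.
    by apply: lerXn2r => //; rewrite nnegrE ltW.
  - apply: le_trans (sqn_le _) _; rewrite distrC.
    have h1 : `|xs - z| ^+ 2 <= rho ^+ 2 by rewrite lerXn2r ?nnegrE// ltW.
    apply: le_trans (_ : n%:R * rho ^+ 2 <= _); first by rewrite ler_wpM2l.
    rewrite -rhon; have -> : (4 * n%:R * rho / 2) ^+ 2 / 4 = n%:R * rho ^+ 2 * n%:R by field.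
    by apply: ler_peMr => //; apply: mulr_ge0 => //; exact: sqr_ge0.
have cd : c * (d / 2) / (r / 2) = c * d / r by field; rewrite lt0r_neq0.
rewrite cd in bar.
have cdr0 : 0 < c * d / r by rewrite divr_gt0// mulr_gt0.
have cdr1 : c * d / r <= 1.
  by rewrite ler_pdivrMr// mul1r; clear -bd2; lra.
have pw : (c * d / r) ^+ n <= ((c * d / r) ^+ 2) `^ be.
  rewrite -!(powR_mulrn _ (ltW cdr0)) -powRrM.
  have -> : 2%:R * be = pexp R n by rewrite /be; field.
  by apply: ler_wiXn2l_powR => //; exact: pexp_le_n.
have bar2 : w xs * d ^+ n <= 2 * (r / c) ^+ n * w z.
  have h1 : w xs / 2 * (c * d / r) ^+ n <= w z.
    by apply: le_trans bar; rewrite ler_pM2l// divr_gt0.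
  have k1 : 0 < (r / c) ^+ n by rewrite exprn_gt0// divr_gt0.
  have -> : w xs * d ^+ n = 2 * (r / c) ^+ n * (w xs / 2 * (c * d / r) ^+ n).
    have -> : d ^+ n = (r / c) ^+ n * (c * d / r) ^+ n.
      by rewrite -exprMn; congr (_ ^+ n); field; rewrite !lt0r_neq0.
    by field.
  by rewrite ler_pM2l// mulr_gt0.
move=> x xr.
have rho2 : r / (8 * n%:R) = rho / 2 by rewrite /rho; field; exact: nn0.
rewrite rho2 in xr.
have xrho : `|x - z| <= rho by clear -xr rho0; lra.
have := le_trans (mx x xrho) bar2.
have h2 : (rho / 2) ^+ n <= (rho - `|x - z|) ^+ n.
  by rewrite lerXn2r// ?nnegrE; clear -xr rho0; lra.
have wx0 : 0 < w x by apply: w0; clear -xrho rho4 rho0; lra.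
have k2 : 0 < (rho / 2) ^+ n by rewrite exprn_gt0// divr_gt0.
move=> h3; rewrite -(ler_pM2r k2); apply: le_trans (_ : _ <= w x * (rho - `|x - z|) ^+ n) _.
  by rewrite ler_pM2l.
apply: le_trans h3 _; rewrite le_eqVlt; apply/orP; left; apply/eqP.
rewrite /CH -rho2; have -> : r / c = (8 * n%:R / c) * (r / (8 * n%:R)).
  by field; rewrite ?nn0 ?lt0r_neq0.
by rewrite exprMn; ring.
Qed.

End Harnack.

(** * The sign of an eigenfunction in nearly Euclidean coordinates *)

Section Shells.
Variable R : realType.

(** The value [(i + 1)^(-3/2)]: the exponent 3/2 is a lower bound of [pexp] for n >= 3, and it is
    large enough for the series to converge. *)
Definition decay (i : nat) : R := (i.+1%:R * Num.sqrt i.+1%:R)^-1.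

Lemma decay_ge0 i : 0 <= decay i.
Proof. by rewrite invr_ge0 mulr_ge0// sqrtr_ge0. Qed.

(** A telescoping form of the integral test: for i >= 1, [(i + 1)^(-3/2) <= 2 * (i^(-1/2) - (i +
    1)^(-1/2))]. *)
Lemma sum_decay T : \sum_(i < T.+1) decay i <= 3 - 2 / Num.sqrt T.+1%:R.
Proof.
elim: T => [|T IH]; first by rewrite big_ord1 /decay sqrtr1 mulr1 invr1 mulr1; lra.
rewrite big_ord_recr /=; apply: le_trans (lerD IH (lexx _)) _.
rewrite /decay; set s := Num.sqrt T.+1%:R; set t := Num.sqrt T.+2%:R.
have s0 : 0 < s by rewrite sqrtr_gt0.
have t0 : 0 < t by rewrite sqrtr_gt0.
have tE : t ^+ 2 = T.+2%:R by rewrite sqr_sqrtr.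
have sE : s ^+ 2 = T.+1%:R by rewrite sqr_sqrtr.
have ts : t ^+ 2 = s ^+ 2 + 1 by rewrite tE sE -natr1.
rewrite -tE.
have st : s <= t by rewrite ler_wsqrtr// ler_nat.
have st1 : (t - s) * (t + s) = 1 by rewrite -subr_sqr ts addrAC subrr add0r.
have h : (t ^+ 2 * t)^-1 <= 2 * (s^-1 - t^-1).
  have -> : 2 * (s^-1 - t^-1) = 2 * (t - s) / (s * t) by field; rewrite !lt0r_neq0.
  rewrite -div1r ler_pdivrMr ?mulr_gt0// mulrAC ler_pdivlMr ?mulr_gt0// mul1r.
  have -> : 2 * (t - s) * (t ^+ 2 * t) = (2 * (t - s) * t) * t ^+ 2 by ring.
  have h1 : 1 <= 2 * (t - s) * t.
    have h0 : (t - s) * (t + s) <= (t - s) * (2 * t).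
      by apply: ler_wpM2l; [rewrite subr_ge0 | clear -st; lra].
    by rewrite st1 in h0; clear -h0; lra.
  apply: (@le_trans _ _ (1 * t ^+ 2)); last by rewrite ler_wpM2r// sqr_ge0.
  by rewrite mul1r expr2 ler_wpM2r// ltW.
lra.
Qed.

Lemma sum_decay_le T : \sum_(i < T) decay i <= 3.
Proof.
case: T => [|T]; first by rewrite big_ord0.
by apply: le_trans (sum_decay T) _; rewrite gerBl divr_ge0// sqrtr_ge0.
Qed.

(** The [if] is the distance between [j] and [k], and the indices on either side of [j] contribute
    at most 3 each. The range is first extended to [T + j], so that it can be cut at [j] in all
    cases. *)
Lemma sum_decay_dist T j :
  \sum_(k < T) decay (if (j <= k)%N then (k - j)%N else (j - k)%N) <= 6.
Proof.
pose f k := decay (if (j <= k)%N then (k - j)%N else (j - k)%N).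
have h1 : \sum_(k < T) f k <= \sum_(0 <= k < T + j) f k.
  rewrite -(big_mkord xpredT) (big_cat_nat (n := T) (leq0n _) (leq_addr _ _))/=.
  by rewrite lerDl sumr_ge0// => k _; exact: decay_ge0.
apply: le_trans h1 _; rewrite (big_cat_nat (n := j) (leq0n _) (leq_addl _ _))/=.
have -> : (6 : R) = 3 + 3 by lra.
apply: lerD.
  rewrite big_mkord; apply: (@le_trans _ _ (\sum_(k < j) decay k.+1)).
    rewrite (reindex_inj rev_ord_inj)/=; apply: ler_sum => k _.
    rewrite /f leqNgt (_ : (j - k.+1 < j)%N)//=; last by rewrite ltn_subrL/= (leq_ltn_trans _ (ltn_ord k)).
    by rewrite subKn.
  have := sum_decay_le j.+1; rewrite big_ord_recl /=.
  by apply: le_trans; rewrite lerDr decay_ge0.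
rewrite -{1}[j]add0n big_addn addnK big_mkord; apply: le_trans (sum_decay_le T).
by apply: ler_sum => k _; rewrite /f leq_addl addnK.
Qed.

(** For [u >= 0] the index [j] is the integer part: [1 + |u - k|] is at least half of [|j - k| + 1],
    and the factor 4 covers [2^(3/2)]. For negative [u] the index [j = 0] is the nearest one. *)
Lemma decay_shift (u : R) : exists j : nat, forall k : nat,
  (1 + `|u - k%:R|) `^ (- (3 / 2)) <= 4 * decay (if (j <= k)%N then (k - j)%N else (j - k)%N).
Proof.
have key (k i : nat) : i.+1%:R / 2 <= 1 + `|u - k%:R| -> (1 + `|u - k%:R|) `^ (- (3 / 2)) <= 4 * decay i.
  set x := 1 + _ => h.
  have i0 : (0 : R) < i.+1%:R by rewrite ltr0n.
  have i2 : (0 : R) < i.+1%:R / 2 by rewrite divr_gt0.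
  apply: le_trans (powRN_le _ i2 h) _; first by lra.
  rewrite powRN powRM ?invr_ge0// invfM /decay.
  have E (y : R) : 0 < y -> y `^ (3 / 2) = y * Num.sqrt y.
    move=> y0; have -> : (3 / 2 : R) = 1 + 2^-1 by field.
    by rewrite powRD ?(gt_eqF y0) ?implybT// powRr1 ?ltW// powR12_sqrt// ltW.
  rewrite E// mulrC ler_wpM2r ?invr_ge0 ?mulr_ge0 ?sqrtr_ge0 ?(ltW i0)//.
  rewrite E; last by rewrite invr_gt0.
  rewrite invfM invrK.
  have : Num.sqrt (2^-1) >= 2^-1 :> R.
    rewrite -[X in X <= _]ger0_norm; last by rewrite invr_ge0.
    by rewrite -sqrtr_sqr ler_wsqrtr//; lra.
  have h2 : (0 : R) < 2^-1 by rewrite invr_gt0.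
  by move=> h3; rewrite (_ : 4 = 2 * 2^-1^-1 :> R) ?invrK; [rewrite ler_pM2l// -[X in _ <= X]invrK lef_pV2 ?posrE ?(lt_le_trans h2 h3) | lra].
have [u0|u0] := ltP u 0.
  exists 0%N => k; apply: key; rewrite subn0 distrC ger0_norm ?subr_ge0; last first.
    by apply: le_trans (ltW u0) _.
  by rewrite -natr1; have : 0 <= k%:R :> R by []; lra.
exists (Num.truncn u) => k; apply: key.
have /andP[j1 j2] := truncn_itv u0; set j := Num.truncn u in j1 j2 *.
have := normr_ge0 (u - k%:R); case: leqP => jk.
  rewrite -natr1 natrB// distrC => h; have := ler_norm (k%:R - u); rewrite -natr1 in j2; lra.
rewrite -natr1 natrB ?(ltnW jk)// => h; have := ler_norm (u - k%:R); lra.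
Qed.

Lemma sum_powR_dist (u : R) T : \sum_(k < T) (1 + `|u - k%:R|) `^ (- (3 / 2)) <= 24.
Proof.
have [j hj] := decay_shift u.
apply: (@le_trans _ _ (4 * \sum_(k < T) decay (if (j <= k)%N then (k - j)%N else (j - k)%N))).
  by rewrite mulr_sumr; apply: ler_sum => k _; exact: hj.
by have := sum_decay_dist T j; lra.
Qed.

(** Every step over which [m] grows by more than the factor e multiplies the lower bound by e, so
    the logarithm of the total growth bounds the number of such steps. *)
Lemma jumps_le (m : nat -> R) T : (forall k, 0 < m k) -> (forall k, m k <= m k.+1) ->
  expR (\sum_(k < T | ~~ (m k.+1 <= expR 1 * m k)) 1) * m 0%N <= m T.
Proof.
move=> m0 mon; elim: T => [|T IH]; first by rewrite big_ord0 expR0 mul1r.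
rewrite big_mkcond big_ord_recr -big_mkcond/=; case: ifPn => h; last by rewrite addr0; exact: le_trans (mon _).
rewrite expRD mulrAC; rewrite -ltNge in h; apply: le_trans (ltW h).
by rewrite mulrC ler_wpM2l// expR_ge0.
Qed.

End Shells.

(** * Balls on which the eigenfunction is negative *)

Section LocalArgument.
Variables (R : realType) (n : nat).
Hypothesis n3 : (3 <= n)%N.
Notation V := 'rV[R]_n.
Implicit Types (x y z p d : V) (H : 'M[R]_n) (u w : V -> R).

Let n0 : (0 < n)%N. Proof. exact: leq_trans n3. Qed.
Let nR : 3 <= n%:R :> R. Proof. by rewrite ler_nat. Qed.
Let be : R := pexp R n / 2.

Lemma regular_addc u du Hu z (r c : R) : regular u du Hu z r -> regular (fun x => u x + c) du Hu z r.
Proof.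
move=> reg x xr; have [cu ju] := reg x xr; split.
  by apply: (cvgD cu); exact: cvg_cst.
by apply: (jet_eq (jetD ju (jet_cst c x))); rewrite addr0.
Qed.

Lemma regular_sub u du Hu z (r : R) z' (r' : R) : regular u du Hu z r ->
  (forall x, `|x - z'| <= r' -> `|x - z| <= r) -> regular u du Hu z' r'.
Proof. by move=> reg sub x /sub; exact: reg. Qed.

Lemma box_trans x y z (r s : R) : `|x - y| <= r -> `|y - z| <= s -> `|x - z| <= r + s.
Proof.
by move=> h1 h2; rewrite -(subrK y x) -addrA; apply: le_trans (ler_normD _ _) _; exact: lerD.
Qed.

Section Fixed.
Variables (R0 K : R) (a : V -> 'M[R]_n) (b : V -> V).
Hypothesis K0 : 0 <= K.
Hypothesis KR : 4 * n%:R ^+ 2 * K * R0 <= 1.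
Hypothesis ell : elliptic (eps0 R n) R0 K a b.

Lemma Lop_sqn_ge1 x z : `|x| <= R0 -> `|z| <= R0 -> 1 <= Lop (a x) (b x) (2 *: (x - z)) 2%:M.
Proof.
move=> xR zR; have [aT ai bK] := (proj1 ell) x xR.
have e0 : 0 < eps0 R n by rewrite invr_gt0 mulr_gt0// exprn_gt0// ltr0n.
have := tr_near_id ai; rewrite ler_norml => /andP[t1 _].
have := dot_norm_le (b x) (x - z); rewrite ler_norml => /andP[t2 _].
rewrite /Lop mxdot_scalar dotZr.
have h1 : n%:R * eps0 R n <= 16^-1.
  have -> : n%:R * eps0 R n = 16^-1 * n%:R ^- 2 by rewrite /eps0; field; have := nR; lra.
  by rewrite ler_piMr// invf_le1 ?exprn_ege1 ?exprn_gt0 ?ltr0n//; have := nR; lra.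
have h2 : n%:R * `|b x| * `|x - z| <= 6^-1.
  have : `|x - z| <= 2 * R0 by apply: le_trans (ler_normB _ _) _; lra.
  move=> h3; apply: (@le_trans _ _ (n%:R * K * (2 * R0))).
    by apply: ler_pM => //; rewrite ler_wpM2l.
  have h4 : 3 * (n%:R * K * (2 * R0)) <= n%:R * (n%:R * K * (2 * R0)).
    rewrite ler_wpM2r//; rewrite !mulr_ge0//; exact: le_trans xR.
  have := KR; lra.
have := nR; set T := \tr _ in t1 *; set D := dot _ _ in t2 *; lra.
Qed.

End Fixed.

(** Where -phi at the centre is comparable to its supremum, the negative set
    contains a whole concentric ball: Harnack's inequality bounds |phi| and the
    oscillation bound then keeps the sign. *)
Lemma negative_ball (K : R) : 0 <= K -> exists2 c : R, 0 < c <= 1 &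
  forall R0 a b, 4 * n%:R ^+ 2 * K * R0 <= 1 -> elliptic (eps0 R n) R0 K a b ->
  forall (lam s m : R) phi dphi Hphi y, 0 < s <= 1 -> 0 < lam -> 3 * n%:R ^+ 2 * lam * s ^+ 2 <= 1 -> 0 < m ->
  (forall x, `|x - y| <= s -> `|x| <= R0) -> regular phi dphi Hphi y s ->
  (forall x, `|x - y| <= s -> Lop (a x) (b x) (dphi x) (Hphi x) = - lam * phi x) ->
  (forall x, `|x - y| <= s -> - (2 * expR 1 * m) <= phi x) -> phi y <= - m ->
  forall x, `|x - y| <= c * s -> phi x < 0.
Proof.
move=> K0; have [CH CH1 har] := @harnack R n n3 K K0.
have e1 : 0 < expR 1 :> R by exact: expR_gt0.
(* With [w <= CH * C] and [C = 4 * e * m], this accuracy lets [w] move by [m / 2] at most, while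
   [phi y <= - m]. *)
have [|c1 /andP[c10 c11] osc] := @oscillation_bound R n n0 K K0 (8 * expR 1 * CH)^-1.
  by rewrite invr_gt0 !mulr_gt0//; lra.
have n8 : 0 < 8 * n%:R :> R by have := nR; lra.
exists (c1 / (8 * n%:R)).
  rewrite divr_gt0//= ler_pdivrMr// mul1r; have := nR; lra.
move=> R0 a b KR ell lam s m phi dphi Hphi y /andP[s0 s1] lam0 lams m0 sub reg Lphi lb phiy x xs.
(* Twice the given bound on [- phi], so that [w = phi + C] stays above [C / 2] and [|phi|] is
   bounded by a multiple of [w]. *)
pose C := 4 * expR 1 * m.
have C0 : 0 < C by rewrite /C !mulr_gt0.
pose w z := phi z + C.
have w_ge z : `|z - y| <= s -> C / 2 <= w z by move=> /lb; rewrite /w /C; lra.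
have w_gt0 z : `|z - y| <= s -> 0 < w z by move=> /w_ge; apply: lt_le_trans; rewrite divr_gt0.
have rw := regular_addc C reg.
have Lw z : `|z - y| <= s -> `|Lop (a z) (b z) (dphi z) (Hphi z)| <= 3 * lam * w z.
  move=> zs; rewrite Lphi// mulNr normrN normrM (gtr0_norm lam0) [3 * lam]mulrC -mulrA ler_pM2l//.
  have := w_ge z zs; rewrite /w => h; rewrite ler_norml; apply/andP; split; lra.
have s21 : 0 < s ^+ 2 by rewrite exprn_gt0.
have nn : 0 < n%:R ^+ 2 :> R by rewrite exprn_gt0// ltr0n.
have Lw2 z : `|z - y| <= s -> `|Lop (a z) (b z) (dphi z) (Hphi z)| <= n%:R ^- 2 * (w z / s ^+ 2).
  move=> zs; apply: le_trans (Lw z zs) _; have wz := w_gt0 z zs.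
  rewrite mulrCA [X in X <= _]mulrC ler_pM2l// -invfM -div1r ler_pdivlMr ?(mulr_gt0 nn s21)//.
  by move: lams; congr (_ <= _); ring.
have zs8 z : `|z - y| <= s / (8 * n%:R) -> `|z - y| <= s.
  move=> /le_trans; apply; rewrite ler_pdivrMr// ler_peMr ?(ltW s0)//; have := nR; lra.
have har1 z : `|z - y| <= s / (8 * n%:R) -> w z <= CH * C.
  move=> zs; have := har R0 a b KR ell w dphi Hphi y s _ sub rw w_gt0 Lw2 z zs.
  rewrite s0 s1 => /(_ isT) h; apply: le_trans h _; rewrite ler_wpM2l//; first lra.
  by rewrite /w; lra.
pose t := s / (8 * n%:R).
have t0 : 0 < t <= 1.
  by rewrite divr_gt0//= ler_pdivrMr// mul1r; have := nR; lra.
have [t00 _] := andP t0.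
have ts : t <= s by rewrite /t ler_pdivrMr// ler_peMr ?(ltW s0)//; have := nR; lra.
have CHC : 0 < CH * C by rewrite mulr_gt0//; lra.
have := osc R0 a b (elliptic_offw n3 ell) w dphi Hphi y t (CH * C) t0 _ _ _ _ x.
case/(_ _ _ _ _ _)/ler_normlP => //.
- by move=> z /zs8; exact: sub.
- by apply: regular_sub rw _.
- by move=> z zt; rewrite gtr0_norm; [exact: har1 | exact/w_gt0/zs8].
- move=> z zt; apply: le_trans (Lw2 z (zs8 z zt)) _.
  have wz := w_gt0 z (zs8 z zt).
  apply: (@le_trans _ _ (1 * (w z / s ^+ 2))).
    rewrite ler_wpM2r//; first by rewrite divr_ge0 ?sqr_ge0// ltW.
    by rewrite invf_le1 ?exprn_ege1//; have := nR; lra.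
  rewrite mul1r; apply: ler_pM => //; [exact: ltW | by rewrite invr_ge0 sqr_ge0 | exact: har1 |].
  by rewrite lef_pV2 ?posrE ?exprn_gt0// lerXn2r ?nnegrE ?(ltW s0) ?(ltW t00).
- by rewrite /t mulrA mulrAC.
move=> _; have -> : (8 * expR 1 * CH)^-1 * (CH * C) = m / 2.
  by rewrite /C; field; rewrite !lt0r_neq0//; lra.
rewrite /w; lra.
Qed.

End LocalArgument.

(** * Nested boxes around the maximum and the sum of poles *)

Section ShellArgument.
Variables (R : realType) (n : nat).
Hypothesis n3 : (3 <= n)%N.
Notation V := 'rV[R]_n.
Implicit Types (x y z p d : V) (H : 'M[R]_n) (u w : V -> R).

Let n0 : (0 < n)%N. Proof. exact: leq_trans n3. Qed.
Let nR : 3 <= n%:R :> R. Proof. by rewrite ler_nat. Qed.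
Notation be := (pexp R n / 2).

Section Fixed.
Variables (R0 K : R) (a : V -> 'M[R]_n) (b : V -> V).
Hypothesis K0 : 0 <= K.
Hypothesis KR : 4 * n%:R ^+ 2 * K * R0 <= 1.
Hypothesis ell : elliptic (eps0 R n) R0 K a b.
Variables (lam : R) (phi : V -> R) (dphi : V -> V) (Hphi : V -> 'M[R]_n) (x0 : V).
Hypothesis lam0 : 0 < lam.

(* A positive strict supersolution on small boxes: -phi divided by it has no
   positive interior maximum, although phi itself may have negative minima. *)
Let h x := 2 - 4 * lam * sqn (x - x0).

(** [ym.2] is the maximum of [- phi / h] on the box and [ym.1] a point attaining it. If this value m
    were positive at an interior point, [phi + m * h] would have a minimum there, whereas the
    operator on it is [m * lam * (h - 4 * L)], with [h <= 2] and [L >= 1] its value on the squared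
    distance. That the point lies on the boundary is what later separates the poles. *)
Lemma box_minimum (s : R) : 0 <= s -> 4 * lam * n%:R * s ^+ 2 <= 1 ->
  (forall x, `|x - x0| <= s -> `|x| <= R0) -> regular phi dphi Hphi x0 s ->
  (forall x, `|x - x0| <= s -> Lop (a x) (b x) (dphi x) (Hphi x) = - lam * phi x) ->
  exists (ym : V * R), [/\ `|ym.1 - x0| <= s,
    forall x, `|x - x0| <= s -> - (ym.2 * h x) <= phi x,
    phi ym.1 = - (ym.2 * h ym.1) & 0 < ym.2 -> `|ym.1 - x0| = s].
Proof.
move=> s0 lams sub reg Lphi.
have h_ge1 x : `|x - x0| <= s -> 1 <= h x.
  move=> xs; have : 4 * lam * sqn (x - x0) <= 4 * lam * (n%:R * s ^+ 2).
    rewrite ler_wpM2l ?mulr_ge0 ?(ltW lam0)//.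
    by apply: le_trans (sqn_le _) _; rewrite ler_wpM2l// lerXn2r ?nnegrE.
  by rewrite /h; lra.
have x0s : `|x0 - x0| <= s by rewrite subrr normr0.
have [||y] := @EVT_max_rV R n (fun x => - phi x / h x) [set x | `|x - x0| <= s] _ (@box_compact R n x0 s).
- by exists x0.
- apply: continuous_in_subspaceT => x; rewrite inE /= => xs.
  have [cp _] := reg x xs; have hx := h_ge1 x xs.
  apply: (cvgM (cvgN cp)); apply: cvgV; first by rewrite gt_eqF//; lra.
  apply: cvgB; first exact: cvg_cst.
  by apply: cvgMl_tmp; exact: sqn_sub_continuous.
rewrite inE /= => ys my.
have {}my x : `|x - x0| <= s -> - phi x / h x <= - phi y / h y by move=> xs; apply: my; rewrite inE.
have hy := h_ge1 y ys.
exists (y, - phi y / h y); rewrite /=; split => //.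
- move=> x xs; have := my x xs; have hx := h_ge1 x xs.
  by rewrite ler_pdivrMr; [lra | lra].
- by field; lra.
- move=> m0; apply/eqP; rewrite eq_le ys /= leNgt; apply/negP => ys'.
  have [_ jy] := reg y ys.
  have JJ := jetD jy (jetZ (- phi y / h y) (jetD (jet_cst 2 y) (jetN (jetZ (4 * lam) (sqn_jet y x0))))).
  have [aT ai _] := (proj1 (elliptic_offw n3 ell)) y (sub y ys).
  have := Lop_min n0 (b y) aT ai JJ; rewrite !add0r LopD LopZ LopN LopZ.
  have /[swap] /[apply] : \forall x \near y, phi y + - phi y / h y * (2 + - (4 * lam * sqn (y - x0)))
       <= phi x + - phi y / h y * (2 + - (4 * lam * sqn (x - x0))).
    have near_s := box_nbhs ys'; near=> x.
    have xs : `|x - x0| <= s by apply: ltW; near: x.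
    rewrite -/(h y) -/(h x) divfK; last by rewrite gt_eqF//; lra.
    rewrite subrr; have := my x xs; have hx := h_ge1 x xs.
    by rewrite ler_pdivrMr; [lra | lra].
  rewrite (Lphi y ys); have L1 := Lop_sqn_ge1 n3 K0 KR ell (sub y ys) (sub x0 x0s).
  set m := - phi y / h y in m0 *; set L := Lop _ _ _ _ in L1 *.
  have -> : - lam * phi y = m * (lam * h y) by rewrite /m; field; lra.
  have h2 : h y <= 2 by rewrite /h lerBlDr lerDl !mulr_ge0 ?sqn_ge0 ?(ltW lam0).
  have h3 : lam * h y + - (4 * lam * L) < 0.
    have hA : lam * h y <= lam * 2 by rewrite ler_pM2l.
    have hB : 4 * lam * 1 <= 4 * lam * L by rewrite ler_wpM2l ?mulr_ge0 ?(ltW lam0).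
    rewrite subr_lt0; apply: le_lt_trans hA _; apply: lt_le_trans hB.
    by have := lam0; lra.
  by rewrite -mulrDr leNgt pmulr_rlt0// h3.
Unshelve. all: by end_near. Qed.

Section Barrier.
Variables (T : nat) (rho Phi kap B : R) (S : pred 'I_T) (y : 'I_T -> V) (Om : set V).
Hypothesis rho0 : 0 < rho.
Hypothesis sub : forall x, `|x - x0| <= rho -> `|x| <= R0.
Hypothesis reg : regular phi dphi Hphi x0 rho.
Hypothesis Lphi : forall x, `|x - x0| <= rho -> Lop (a x) (b x) (dphi x) (Hphi x) = - lam * phi x.
Hypothesis Phi_gt0 : 0 < Phi.
Hypothesis phi_x0 : phi x0 = Phi.
Hypothesis Om_x0 : Om x0.
Hypothesis Om_le : forall x, closure Om x -> `|x - x0| <= rho -> phi x <= Phi.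
Hypothesis Om_near : forall z, closure Om z -> `|z - x0| < rho -> 0 < phi z -> \forall x \near z, Om x.
Hypothesis y_in : forall k, `|y k - x0| <= rho / (4 * n%:R).
Hypothesis y_off : forall z k, S k -> closure Om z -> `|z - x0| <= rho -> 0 < sqn (z - y k).
Hypothesis kap0 : 0 < kap.
Hypothesis sum_le : forall z, closure Om z -> `|z - x0| <= rho -> \sum_(k < T | S k) sqn (z - y k) `^ (- be) <= B.
Hypothesis kapB : kap * B <= 4^-1.
Hypothesis lam_rho : 8 * n%:R * lam * rho ^+ 2 <= 1.
Hypothesis gain : 2 * n%:R * lam * rho ^+ 2 < kap * ((\sum_(k < T | S k) 1) * (rho ^+ 2) `^ (- be)).

(** [F] has a maximum [z] on the part of the closure of [Om] in the box, and [F z >= F x0 >= Phi].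
    If [phi z <= 0], the added terms are at most [Phi / 2]. If [z] is on the boundary of the box,
    [gain] says that the poles lose more from [x0] to [z] than the quadratic term adds. Otherwise
    [z] is interior to [Om], and the operator on [F] is at least [lam * (2 * Phi - phi z) > 0]. *)
Lemma barrier_contradiction : False.
Proof.
pose F x := phi x + Phi * (kap * (\sum_(k < T | S k) sqn (x - y k) `^ (- be)) + 2 * lam * sqn (x - x0)).
have x0rho : `|x0 - x0| <= rho by rewrite subrr normr0 ltW.
have cx0 : closure Om x0 by exact: subset_closure.
have [||z] := @EVT_max_rV R n F ([set x | `|x - x0| <= rho] `&` closure Om) _ (compact_closedI (@box_compact R n x0 rho) (@closed_closure _ Om)).
- by exists x0.
- apply: continuous_in_subspaceT => x; rewrite inE => -[/= xr cx].
  apply: (cvgD (proj1 (reg xr))); apply: cvgMl_tmp; apply: cvgD; apply: cvgMl_tmp; last exact: sqn_sub_continuous.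
  apply: cvg_big; first exact: add_continuous.
  by move=> k Sk; apply: powR_sqn_continuous; exact: y_off.
rewrite inE => -[/= zr cz] mz.
have {}mz x : `|x - x0| <= rho -> closure Om x -> F x <= F z by move=> xr cx; apply: mz; rewrite inE.
have Fx0 : F x0 <= F z by exact: mz.
have sq_le x : `|x - x0| <= rho -> 2 * lam * sqn (x - x0) <= 2 * n%:R * lam * rho ^+ 2.
  move=> xr; have -> : 2 * n%:R * lam * rho ^+ 2 = 2 * lam * (n%:R * rho ^+ 2) by ring.
  rewrite ler_wpM2l ?mulr_ge0 ?(ltW lam0)//.
  by apply: le_trans (sqn_le _) _; rewrite ler_wpM2l// lerXn2r ?nnegrE// ltW.
have Sge0 x : 0 <= \sum_(k < T | S k) sqn (x - y k) `^ (- be) by apply: sumr_ge0 => k _; exact: powR_ge0.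
move: Fx0; rewrite /F phi_x0 subrr sqn0 mulr0 addr0 => Fx0.
have [phiz|phiz] := leP (phi z) 0.
  have h1 : kap * \sum_(k < T | S k) sqn (z - y k) `^ (- be) <= 4^-1.
    by apply: le_trans kapB; rewrite ler_pM2l//; exact: sum_le.
  have h2 := sq_le z zr.
  have h3 : 2 * n%:R * lam * rho ^+ 2 <= 4^-1 by have := lam_rho; lra.
  have h4 : 0 <= kap * \sum_(k < T | S k) sqn (x0 - y k) `^ (- be) by rewrite mulr_ge0// ltW.
  have : Phi * (kap * \sum_(k < T | S k) sqn (z - y k) `^ (- be) + 2 * lam * sqn (z - x0)) <= Phi * 2^-1.
    by rewrite ler_pM2l//; lra.
  have : 0 <= Phi * (kap * \sum_(k < T | S k) sqn (x0 - y k) `^ (- be)) by rewrite mulr_ge0// ltW.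
  by have := Phi_gt0; move: Fx0 phiz; set A := Phi * (_ * _); set A' := Phi * (_ + _); move=> ? ? ? ? ?; lra.
have [zr'|zr'] := ltP `|z - x0| rho; last first.
  have zrE : `|z - x0| = rho by apply/eqP; rewrite eq_le zr zr'.
  (* Each pole is within Euclidean distance [rho / 4] of [x0] and at least [rho / 2] away from [z],
     so its power drops from at least [16^be] to at most [4^be] times that of [rho]. *)
  have hS : (\sum_(k < T | S k) 1) * (rho ^+ 2) `^ (- be) <=
     \sum_(k < T | S k) sqn (x0 - y k) `^ (- be) - \sum_(k < T | S k) sqn (z - y k) `^ (- be).
    rewrite mulr_suml -sumrB; apply: ler_sum => k Sk; rewrite mul1r.
    set P := (rho ^+ 2) `^ (- be).
    have P0 : 0 < P by rewrite powR_gt0// exprn_gt0.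
    have be12 : 2^-1 <= be by have := pexp_gt1 R n3; lra.
    have be0 : 0 <= be by lra.
    have b4 : 2 <= 4 `^ be :> R.
      have : 4 `^ 2^-1 <= 4 `^ be :> R by apply: ler_powR => //; lra.
      have -> // : 4 `^ 2^-1 = 2 :> R.
      rewrite powR12_sqrt// (_ : 4 = 2 ^+ 2 :> R); last by ring.
      by rewrite sqrtr_sqr ger0_norm.
    have E (c : R) : 0 < c -> (rho ^+ 2 / c) `^ (- be) = c `^ be * P.
      move=> c0; rewrite mulrC powRM ?sqr_ge0 ?invr_ge0 ?(ltW c0)//; congr (_ * _).
      by rewrite -(powR_inv1 (ltW c0)) -powRrM mulN1r opprK.
    have n1 : 0 < 4 * n%:R :> R by have := nR; lra.
    have yk := y_in k.
    have yk12 : rho / (4 * n%:R) <= rho / 12.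
      by rewrite ler_pM2l// lef_pV2 ?posrE//; have := nR; lra.
    have up : 16 `^ be * P <= sqn (x0 - y k) `^ (- be).
      rewrite -E//; apply: powRN_le => //; first by apply: y_off.
      apply: le_trans (sqn_le _) _; rewrite distrC.
      apply: (@le_trans _ _ (n%:R * (rho / (4 * n%:R)) ^+ 2)).
        by rewrite ler_wpM2l// lerXn2r ?nnegrE// divr_ge0// ltW.
      have -> : n%:R * (rho / (4 * n%:R)) ^+ 2 = rho ^+ 2 / 16 / n%:R by field; have := nR; lra.
      rewrite ler_pdivrMr; last by have := nR; lra.
      by rewrite ler_peMr ?divr_ge0 ?sqr_ge0//; have := nR; lra.
    have low : sqn (z - y k) `^ (- be) <= 4 `^ be * P.
      rewrite -E//; apply: powRN_le => //; first by rewrite divr_gt0// exprn_gt0.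
      apply: le_trans (sqn_ge _ n0).
      have : rho / 2 <= `|z - y k|.
        have -> : z - y k = (z - x0) - (y k - x0) by rewrite opprB addrA subrK.
        have := lerB_dist (z - x0) (y k - x0); rewrite zrE.
        by move=> ?; have := rho0; move: yk yk12; move=> ? ? ?; lra.
      move=> hh; have -> : rho ^+ 2 / 4 = (rho / 2) ^+ 2 by field.
      by rewrite lerXn2r ?nnegrE// divr_ge0// ltW.
    have : 16 `^ be = 4 `^ be * 4 `^ be :> R.
      by rewrite -powRM//; congr (_ `^ _); ring.
    move=> e16; rewrite e16 in up.
    have h5 : 2 * 1 * P <= 4 `^ be * P + (4 `^ be - 2) * P by rewrite -mulrDl ler_pM2r//; lra.
    have h6 : 2 * (4 `^ be * P) <= 4 `^ be * 4 `^ be * P.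
      by rewrite -mulrA ler_pM2r// mulr_gt0// powR_gt0.
    by move: up low h5 h6 b4 P0; set X := 4 `^ be; move=> ? ? ? ? ? ?; lra.
  have h2 := sq_le z zr.
  have h1 : kap * ((\sum_(k < T | S k) 1) * (rho ^+ 2) `^ (- be)) <=
    kap * (\sum_(k < T | S k) sqn (x0 - y k) `^ (- be) - \sum_(k < T | S k) sqn (z - y k) `^ (- be)).
    by rewrite ler_pM2l.
  have h3 := Om_le cz zr.
  have : Phi * (kap * \sum_(k < T | S k) sqn (z - y k) `^ (- be) + 2 * lam * sqn (z - x0))
      < Phi * (kap * \sum_(k < T | S k) sqn (x0 - y k) `^ (- be)).
    rewrite ltr_pM2l//; have := gain; rewrite mulrBr in h1; lra.
  by move: Fx0 h3; set A := Phi * (_ + _); set A' := Phi * (_ * _); move=> ? ? ?; lra.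
have near_z := Om_near cz zr' phiz.
have zR := sub zr.
have yR k : `|y k| <= R0.
  apply: sub; apply: le_trans (y_in k) _; rewrite ler_pdivrMr; last by have := nR; lra.
  by rewrite ler_peMr ?(ltW rho0)//; have := nR; lra.
have rs (k : 'I_T) : exists dH : V * 'M[R]_n, S k ->
    jet (fun x => sqn (x - y k) `^ (- be)) z dH.1 dH.2 /\ 0 <= Lop (a z) (b z) dH.1 dH.2.
  have [Sk|nSk] := boolP (S k); last by exists (0, 0).
  have [d [H [J L]]] := radial_subsolution n3 K0 KR ell zR (yR k) (y_off Sk cz zr).
  exists (d, H) => _; split => //=; apply: le_trans L.
  by rewrite mulr_ge0 ?powR_ge0 ?invr_ge0.
have [dH hdH] := choice rs.
have [_ jz] := reg zr.
have JS := @jet_sum R n _ (index_enum 'I_T) S (fun k x => sqn (x - y k) `^ (- be)) z _ _ (fun k Sk => proj1 (hdH k Sk)).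
have JJ := jetD jz (jetZ Phi (jetD (jetZ kap JS) (jetZ (2 * lam) (sqn_jet z x0)))).
have [aT ai _] := (proj1 (elliptic_offw n3 ell)) z zR.
have := Lop_max n0 (b z) aT ai JJ; rewrite LopD LopZ LopD LopZ LopZ Lop_sum (Lphi zr).
have /[swap] /[apply] : \forall x \near z, F x <= F z.
  have near_r := box_nbhs zr'; near=> x; apply: mz.
    by apply: ltW; near: x.
  by apply: subset_closure; near: x.
have L1 := Lop_sqn_ge1 n3 K0 KR ell zR (sub x0rho).
have L2 : 0 <= \sum_(k < T | S k) Lop (a z) (b z) (dH k).1 (dH k).2.
  by apply: sumr_ge0 => k Sk; exact: (proj2 (hdH k Sk)).
apply/negP; rewrite -ltNge.
have h1 : lam * phi z <= lam * Phi by rewrite ler_pM2l//; exact: Om_le.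
have h2 : Phi * (2 * lam * 1) <= Phi * (kap * (\sum_(k < T | S k) Lop (a z) (b z) (dH k).1 (dH k).2) + 2 * lam * Lop (a z) (b z) (2 *: (z - x0)) 2%:M).
  rewrite ler_pM2l//; apply: ler_wpDl; first by rewrite mulr_ge0// ltW.
  by rewrite ler_wpM2l// mulr_ge0// ltW.
have h3 : 0 < lam * Phi by rewrite mulr_gt0.
by move: h1 h2 h3; set A := Phi * (_ + _); move=> ? ? ?; lra.
Unshelve. all: by end_near. Qed.

End Barrier.
End Fixed.
End ShellArgument.

Section ShellConclusion.
Variable R : realType.


(** The radii are frozen from index [T] on, so that bounds and monotonicity hold for all natural
    numbers and the box minima can be chosen without carrying [k <= T]. *)
Lemma shell_radii (T : nat) (r1 : R) : (0 < T)%N -> 0 < r1 ->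
  exists s : nat -> R, [/\ forall k, r1 <= s k <= 2 * r1, forall k, s k <= s k.+1, s 0%N = r1,
    forall k, (k < T)%N -> s k.+1 = s k + r1 / T%:R &
    forall k, (k <= T)%N -> s k = r1 + k%:R * (r1 / T%:R)].
Proof.
move=> T0 r10; have TR : 0 < T%:R :> R by rewrite ltr0n.
pose s k := r1 + (minn k T)%:R * (r1 / T%:R).
have e0 : 0 <= r1 / T%:R by rewrite divr_ge0 ?ltW.
have sE k : (k <= T)%N -> s k = r1 + k%:R * (r1 / T%:R) by move=> kT; rewrite /s (minn_idPl kT).
exists s; split => // [k|k||k kT].
- rewrite /s lerDl mulr_ge0//=.
  have -> : 2 * r1 = r1 + T%:R * (r1 / T%:R) by field; rewrite gt_eqF.
  by rewrite lerD2l ler_wpM2r// ler_nat geq_minr.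
- rewrite /s lerD2l ler_wpM2r// ler_nat leq_min geq_minr andbT.
  by apply: leq_trans (geq_minl _ _) _.
- by rewrite sE// mul0r addr0.
- by rewrite !sE// ?(ltnW kT)// -natr1; ring.
Qed.


End ShellConclusion.

(** A form of the argument free of exponents in [lam]: [G] bounds |phi| in terms of its value at the
    centre, [T] counts the boxes, and [lam], [rho] and [T] are linked only by the product bounded by
    [eta]. [Om] stands for the nodal domain and is described by the properties that the barrier
    uses. *)
Lemma shell_argument (R : realType) (n : nat) (n3 : (3 <= n)%N) (K : R) : 0 <= K -> exists eta c CH : R, [/\ 0 < eta, 0 < c, 1 <= CH &
  forall R0 (a : 'rV[R]_n -> 'M[R]_n) (b : 'rV[R]_n -> 'rV[R]_n), 4 * n%:R ^+ 2 * K * R0 <= 1 -> elliptic (eps0 R n) R0 K a b ->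
  forall (T : nat) (lam rho G : R) phi dphi Hphi x0 (Om : set 'rV[R]_n),
  (0 < T)%N -> 0 < lam -> 0 < rho <= 1 -> lam * rho ^+ 2 * T%:R `^ (pexp R n - 1) <= eta ->
  4 * CH * G <= expR (T%:R / 2) ->
  (forall x, `|x - x0| <= rho -> `|x| <= R0) -> regular phi dphi Hphi x0 rho ->
  (forall x, `|x - x0| <= rho -> Lop (a x) (b x) (dphi x) (Hphi x) = - lam * phi x) ->
  0 < phi x0 -> (forall x, `|x - x0| <= rho -> `|phi x| <= G * phi x0) ->
  Om x0 -> (forall x, Om x -> `|x - x0| <= rho -> 0 < phi x) ->
  (forall x, closure Om x -> `|x - x0| <= rho -> phi x <= phi x0) ->
  (forall z, closure Om z -> `|z - x0| < rho -> 0 < phi z -> \forall x \near z, Om x) ->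
  forall x, `|x - x0| <= c * rho -> 0 <= phi x].
Proof.
move=> K0; have n0 : (0 < n)%N by exact: leq_trans n3.
have [CH CH1 har] := @harnack R n n3 K K0.
have [c3 /andP[c30 c31] neg] := @negative_ball R n n3 K K0.
have nR : 3 <= n%:R :> R by rewrite ler_nat.
have ngt0 : 0 < n%:R :> R by lra.
have nge1 : 1 <= n%:R :> R by lra.
have be0 : 0 < pexp R n / 2 by exact: half_pexp_gt0.
(* With [X = c3 * es / 2], [es = r1 / T] and [r1 = rho / (8 * n)], this is the [pexp]-th power of
   [T * X / rho]. *)
pose C3 : R := ((c3 / (16 * n%:R)) ^+ 2) `^ (pexp R n / 2).
have C30 : 0 < C3 by rewrite powR_gt0// exprn_gt0// divr_gt0// mulr_gt0// ltr0n.
have C3E : C3 = ((c3 / (16 * n%:R)) ^+ 2) `^ (pexp R n / 2) by [].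
clearbody C3.
(* The first bound makes [lam * rho^2] small enough for the auxiliary function [h] and for the
   barrier. The second gives [2 * n * eta <= C3 / 200], below the constant [C3 / 192] in the gain
   from the poles. *)
pose eta : R := Num.min (8 * n%:R)^-1 (C3 / (400 * n%:R)).
have eta0 : 0 < eta.
  have h8 : 0 < 8 * n%:R :> R by lra.
  have h400 : 0 < 400 * n%:R :> R by lra.
  by rewrite lt_min invr_gt0 h8 divr_gt0.
have eta1 : eta <= (8 * n%:R)^-1 by rewrite ge_min lexx.
have eta2 : eta <= C3 / (400 * n%:R) by rewrite ge_min lexx orbT.
clearbody eta.
(* With this constant [c * rho = r1 / (16 * n)], so that [x0] is in the box around [q] covered by
   Harnack's inequality of radius [r1 / 2]. *)
exists eta, (128 * n%:R ^+ 2)^-1, CH; split => //.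
  by rewrite invr_gt0 mulr_gt0// exprn_gt0.
move=> R0 a b KR ell T lam rho G phi dphi Hphi x0 Om T0 lam0 /andP[rho0 rho_le1] lamT CHG sub reg Lphi phi0 phiG Omx0 Om_gt0 Om_le Om_near q qc.
rewrite leNgt; apply/negP => phiq.
have TR : 1 <= T%:R :> R by rewrite ler1n.
have T0R : 0 < T%:R :> R by rewrite ltr0n.
have p1 : 0 <= pexp R n - 1 by have hp := pexp_gt1 R n3; clear -hp; lra.
have lamrho : lam * rho ^+ 2 <= (8 * n%:R)^-1.
  apply: le_trans eta1; apply: le_trans lamT; rewrite ler_peMr//.
    by rewrite mulr_ge0 ?sqr_ge0 ?ltW.
  by rewrite -[X in X <= _](powRr0 T%:R) ler_powR.
have lam8 : 8 * n%:R * lam * rho ^+ 2 <= 1.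
  by rewrite -mulrA mulrC -ler_pdivlMr ?mul1r ?div1r//; clear -nge1; lra.
have lam1 : lam * rho ^+ 2 <= 1.
  have h8 : 1 <= 8 * n%:R :> R by clear -nge1; lra.
  by apply: le_trans lamrho _; rewrite invf_le1// (lt_le_trans ltr01).
pose r1 := rho / (8 * n%:R).
have r10 : 0 < r1 by rewrite divr_gt0//; clear -nge1; lra.
have r1E : 8 * n%:R * r1 = rho by rewrite /r1; field; clear -nge1; lra.
have r1_le : 24 * r1 <= rho by rewrite -r1E ler_pM2r//; clear -nR; lra.
clearbody r1.
have [s [s_in s_mon s0E s_step sE]] := shell_radii T0 r10.
pose es := r1 / T%:R.
have es0 : 0 < es by rewrite divr_gt0.
have es_r1 : es <= r1 by rewrite /es ler_pdivrMr// ler_peMr// ltW.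
have esE : es = r1 / T%:R by [].
clearbody es; rewrite -esE in s_step sE.
have s_rho k : s k <= rho by have /andP[_ hh] := s_in k; clear -hh r1_le r10; lra.
have s_ge0 k : 0 <= s k by have /andP[hh _] := s_in k; clear -hh r10; lra.
pose h x := 2 - 4 * lam * sqn (x - x0).
have h_bd x : `|x - x0| <= 2 * r1 -> 1 <= h x <= 2.
  move=> xr; rewrite /h; apply/andP; split; last by rewrite gerBl !mulr_ge0 ?sqn_ge0 ?(ltW lam0).
  have : 4 * lam * sqn (x - x0) <= 4 * lam * (n%:R * (2 * r1) ^+ 2).
    rewrite ler_wpM2l ?mulr_ge0 ?(ltW lam0)//.
    by apply: le_trans (sqn_le _) _; rewrite ler_pM2l// lerXn2r ?nnegrE// mulr_ge0// ltW.
  have -> : 4 * lam * (n%:R * (2 * r1) ^+ 2) = lam * rho ^+ 2 / (4 * n%:R) by rewrite -r1E; field; clear -nge1; lra.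
  have : lam * rho ^+ 2 / (4 * n%:R) <= 1.
    have n4 : 1 <= 4 * n%:R :> R by clear -nge1; lra.
    by rewrite ler_pdivrMr ?mul1r ?(lt_le_trans ltr01)//; exact: le_trans n4.
  by move=> ha hb; clear -ha hb; lra.
have hy k : exists ym : 'rV[R]_n * R, [/\ `|ym.1 - x0| <= s k,
    forall x, `|x - x0| <= s k -> - (ym.2 * h x) <= phi x,
    phi ym.1 = - (ym.2 * h ym.1) & 0 < ym.2 -> `|ym.1 - x0| = s k].
  apply: (box_minimum n3 K0 KR ell lam0 (s_ge0 k)).
  - have : 4 * lam * n%:R * s k ^+ 2 <= 4 * lam * n%:R * rho ^+ 2.
      by rewrite ler_wpM2l ?mulr_ge0 ?(ltW lam0)// ?(ltW ngt0)// lerXn2r ?nnegrE// ltW.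
    by move=> h1; apply: le_trans h1 _; move: lam8; clear; lra.
  - by move=> x xs; apply: sub; exact: le_trans (s_rho k).
  - by apply: regular_sub reg _ => x xs; exact: le_trans (s_rho k).
  - by move=> x xs; apply: Lphi; exact: le_trans (s_rho k).
have [ym hym] := choice hy; clear hy; clearbody h.
pose y k := (ym k).1; pose m k := (ym k).2.
have y_s k : `|y k - x0| <= s k by case: (hym k).
have y_lb k x : `|x - x0| <= s k -> - (m k * h x) <= phi x by case: (hym k) => _ + _ _; apply.
have y_phi k : phi (y k) = - (m k * h (y k)) by case: (hym k).
have y_bd k : 0 < m k -> `|y k - x0| = s k by case: (hym k).
clearbody y m; clear hym ym.
have s2 k : s k <= 2 * r1 by case/andP: (s_in k).
have s1 k : r1 <= s k by case/andP: (s_in k).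
have qr : `|q - x0| <= r1 / (16 * n%:R).
  apply: le_trans qc _; rewrite -r1E le_eqVlt; apply/orP; left; apply/eqP; clear -nR; field; lra.
have qr1 : `|q - x0| <= r1 / 2.
  have n16 : 2 <= 16 * n%:R :> R by clear -nge1; lra.
  by apply: le_trans qr _; rewrite ler_pM2l// lef_pV2 ?posrE//; exact: lt_le_trans n16.
have m_gt0 k : 0 < m k.
  have qs : `|q - x0| <= s k by apply: le_trans qr1 _; apply: le_trans (s1 k); clear -r10; lra.
  have /andP[h1 _] := h_bd q (le_trans qs (s2 k)).
  have := le_lt_trans (y_lb k q qs) phiq; rewrite oppr_lt0 pmulr_lgt0//.
  exact: lt_le_trans h1.
have hyk k : 1 <= h (y k) <= 2 by apply: h_bd; exact: le_trans (s2 k).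
have m_mon k : m k <= m k.+1.
  have := y_lb k.+1 (y k) (le_trans (y_s k) (s_mon k)).
  rewrite y_phi lerN2; have /andP[h1 _] := hyk k.
  by rewrite ler_pM2r// (lt_le_trans ltr01 h1).
have mT : m T <= G * phi x0.
  have := phiG (y T) (le_trans (y_s T) (s_rho T)); rewrite y_phi normrN => h1.
  apply: le_trans h1; apply: le_trans (ler_norm _); have /andP[h2 _] := hyk T.
  by rewrite ler_peMr// ltW.
have G_gt0 : 0 < G by have := lt_le_trans (m_gt0 T) mT; rewrite pmulr_lgt0.
(* Harnack's inequality around [q] for [phi + 4 * m 0]: at [q] this function is below [4 * m 0],
   because [phi q < 0], and at [x0] it exceeds [phi x0]. *)
have m0_ge : phi x0 <= 4 * CH * m 0%N.
  pose w z := phi z + 4 * m 0%N.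
  have inq x : `|x - q| <= r1 / 2 -> `|x - x0| <= r1.
    by move=> xq; apply: le_trans (box_trans xq qr1) _; clear -r10; lra.
  have r1rho : r1 <= rho by clear -r1_le r10; lra.
  have w_ge x : `|x - q| <= r1 / 2 -> 2 * m 0%N <= w x.
    move=> /inq xq; have xs0 : `|x - x0| <= s 0%N by rewrite s0E.
    have /andP[_ h2] := h_bd x (le_trans xs0 (s2 0%N)).
    have : m 0%N * h x <= m 0%N * 2 by rewrite ler_pM2l.
    by have h3 := y_lb 0%N x xs0; rewrite /w => h4; clear -h3 h4; lra.
  have w_gt0 x : `|x - q| <= r1 / 2 -> 0 < w x.
    by move=> /w_ge; apply: lt_le_trans; rewrite mulr_gt0.
  have r12 : 0 < r1 / 2 <= 1.
    by rewrite divr_gt0//=; clear -r1rho rho_le1 r10; lra.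
  have sub1 x : `|x - q| <= r1 / 2 -> `|x| <= R0.
    by move=> /inq xq; apply: sub; exact: le_trans r1rho.
  have reg1 : regular w dphi Hphi q (r1 / 2).
    by apply/regular_addc/(regular_sub reg) => x /inq xq; exact: le_trans r1rho.
  have L1 x : `|x - q| <= r1 / 2 ->
      `|Lop (a x) (b x) (dphi x) (Hphi x)| <= n%:R ^- 2 * (w x / (r1 / 2) ^+ 2).
    move=> xq; rewrite Lphi; last exact: le_trans (inq x xq) r1rho.
    have wx := w_ge x xq; have wx0 := w_gt0 x xq.
    rewrite mulNr normrN normrM (gtr0_norm lam0).
    have h1 : `|phi x| <= 3 * w x by have m00 := m_gt0 0%N; rewrite ler_norml; move: wx; rewrite /w => wx; clear -wx m00; apply/andP; split; lra.
    apply: le_trans (_ : lam * (3 * w x) <= _); first by rewrite ler_pM2l.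
    have -> : n%:R ^- 2 * (w x / (r1 / 2) ^+ 2) = 256 * (w x / rho ^+ 2) by rewrite -r1E; field; rewrite !lt0r_neq0.
    have -> : lam * (3 * w x) = 3 * (lam * rho ^+ 2) * (w x / rho ^+ 2) by field; rewrite !lt0r_neq0.
    by rewrite ler_pM2r; [clear -lam1; lra | rewrite divr_gt0// exprn_gt0].
  have x0q : `|x0 - q| <= r1 / 2 / (8 * n%:R).
    by rewrite distrC; apply: le_trans qr _; rewrite le_eqVlt; apply/orP; left; apply/eqP; clear -nR; field; lra.
  have := har R0 a b KR ell w dphi Hphi q (r1 / 2) r12 sub1 reg1 w_gt0 L1 x0 x0q.
  have : CH * w q <= CH * (4 * m 0%N) by rewrite ler_pM2l//; [rewrite /w; clear -phiq; lra | exact: lt_le_trans CH1].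
  by have := m_gt0 0%N; rewrite /w => ha hb hc; clear -ha hb hc; lra.
(* The box of radius [es] around [y k] lies in the next box, where [phi >= - 2 * m k.+1]; on a good
   step this is at least [- 2 * e * m k], the lower bound required for a negative ball. *)
have neg_k k : (k < T)%N -> m k.+1 <= expR 1 * m k -> forall x, `|x - y k| <= c3 * es -> phi x < 0.
  move=> kT good; have ins x : `|x - y k| <= es -> `|x - x0| <= s k.+1.
    by move=> xy; rewrite (s_step k kT) [s k + _]addrC; exact: (box_trans xy (y_s k)).
  have es_le1 : 0 < es <= 1 by rewrite es0/=; clear -es_r1 r1_le rho_le1 r10; lra.
  apply: (neg R0 a b KR ell lam es (m k) phi dphi Hphi (y k)) => //.
  - have : 3 * n%:R ^+ 2 * lam * es ^+ 2 <= 3 * n%:R ^+ 2 * lam * r1 ^+ 2.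
      rewrite ler_wpM2l ?mulr_ge0 ?sqr_ge0 ?(ltW lam0)//.
      by rewrite lerXn2r ?nnegrE// ltW.
    have -> : 3 * n%:R ^+ 2 * lam * r1 ^+ 2 = 3 / 64 * (lam * rho ^+ 2) by rewrite -r1E; field.
    by move=> ha; clear -ha lam1; lra.
  - by move=> x /ins xs; apply: sub; exact: (le_trans xs (s_rho _)).
  - by apply: regular_sub reg _ => x /ins xs; exact: (le_trans xs (s_rho _)).
  - by move=> x /ins xs; apply: Lphi; exact: (le_trans xs (s_rho _)).
  - move=> x /ins xs; apply: le_trans (y_lb _ _ xs); rewrite lerN2; have ha := good.
    have /andP[_ h2] := h_bd x (le_trans xs (s2 _)).
    have hb : m k.+1 * h x <= m k.+1 * 2 by rewrite ler_pM2l.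
    by clear -ha hb; lra.
  - rewrite y_phi lerN2; have /andP[h1 _] := hyk k.
    by rewrite ler_peMr// ltW.
have y_off z k : (k < T)%N -> m k.+1 <= expR 1 * m k -> closure Om z -> c3 * es <= `|z - y k|.
  move=> kT good cz; rewrite leNgt; apply/negP => zy.
  have [x [Omx xy]] := cz _ (box_nbhs zy).
  have := neg_k k kT good x (ltW xy); rewrite ltNge => /negP; apply; apply/ltW/Om_gt0 => //.
  have ces : c3 * es <= es by rewrite ler_piMl// ltW.
  apply: le_trans (box_trans (ltW xy) (y_s k)) _.
  by have ha := s2 k; clear -ha ces r1_le es_r1 r10; lra.
pose S (k : 'I_T) := m k.+1 <= expR 1 * m k.
(* [e^bad * m 0 <= m T <= G * phi x0 <= 4 * CH * G * m 0 <= e^(T / 2) * m 0], so at most half of the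
   steps are bad. *)
have count : T%:R / 2 <= \sum_(k < T | S k) (1 : R).
  have := jumps_le T m_gt0 m_mon; set bad := \sum_(k < T | ~~ _) _ => h1.
  have : \sum_(k < T | S k) (1 : R) + bad = T%:R.
    by rewrite -(bigID S xpredT (fun=> 1)) sumr_const card_ord.
  have h2 : expR bad * m 0%N <= expR (T%:R / 2) * m 0%N.
    apply: le_trans h1 _; apply: le_trans mT _.
    apply: le_trans (_ : G * (4 * CH * m 0%N) <= _).
      by rewrite ler_pM2l.
    have -> : G * (4 * CH * m 0%N) = 4 * CH * G * m 0%N by ring.
    by rewrite ler_pM2r.
  move: h2; rewrite ler_pM2r// ler_expR => h2 h3; clear -h2 h3; lra.
pose X := c3 * es / 2.
have X0 : 0 < X by rewrite divr_gt0// mulr_gt0.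
have X20 : 0 < X ^+ 2 by rewrite exprn_gt0.
(* Bound for the sum of all poles: the value of one pole at distance [X] times the constant 24 of
   the convergent series. *)
pose B := (X ^+ 2) `^ (- (pexp R n / 2)) * 24.
have P0 : 0 < (X ^+ 2) `^ (- (pexp R n / 2)) by rewrite powR_gt0.
have B0 : 0 < B by rewrite mulr_gt0.
apply: (@barrier_contradiction R n n3 R0 K a b K0 KR ell lam phi dphi Hphi x0 lam0 T rho (phi x0) (4 * B)^-1 B S (fun k => y k) Om) => //.
- move=> k; apply: le_trans (y_s k) _; apply: le_trans (s2 k) _.
  by rewrite -r1E le_eqVlt; apply/orP; left; apply/eqP; clear -nR; field; lra.
- move=> z k Sk cz _; apply: sqn_gt0 => //; rewrite -normr_gt0.
  by apply: lt_le_trans (y_off z k (ltn_ord k) Sk cz); rewrite mulr_gt0.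
- by rewrite invr_gt0 mulr_gt0.
(* [u] is the position of [z] in units of shells. As [y k] is at distance exactly [s k] from [x0],
   [|z - y k|] is at least [es * |u - k|]; it is also at least [c3 * es], and the two together give
   [X * (1 + |u - k|)]. *)
- move=> z cz zr; pose u := (`|z - x0| - r1) / es.
  have term (k : 'I_T) : S k -> sqn (z - y k) `^ (- (pexp R n / 2)) <= (X ^+ 2) `^ (- (pexp R n / 2)) * (1 + `|u - k%:R|) `^ (- (3 / 2)).
    move=> Sk; have h1 := y_off z k (ltn_ord k) Sk cz.
    have h2 : es * `|u - k%:R| <= `|z - y k|.
      have -> : es * `|u - k%:R| = `| `|z - x0| - s k|.
        rewrite -{1}(gtr0_norm es0) -normrM (sE k (ltnW (ltn_ord k))); congr (`| _ |).
        by rewrite /u; field; rewrite lt0r_neq0.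
      rewrite -(y_bd k (m_gt0 k)); apply: le_trans (ler_dist_dist _ _) _.
      by rewrite opprB addrA subrK.
    set Y := 1 + _; have Y1 : 1 <= Y by rewrite lerDl.
    have h3 : X * Y <= `|z - y k|.
      have u0 := normr_ge0 (u - k%:R); have [uk|uk] := leP `|u - k%:R| 1.
        have -> : X * Y = c3 * es * (Y / 2) by rewrite /X; ring.
        apply: le_trans h1; apply: ler_piMr; first by rewrite mulr_ge0 ?ltW.
        by rewrite /Y; clear -uk; lra.
      have -> : X * Y = c3 * (es * (Y / 2)) by rewrite /X; ring.
      have Y20 : 0 <= es * (Y / 2) by rewrite mulr_ge0 ?(ltW es0)// divr_ge0// (le_trans _ Y1).
      apply: le_trans (ler_piMl Y20 c31) _; apply: le_trans h2; rewrite ler_pM2l// /Y.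
      by clear -uk; lra.
    have XY0 : 0 < X * Y by rewrite mulr_gt0// (lt_le_trans ltr01).
    apply: (@le_trans _ _ (((X * Y) ^+ 2) `^ (- (pexp R n / 2)))).
      apply: powRN_le; [exact: ltW | by rewrite exprn_gt0 |].
      apply: le_trans (sqn_ge _ n0); rewrite lerXn2r ?nnegrE// ltW//.
    have Y0 : 0 <= Y by apply: le_trans Y1.
    rewrite exprMn powRM ?sqr_ge0// ler_pM2l// -(powR_mulrn 2 Y0) -powRrM.
    apply: ler_powR => //; have hp := pexp_gt1 R n3; clear -hp; lra.
  apply: le_trans (ler_sum _ term) _; rewrite -mulr_sumr /B ler_pM2l//.
  apply: le_trans (sum_powR_dist u T); rewrite big_mkcond /=; apply: ler_sum => k _.
  by case: ifP => // _; exact: powR_ge0.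
- by rewrite le_eqVlt; apply/orP; left; apply/eqP; field; rewrite lt0r_neq0.
- have Tp0 : 0 < T%:R `^ (pexp R n - 1) by rewrite powR_gt0.
  have XrE : (X ^+ 2) `^ (pexp R n / 2) * (rho ^+ 2) `^ (- (pexp R n / 2)) = C3 * T%:R `^ (- pexp R n).
    have e1 : rho ^+ 2 = (X ^+ 2) / ((c3 / (16 * n%:R)) ^+ 2) * T%:R ^+ 2.
      by rewrite /X esE -r1E; field; rewrite ?lt0r_neq0.
    have c0 : 0 < (c3 / (16 * n%:R)) ^+ 2 by rewrite exprn_gt0// divr_gt0// mulr_gt0// ltr0n.
    rewrite e1 powRM ?divr_ge0 ?sqr_ge0// powRM ?sqr_ge0 ?invr_ge0 ?sqr_ge0// mulrA mulrA.
    rewrite -powRD ?addrN ?powRr0 ?mul1r ?(gt_eqF X20) ?implybT//.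
    rewrite -(powR_inv1 (ltW c0)) -!powRrM mulN1r opprK C3E; congr (_ * _).
    by rewrite -(powR_mulrn 2 (ltW T0R)) -powRrM; congr (_ `^ _); field.
  have h1 : C3 * T%:R `^ (- pexp R n) / 96 * (T%:R / 2) <= (4 * B)^-1 * ((\sum_(k < T | S k) 1) * (rho ^+ 2) `^ (- (pexp R n / 2))).
    have -> : (4 * B)^-1 * ((\sum_(k < T | S k) 1) * (rho ^+ 2) `^ (- (pexp R n / 2))) =
       C3 * T%:R `^ (- pexp R n) / 96 * \sum_(k < T | S k) 1.
      rewrite -XrE /B powRN; set SS := \sum_(_ < _ | _) _; field.
      by rewrite gt_eqF// powR_gt0.
    by rewrite ler_wpM2l// divr_ge0// mulr_ge0 ?(ltW C30)// powR_ge0.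
  apply: lt_le_trans h1.
  have -> : C3 * T%:R `^ (- pexp R n) / 96 * (T%:R / 2) = C3 / 192 * (T%:R `^ (pexp R n - 1))^-1.
    have -> : T%:R `^ (- pexp R n) = T%:R^-1 * (T%:R `^ (pexp R n - 1))^-1.
      rewrite -powRN -(powR_inv1 (ltW T0R)) -powRD ?(gt_eqF T0R) ?implybT//; congr (_ `^ _); ring.
    by field; rewrite !gt_eqF.
  rewrite ltr_pdivlMr//.
  have -> : 2 * n%:R * lam * rho ^+ 2 * T%:R `^ (pexp R n - 1) = 2 * n%:R * (lam * rho ^+ 2 * T%:R `^ (pexp R n - 1)) by ring.
  apply: le_lt_trans (_ : 2 * n%:R * eta < _); first by rewrite ler_pM2l// mulr_gt0.
  apply: le_lt_trans (_ : 2 * n%:R * (C3 / (400 * n%:R)) < _); first by rewrite ler_pM2l// mulr_gt0.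
  have -> : 2 * n%:R * (C3 / (400 * n%:R)) = C3 / 200 by field; clear -nge1; lra.
  by clear -C30; lra.
Qed.



(** [T], just above [2 * (lam^mu + C')], makes [e^(T / 2)] exceed [4 * CH * e^(lam^mu) / a0]. Since
    [lam >= lam0], also [T <= CT * lam^mu], and then the powers of [lam] in the bound for
    [lam * rho^2 * T^(pexp - 1)] cancel exactly. *)
Lemma local_sign (R : realType) (n : nat) (n3 : (3 <= n)%N) (K R0 : R) a b :
  0 <= K -> 0 < R0 <= 1 -> 4 * n%:R ^+ 2 * K * R0 <= 1 -> elliptic (eps0 R n) R0 K a b ->
  forall nu a0 lam0 : R, 0 < nu -> 0 < a0 -> 0 < lam0 ->
  let mu : R := (2 * n%:R * nu) / ((n%:R - 1) * (n%:R - 2)) in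
  exists2 c : R, 0 < c &
  forall (lam : R) phi dphi Hphi x0 (Om : set 'rV[R]_n),
  lam0 <= lam -> `|x0| <= R0 / 2 -> regular phi dphi Hphi x0 (R0 / 2) ->
  (forall x, `|x - x0| <= R0 / 2 -> Lop (a x) (b x) (dphi x) (Hphi x) = - lam * phi x) ->
  0 < phi x0 -> (forall x, `|x - x0| <= R0 / 2 -> a0 * expR (- (lam `^ mu)) * `|phi x| <= phi x0) ->
  Om x0 -> (forall x, Om x -> `|x - x0| <= R0 / 2 -> 0 < phi x) ->
  (forall x, closure Om x -> `|x - x0| <= R0 / 2 -> phi x <= phi x0) ->
  (forall z, closure Om z -> `|z - x0| < R0 / 2 -> 0 < phi z -> \forall x \near z, Om x) ->
  forall x, `|x - x0| <= c / lam `^ (2^-1 + nu) -> 0 <= phi x.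
Proof.
move=> K0 /andP[R00 R01] KR ell nu a0 lam0 nu0 a00 lam00 mu.
have [eta [c1 [CH [eta0 c10 CH1 main]]]] := shell_argument n3 K0.
have nR : 3 <= n%:R :> R by rewrite ler_nat.
have mu0 : 0 < mu.
  rewrite /mu divr_gt0 ?mulr_gt0//; clear -nR; lra.
have mup : mu * (pexp R n - 1) = 2 * nu.
  by rewrite /mu /pexp; field; clear -nR; apply/and3P; split; apply/eqP; lra.
have p1 : 0 <= pexp R n - 1 by have h := pexp_gt1 R n3; clear -h; lra.
clearbody mu.
have CHa : 0 < 4 * CH / a0 by rewrite divr_gt0// mulr_gt0//; clear -CH1; lra.
pose C' := `|ln (4 * CH / a0)|.
have C'0 : 0 <= C' by exact: normr_ge0.
have C'E : ln (4 * CH / a0) <= C' by exact: ler_norm.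
clearbody C'.
have l0m : 0 < lam0 `^ mu by rewrite powR_gt0.
pose CT := 2 + (2 * C' + 1) / lam0 `^ mu.
have CT0 : 0 < CT.
  by apply: ltr_wpDr => //; rewrite divr_ge0 ?(ltW l0m)//; clear -C'0; lra.
have CTp : 0 < CT `^ (pexp R n - 1) by rewrite powR_gt0.
pose e1 := eta / CT `^ (pexp R n - 1).
have e10 : 0 < e1 by rewrite divr_gt0.
pose e2 := R0 / 2 * lam0 `^ (2^-1 + nu).
have e20 : 0 < e2 by rewrite mulr_gt0 ?powR_gt0// divr_gt0.
(* The bound 1 gives [c2^2 <= c2], [e1] keeps the product at most [eta], and [e2] keeps [rho] at
   most [R0 / 2] for every [lam >= lam0]. *)
pose c2 := Num.min 1 (Num.min e1 e2).
have c20 : 0 < c2 by rewrite !lt_min ltr01 e10.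
have c21 : c2 <= 1 by rewrite ge_min lexx.
have c2e1 : c2 <= e1 by rewrite !ge_min lexx !orbT.
have c2e2 : c2 <= e2 by rewrite !ge_min lexx !orbT.
clearbody c2.
exists (c1 * c2); first exact: mulr_gt0.
move=> lam phi dphi Hphi x0 Om laml x0R reg Lphi phi0 phib Omx0 Om_gt0 Om_le Om_near x xc.
have lam_gt0 : 0 < lam by exact: lt_le_trans laml.
have lp (s : R) : 0 <= s -> lam0 `^ s <= lam `^ s.
  by move=> s0; apply: ge0_ler_powR => //; rewrite nnegrE ltW.
have lnu : 0 < lam `^ (2^-1 + nu) by rewrite powR_gt0.
pose rho := c2 / lam `^ (2^-1 + nu).
have rho0 : 0 < rho by rewrite divr_gt0.
have hn0 : 0 <= 2^-1 + nu by clear -nu0; lra.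
have rhoR : rho <= R0 / 2.
  rewrite ler_pdivrMr//; apply: le_trans c2e2 _; rewrite /e2 ler_pM2l ?divr_gt0//.
  exact: lp.
pose L := lam `^ mu.
have L0 : 0 < L by rewrite powR_gt0.
have LL : lam0 `^ mu <= L by exact: lp (ltW mu0).
pose T := (Num.truncn (2 * (L + C'))).+1.
have LC0 : 0 <= 2 * (L + C') by rewrite mulr_ge0// addr_ge0// ltW.
have /andP[T1 T2] := truncn_itv LC0; rewrite -/T in T2.
have T3 : T%:R <= CT * L.
  rewrite /T -natr1; apply: le_trans (lerD T1 (lexx 1)) _.
  have h1 : 1 <= L / lam0 `^ mu by rewrite ler_pdivlMr ?mul1r.
  have h2 : (2 * C' + 1) * 1 <= (2 * C' + 1) * (L / lam0 `^ mu) by rewrite ler_wpM2l//; clear -C'0; lra.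
  have -> : CT * L = 2 * L + (2 * C' + 1) * (L / lam0 `^ mu) by rewrite /CT; ring.
  by clear -h2; lra.
apply: (main R0 a b KR ell T lam rho (a0^-1 * expR L) phi dphi Hphi x0 Om) => //.
- by rewrite rho0/=; clear -rhoR R01 R00; lra.
- have -> : lam * rho ^+ 2 = c2 ^+ 2 * lam `^ (- (2 * nu)).
    have lE : lam = lam `^ 1 by rewrite powRr1// ltW.
    rewrite /rho expr_div_n mulrCA; congr (_ * _).
    rewrite -(powR_mulrn 2 (ltW lnu)) -powRrM {1}lE -powRB ?(gt_eqF lam_gt0) ?implybT//.
    by congr (_ `^ _); field.
  have h1 : T%:R `^ (pexp R n - 1) <= CT `^ (pexp R n - 1) * lam `^ (2 * nu).
    rewrite -mup powRrM -powRM ?(ltW CT0)// ?(ltW L0)//.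
    by apply: ge0_ler_powR => //; rewrite nnegrE// mulr_ge0// ltW.
  have ln0 : 0 <= c2 ^+ 2 * lam `^ (- (2 * nu)) by rewrite mulr_ge0 ?sqr_ge0// powR_ge0.
  apply: le_trans (ler_wpM2l ln0 h1) _.
  have -> : c2 ^+ 2 * lam `^ (- (2 * nu)) * (CT `^ (pexp R n - 1) * lam `^ (2 * nu)) = c2 ^+ 2 * CT `^ (pexp R n - 1).
    by rewrite powRN; field; rewrite gt_eqF// powR_gt0.
  rewrite -ler_pdivlMr// -/e1; apply: le_trans c2e1.
  by rewrite expr2 ler_piMl// ltW.
- have -> : 4 * CH * (a0^-1 * expR L) = expR (L + ln (4 * CH / a0)).
    by rewrite expRD lnK ?posrE//; ring.
  rewrite ler_expR; clear -C'E T2; lra.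
- move=> y yr; rewrite -(subrK x0 y); apply: le_trans (ler_normD _ _) _.
  have := le_trans yr rhoR; clear -x0R; lra.
- by apply: regular_sub reg _ => y yr; exact: le_trans rhoR.
- by move=> y yr; apply: Lphi; exact: le_trans rhoR.
- move=> y yr; have h := phib y (le_trans yr rhoR).
  rewrite -(ler_pM2l (_ : 0 < a0 * expR (- L))); last by rewrite mulr_gt0// expR_gt0.
  apply: le_trans h _; rewrite le_eqVlt; apply/orP; left; apply/eqP.
  by rewrite expRN; field; rewrite !gt_eqF// expR_gt0.
- by move=> y Oy yr; apply: Om_gt0 => //; exact: le_trans rhoR.
- by move=> y Oy yr; apply: Om_le => //; exact: le_trans rhoR.
- by move=> y Oy yr; apply: Om_near => //; exact: lt_le_trans rhoR.
- by rewrite /rho mulrA.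
Qed.

(** * Calculus in R^n *)

Section Calculus.
Variables (R : realType) (n : nat).
Notation V := 'rV[R]_n.
Implicit Types (f : V -> R) (x y z v p d : V) (U : set V).

Lemma line_is_derive f x v (t : R) : derivable f (x + t *: v) v ->
  is_derive t (1 : R) (fun s : R => f (x + s *: v)) ('D_v f (x + t *: v)).
Proof.
move=> df.
have E : (fun h : R => h^-1 *: (((fun s : R => f (x + s *: v)) \o shift t) (h *: (1 : R)) - f (x + t *: v))) =
         (fun h : R => h^-1 *: ((f \o shift (x + t *: v)) (h *: v) - f (x + t *: v))).
  apply/funext => h /=; congr (_ *: (f _ - _)).
  have -> : h *: (1 : R) = h by rewrite /GRing.scale/= mulr1.
  by rewrite scalerDl addrCA.
have dg : derivable (fun s : R => f (x + s *: v)) t 1 by rewrite /derivable E.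
by apply: DeriveDef => //; rewrite /derive E.
Qed.

Definition frechet f x d : Prop :=
  forall e : R, 0 < e -> \forall h \near (0 : V), `|f (x + h) - f x - dot d h| <= e * `|h|.

Lemma near0P (P : V -> Prop) x : (\forall h \near (0 : V), P (x + h)) <-> \forall y \near x, P y.
Proof.
split=> /nbhs_ballP[r /= r0 hr]; apply/nbhs_ballP; exists r => //= y; rewrite -ball_normE/=.
  move=> xy; rewrite -(subrKC x y); apply: hr.
  by rewrite -ball_normE /= sub0r normrN distrC.
by move=> y0; apply: hr; rewrite -ball_normE /= opprD addrA subrr.
Qed.

Lemma segment_mvt f x v : (forall s : R, 0 <= s <= 1 -> derivable f (x + s *: v) v) ->
  exists2 s : R, 0 < s < 1 & f (x + v) - f x = 'D_v f (x + s *: v).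
Proof.
move=> df; pose g (s : R) := f (x + s *: v).
have dg (s : R) : 0 <= s <= 1 -> is_derive s (1 : R) g ('D_v f (x + s *: v)).
  by move=> /df; exact: line_is_derive.
have [||s] := @MVT R g (fun s => 'D_v f (x + s *: v)) 0 1 ltr01.
- by move=> s; rewrite in_itv/= => /andP[s0 s1]; apply: dg; rewrite !ltW.
- apply: continuous_in_subspaceT => s; rewrite inE/= in_itv/= => s01.
  apply: differentiable_continuous; apply/derivable1_diffP.
  by have /@ex_derive := dg s s01.
rewrite in_itv/= => s01; rewrite subr0 mulr1 /g scale1r scale0r addr0 => h.
by exists s.
Qed.

Lemma derivable_scale f x v (c : R) : derivable f x v ->
  derivable f x (c *: v) /\ 'D_(c *: v) f x = c * 'D_v f x.
Proof.
move=> df; have h := @line_is_derive f x v 0; rewrite scale0r addr0 in h.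
have {}h := h df; pose g (t : R) := f (x + t *: v).
have gd : is_derive (c * 0 : R) (1 : R) g ('D_v f x) by rewrite mulr0.
have cd : is_derive (0 : R) (1 : R) (fun s : R => c * s) c.
  by apply: is_derive_eq; rewrite /GRing.scale/= mulr1.
have := is_derive1_comp gd cd.
have E : (g \o (fun s : R => c * s)) = (fun s : R => f (s *: (c *: v) + x)).
  by apply/funext => s; rewrite /g /= scalerA mulrC addrC.
rewrite E => hh; have ex := @ex_derive _ _ _ _ _ _ _ hh.
have dd : derivable f x (c *: v).
  by apply/derivable1P.
split => //; have := @derive_val _ _ _ _ _ _ _ hh; rewrite [RHS]mulrC => <-.
rewrite /derive.
have -> // : (fun h0 : R => h0^-1 *: ((f \o shift x) (h0 *: (c *: v)) - f x)) =
  (fun h0 : R => h0^-1 *: (((fun s : R => f (s *: (c *: v) + x)) \o shift 0) (h0 *: (1 : R)) - f (0 *: (c *: v) + x))).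
apply/funext => s /=; have -> : s *: (1 : R) = s by rewrite /GRing.scale/= mulr1.
by rewrite addr0 scale0r add0r.
Qed.

(** The increment is split along the path [z k], which switches on one coordinate at a time; on each
    edge the mean value theorem and the continuity of the partial derivatives bound the error by
    [e' * |h|]. *)
Lemma partial_frechet f x U : nbhs x U ->
  (forall y, U y -> forall i, derivable f y (delta_mx 0 i)) ->
  (forall i, {for x, continuous (partial i f)}) ->
  frechet f x (\row_i partial i f x).
Proof.
move=> Ux df cf e e0; pose e' := e / n.+1%:R.
have e'0 : 0 < e' by rewrite divr_gt0.
have near1 : \forall y \near x, U y /\ forall i, `|partial i f y - partial i f x| < e'.
  near=> y; split; first by near: y.
  near: y; apply: filter_forall => i.
  have /cvgrPdist_lt/(_ _ e'0) := cf i.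
  by apply: filterS => y; rewrite distrC.
have [r r0 hr] : exists2 r : R, 0 < r & forall h : V, `|h| < r -> U (x + h) /\ forall i, `|partial i f (x + h) - partial i f x| < e'.
  have [r r0 hr] := (nbhs_ballP _ _).1 near1; exists r => // h hr'; apply: hr.
  by rewrite -ball_normE /= opprD addrA subrr add0r normrN.
apply/nbhs_ballP; exists r => //= h; rewrite -ball_normE/= sub0r normrN => hlt.
pose z (k : nat) : V := \row_i (if (i < k)%N then h 0 i else 0).
have znorm k : `|z k| <= `|h|.
  apply: mx_norm_leP => // i; rewrite mxE; case: ifP => _; last by rewrite normr0.
  exact: coord_norm_le.
have zS (k : 'I_n) : z k.+1 = z k + h 0 k *: delta_mx 0 k.
  apply/rowP => i; rewrite !mxE ltnS leq_eqVlt /=; case: (eqVneq i k) => [->|ik].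
    by rewrite eqxx ltnn /= add0r mulr1.
  by rewrite -val_eqE /= in ik; rewrite (negbTE ik) /= mulr0 addr0.
have step (k : 'I_n) : `|f (x + z k.+1) - f (x + z k) - h 0 k * partial k f x| <= e' * `|h|.
  have seg s : 0 <= s <= 1 -> `|z k + s *: (h 0 k *: delta_mx 0 k)| <= `|h|.
    move=> /andP[s0 s1]; apply: mx_norm_leP => // i; rewrite !mxE.
    case: (eqVneq i k) => [->|ik].
      rewrite ltnn eqxx /= add0r mulr1 normrM ger0_norm//.
      by apply: le_trans (coord_norm_le h k); rewrite ler_piMl.
    rewrite andbF mulr0 mulr0 addr0; case: ifP => _; last by rewrite normr0.
    exact: coord_norm_le.
  have dk s : 0 <= s <= 1 -> derivable f (x + z k + s *: (h 0 k *: delta_mx 0 k)) (delta_mx 0 k).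
    by move=> s01; rewrite -addrA; apply: df; apply: (proj1 (hr _ _)); exact: le_lt_trans (seg s s01) hlt.
  have [|s s01] := @segment_mvt f (x + z k) (h 0 k *: delta_mx 0 k).
    by move=> s s01; have [] := derivable_scale (h 0 k) (dk s s01).
  have s01' : 0 <= s <= 1 by case/andP: s01 => ? ?; rewrite !ltW.
  rewrite -addrA -zS => ->; have [_ ->] := derivable_scale (h 0 k) (dk s s01').
  rewrite -mulrBr normrM mulrC ler_pM// ?coord_norm_le//.
  by rewrite -addrA; apply: ltW; apply: (proj2 (hr _ _)); exact: le_lt_trans (seg s s01') hlt.
have z0 : z 0%N = 0 by apply/rowP => i; rewrite !mxE.
have zn : z n = h by apply/rowP => i; rewrite !mxE ltn_ord.
have -> : f (x + h) - f x - dot (\row_i partial i f x) h =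
   \sum_(k < n) (f (x + z k.+1) - f (x + z k) - h 0 k * partial k f x).
  rewrite sumrB -(big_mkord xpredT (fun k => f (x + z k.+1) - f (x + z k))).
  rewrite (telescope_sumr (fun k => f (x + z k))) // z0 zn addr0; congr (_ - _).
  by apply: eq_bigr => k _; rewrite mxE mulrC.
apply: le_trans (ler_norm_sum _ _ _) _; apply: le_trans (ler_sum _ (fun k _ => step k)) _.
rewrite sum_ord_const mulrA ler_wpM2r// /e' mulrCA ler_piMr ?(ltW e0)//.
by rewrite ler_pdivrMr// mul1r ler_nat.
Unshelve. all: by end_near. Qed.

Lemma frechet_continuous f x d : frechet f x d -> {for x, continuous f}.
Proof.
move=> fr; apply: (proj2 (@cvgrPdist_le _ _ _ (nbhs x) (nbhs_filter x) f (f x))) => e e0.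
have h1 := fr 1 ltr01.
pose C := n%:R * `|d| + 1.
have C0 : 0 < C by rewrite ltr_wpDl// mulr_ge0.
have h2 : \forall h \near (0 : V), `|h| < e / C.
  by apply/nbhs_ballP; exists (e / C); rewrite /= ?divr_gt0// => h; rewrite -ball_normE/= sub0r normrN.
have : \forall h \near (0 : V), `|f x - f (h + x)| <= e.
  near=> h; have hh : `|f (x + h) - f x - dot d h| <= 1 * `|h| by near: h.
  have he : `|h| < e / C by near: h.
  rewrite distrC (addrC h x) -[f (x + h) - f x](subrK (dot d h)); apply: le_trans (ler_normD _ _) _.
  apply: le_trans (lerD hh (dot_norm_le _ _)) _; rewrite -mulrDl addrC -/C.
  by rewrite mulrC -ler_pdivlMr// ltW.
by move=> h; apply: (proj1 (near0P (fun t => `|f x - f t| <= e) x)); move: h; apply: filterS => h /=; rewrite (addrC x h).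
Unshelve. all: by end_near. Qed.

Lemma chain_rule f (s : R -> V) (t : R) d v : frechet f (s t) d -> is_derive t (1 : R) s v ->
  is_derive t (1 : R) (f \o s) (dot d v).
Proof.
move=> fr ds.
pose D (h : R) := s (h + t) - s t.
have sc : h^-1 *: D h @[h --> 0^'] --> v.
  have := @ex_derive _ _ _ _ _ _ _ ds; have := @derive_val _ _ _ _ _ _ _ ds.
  rewrite /derivable /derive.
  have -> : (fun h : R => h^-1 *: ((s \o shift t) (h *: (1 : R)) - s t)) = (fun h : R => h^-1 *: D h).
    by apply/funext => h; rewrite /= /GRing.scale/= mulr1.
  by move=> <-.
suff main : (fun h : R => h^-1 *: (f (s (h + t)) - f (s t))) @ 0^' --> dot d v.
  have E : (fun h : R => h^-1 *: (((f \o s) \o shift t) (h *: (1 : R)) - (f \o s) t)) = (fun h : R => h^-1 *: (f (s (h + t)) - f (s t))).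
    by apply/funext => h; rewrite /= /GRing.scale/= mulr1.
  by apply: DeriveDef; [rewrite /derivable E; apply/cvg_ex; exists (dot d v) | rewrite /derive E; exact/cvg_lim].
apply/cvgrPdist_le => e e0.
pose Cv := `|v| + 1; pose Cd := n%:R * `|d| + 1.
have Cv0 : 0 < Cv by rewrite ltr_wpDl.
have Cd0 : 0 < Cd by rewrite ltr_wpDl// mulr_ge0.
pose e1 := e / 2 / Cv; pose e2 := Num.min 1 (e / 2 / Cd).
have e10 : 0 < e1 by rewrite !divr_gt0.
have e20 : 0 < e2 by rewrite lt_min ltr01 !divr_gt0.
have near1 : \forall h \near (0:R)^', `|v - h^-1 *: D h| <= e2.
  by move/cvgrPdist_le : sc; apply.
have [r /= r0 hr] := (nbhs_ballP _ _).1 (fr e1 e10).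
have near2 : \forall h \near (0:R)^', `|h| < r / Cv.
  apply: nbhs_dnbhs; apply/nbhs_ballP; exists (r / Cv) => /=; first exact: divr_gt0.
  by move=> h; rewrite /ball/= sub0r normrN.
near=> h.
have h0 : h != 0 by near: h; exact: nbhs_dnbhs_neq.
have hn0 : 0 < `|h| by rewrite normr_gt0.
have v1 : `|v - h^-1 *: D h| <= e2 by near: h.
have hs : `|h| < r / Cv by near: h.
have e21 : e2 <= 1 by rewrite ge_min lexx.
have e22 : e2 <= e / 2 / Cd by rewrite ge_min lexx orbT.
have Dv : `|h^-1 *: D h| <= Cv.
  rewrite -[h^-1 *: D h](subKr v); apply: le_trans (ler_normB _ _) _.
  by rewrite lerD2l; exact: le_trans e21.
have DE : D h = h *: (h^-1 *: D h) by rewrite scalerA mulfV// scale1r.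
have Dn : `|D h| <= `|h| * Cv by rewrite DE normrZ ler_wpM2l.
have Dr : `|D h| < r by apply: le_lt_trans Dn _; rewrite -ltr_pdivlMr.
have := hr (D h); rewrite -ball_normE/= sub0r normrN => /(_ Dr).
rewrite {1}/D [s t + _]addrC subrK => F.
have -> : dot d v - h^-1 *: (f (s (h + t)) - f (s t)) =
   dot d (v - h^-1 *: D h) - h^-1 * (f (s (h + t)) - f (s t) - dot d (D h)).
  rewrite dotBr dotZr /GRing.scale/=; ring.
apply: le_trans (ler_normB _ _) _; rewrite (splitr e); apply: lerD.
  apply: le_trans (dot_norm_le _ _) _; apply: le_trans (_ : Cd * e2 <= _).
    by apply: ler_pM => //; rewrite ?mulr_ge0// lerDl.
  by rewrite mulrC -ler_pdivlMr.
rewrite normrM normfV mulrC ler_pdivrMr//; apply: le_trans F _.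
rewrite /e1; apply: le_trans (ler_wpM2l _ Dn) _; first by rewrite ltW.
by rewrite le_eqVlt; apply/orP; left; apply/eqP; field; rewrite gt_eqF.
Unshelve. all: by end_near. Qed.

End Calculus.

(** * Derivatives of products and determinants *)

Section DeriveAlgebra.
Variables (R : realType) (W : normedModType R).
Implicit Types (x v : W).

Lemma is_derive_mul (f g : W -> R) x v (a b : R) : is_derive x v f a -> is_derive x v g b ->
  is_derive x v (fun x => f x * g x) (a * g x + f x * b).
Proof.
move=> hf hg; have := is_deriveM hf hg; rewrite /GRing.scale/= => h.
by apply: is_derive_eq; rewrite addrC mulrC.
Qed.

Lemma is_derive_prod (I : eqType) (r : seq I) (f : I -> W -> R) (df : I -> R) x v : uniq r ->
  (forall k, is_derive x v (f k) (df k)) ->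
  is_derive x v (fun x => \prod_(k <- r) f k x)
   (\sum_(k <- r) \prod_(j <- r) (if j == k then df j else f j x)).
Proof.
move=> + hf; elim: r => [_|a r IH /= /andP[ar ur]].
  under eq_fun do rewrite big_nil; rewrite big_nil; exact: is_derive_cst.
under eq_fun do rewrite big_cons.
apply: is_derive_eq; first exact: is_derive_mul (hf a) (IH ur).
rewrite big_cons big_cons eqxx; congr (_ * _ + _).
  by apply: eq_big_seq => j jr; case: eqVneq => // ja; rewrite -ja jr in ar.
rewrite mulr_sumr; apply: eq_big_seq => k kr; rewrite big_cons.
by case: eqVneq => // ak; rewrite ak kr in ar.
Qed.

Lemma is_derive_sumf (I : Type) (r : seq I) (f : I -> W -> R) (df : I -> R) x v :
  (forall k, is_derive x v (f k) (df k)) ->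
  is_derive x v (fun x => \sum_(k <- r) f k x) (\sum_(k <- r) df k).
Proof.
move=> hf; elim: r => [|a r IH].
  under eq_fun do rewrite big_nil; rewrite big_nil; exact: is_derive_cst.
by under eq_fun do rewrite big_cons; rewrite big_cons; exact: is_deriveD (hf a) IH.
Qed.

(** Jacobi's formula. The product rule in each permutation gives the sum over k of the determinants
    with the k-th row differentiated, and each is expanded along that row. *)
Lemma is_derive_det m (A : W -> 'M[R]_m) (dA : 'M[R]_m) x v :
  (forall i j, is_derive x v (fun y => A y i j) (dA i j)) ->
  is_derive x v (fun y => \det (A y)) (\sum_i \sum_j dA i j * cofactor (A x) i j).
Proof.
move=> hA; rewrite /determinant.
pose B (k : 'I_m) : 'M[R]_m := \matrix_(i, j) (if i == k then dA i j else A x i j).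
have : is_derive x v (fun y => \sum_(s : 'S_m) (-1) ^+ s * \prod_i A y i (s i))
   (\sum_(s : 'S_m) (0 * \prod_i A x i (s i) + (-1) ^+ s * \sum_k \prod_i (if i == k then dA i (s i) else A x i (s i)))).
  apply: is_derive_sumf => s.
  have hc : is_derive x v (fun=> (-1) ^+ s : R) 0 by exact: is_derive_cst.
  have := @is_derive_prod _ (index_enum 'I_m) (fun i y => A y i (s i)) (fun i => dA i (s i)) x v (index_enum_uniq _) (fun k => hA k (s k)).
  exact: is_derive_mul hc.
move=> h; apply: is_derive_eq.
transitivity (\sum_k \det (B k)).
  rewrite /determinant exchange_big; apply: eq_bigr => s _ /=.
  rewrite mul0r add0r mulr_sumr; apply: eq_bigr => k _; congr (_ * _).
  by apply: eq_bigr => i _; rewrite mxE.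
apply: eq_bigr => k _; rewrite (expand_det_row _ k); apply: eq_bigr => j _.
rewrite mxE eqxx; congr (_ * _); rewrite /cofactor; congr (_ * \det _).
by apply/matrixP => i l; rewrite !mxE eq_sym (negbTE (neq_lift _ _)).
Qed.

End DeriveAlgebra.

(** * Functions with continuous partial derivatives *)

Section C1Functions.
Variables (R : realType) (n : nat).
Notation V := 'rV[R]_n.
Implicit Types (f : V -> R) (x y z v p d : V) (U : set V).

Definition grad f x : V := \row_i partial i f x.

Definition C1 U f : Prop := forall x, U x -> forall i,
  derivable f x (delta_mx 0 i) /\ {for x, continuous (partial i f)}.

Lemma C1_intro U f (df : 'I_n -> V -> R) : open U ->
  (forall x, U x -> forall i, is_derive x (delta_mx 0 i) f (df i x) /\ {for x, continuous (df i)}) ->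
  C1 U f.
Proof.
move=> oU h x Ux i; have [[dx _] cx] := h x Ux i; split => //.
have E : \forall y \near x, df i y = partial i f y.
  have := open_nbhs_nbhs (conj oU Ux); apply: filterS => y Uy.
  by rewrite /partial; have [[_ ->] _] := h y Uy i.
change (partial i f y @[y --> x] --> partial i f x); rewrite -(nbhs_singleton E).
by apply: cvg_trans cx; exact: near_eq_cvg E.
Qed.

Lemma C1_frechet U f x : open U -> C1 U f -> U x -> frechet f x (grad f x).
Proof.
move=> oU h Ux; apply: (@partial_frechet _ _ _ _ U); first exact: open_nbhs_nbhs.
- by move=> y Uy i; case: (h y Uy i).
- by move=> i; case: (h x Ux i).
Qed.

Lemma C1_continuous U f x : open U -> C1 U f -> U x -> {for x, continuous f}.
Proof. by move=> oU h Ux; exact: frechet_continuous (C1_frechet oU h Ux). Qed.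

Lemma C1_is_derive U f x i : C1 U f -> U x -> is_derive x (delta_mx 0 i) f (partial i f x).
Proof. by move=> h Ux; apply: DeriveDef => //; case: (h x Ux i). Qed.

Lemma C1_partial_continuous U f x i : C1 U f -> U x -> {for x, continuous (partial i f)}.
Proof. by move=> h Ux; case: (h x Ux i). Qed.

Lemma line_is_deriveP f x v (l : R) :
  is_derive (0 : R) (1 : R) (fun s : R => f (x + s *: v)) l -> is_derive x v f l.
Proof.
have E : (fun h : R => h^-1 *: (((fun s : R => f (x + s *: v)) \o shift 0) (h *: (1 : R)) - f (x + (0 : R) *: v))) =
         (fun h : R => h^-1 *: ((f \o shift x) (h *: v) - f x)).
  apply/funext => h /=; rewrite scale0r !addr0.
  have -> : h *: (1 : R) = h by rewrite /GRing.scale/= mulr1.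
  by rewrite (addrC x).
by case; rewrite /derivable /derive E => dg vg; apply: DeriveDef.
Qed.

Lemma C1_cst U c : open U -> C1 U (fun=> c).
Proof.
move=> oU; apply: (@C1_intro _ _ (fun _ _ => 0)) => // x Ux i.
by split; [exact: is_derive_cst | exact: cst_continuous].
Qed.

Lemma C1D U f g : open U -> C1 U f -> C1 U g -> C1 U (fun x => f x + g x).
Proof.
move=> oU hf hg; apply: (@C1_intro _ _ (fun i x => partial i f x + partial i g x)) => // x Ux i.
split; first exact: is_deriveD (C1_is_derive i hf Ux) (C1_is_derive i hg Ux).
exact: (cvgD (C1_partial_continuous hf Ux) (C1_partial_continuous hg Ux)).
Qed.

Lemma C1M U f g : open U -> C1 U f -> C1 U g -> C1 U (fun x => f x * g x).
Proof.
move=> oU hf hg; apply: (@C1_intro _ _ (fun i x => partial i f x * g x + f x * partial i g x)) => // x Ux i.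
split; first exact: is_derive_mul (C1_is_derive i hf Ux) (C1_is_derive i hg Ux).
have cf := C1_continuous oU hf Ux; have cg := C1_continuous oU hg Ux.
have df := C1_partial_continuous hf Ux; have dg := C1_partial_continuous hg Ux.
exact: (cvgD (cvgM (df i) cg) (cvgM cf (dg i))).
Qed.

Lemma C1_sum (I : Type) (r : seq I) (P : pred I) (f : I -> V -> R) U : open U ->
  (forall k, P k -> C1 U (f k)) -> C1 U (fun x => \sum_(k <- r | P k) f k x).
Proof.
move=> oU h; elim: r => [|k r IH].
  by under eq_fun do rewrite big_nil; exact: C1_cst.
have [Pk|/negbTE Pk] := boolP (P k); under eq_fun do rewrite big_cons Pk.
  exact: C1D oU (h _ Pk) IH.
exact: IH.
Qed.

Lemma C1_prod (I : Type) (r : seq I) (P : pred I) (f : I -> V -> R) U : open U ->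
  (forall k, P k -> C1 U (f k)) -> C1 U (fun x => \prod_(k <- r | P k) f k x).
Proof.
move=> oU h; elim: r => [|k r IH].
  by under eq_fun do rewrite big_nil; exact: C1_cst.
have [Pk|/negbTE Pk] := boolP (P k); under eq_fun do rewrite big_cons Pk.
  exact: C1M oU (h _ Pk) IH.
exact: IH.
Qed.

Lemma is_derive_comp (s : R -> R) f x v (a l : R) : is_derive (f x) (1 : R) s l -> is_derive x v f a ->
  is_derive x v (fun y => s (f y)) (l * a).
Proof.
move=> hs hf; apply: line_is_deriveP.
have h0 : derivable f (x + (0 : R) *: v) v by rewrite scale0r addr0; case: hf.
have := line_is_derive h0; rewrite scale0r addr0; have [_ ->] := hf => hl.
have hs' : is_derive (f (x + (0 : R) *: v)) (1 : R) s l by rewrite scale0r addr0.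
exact: (@is_derive1_comp _ s (fun t : R => f (x + t *: v)) 0 _ _ hs' hl).
Qed.

Lemma C1_comp (s s' : R -> R) f U : open U -> C1 U f ->
  (forall x, U x -> is_derive (f x) (1 : R) s (s' (f x)) /\ {for f x, continuous s'}) ->
  C1 U (fun x => s (f x)).
Proof.
move=> oU hf hs; apply: (@C1_intro _ _ (fun i x => s' (f x) * partial i f x)) => // x Ux i.
have [ds cs] := hs x Ux; split; first exact: is_derive_comp ds (C1_is_derive i hf Ux).
have cf := C1_continuous oU hf Ux; have dg := C1_partial_continuous hf Ux.
exact: (cvgM (continuous_comp cf cs) (dg i)).
Qed.

Lemma C1V f U : open U -> C1 U f -> (forall x, U x -> f x != 0) -> C1 U (fun x => (f x)^-1).
Proof.
move=> oU hf f0; apply: (@C1_comp (fun t => t^-1) (fun t => - t ^- 2)) => // x Ux; split.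
  have := @is_deriveV R id (f x) 1 1 (f0 x Ux) (is_derive_id _ _).
  by move=> h; apply: is_derive_eq; rewrite /GRing.scale/= mulr1.
apply: (@continuousN _ _ _ (fun t : R => (t ^+ 2)^-1)).
by apply: continuousV; [rewrite expf_neq0// f0 | exact: exprn_continuous].
Qed.

Lemma C1_sqrt f U : open U -> C1 U f -> (forall x, U x -> 0 < f x) -> C1 U (fun x => Num.sqrt (f x)).
Proof.
move=> oU hf f0; apply: (@C1_comp Num.sqrt (fun t => (2 * Num.sqrt t)^-1)) => // x Ux; split.
  exact: is_derive1_sqrt (f0 x Ux).
apply: continuousV; first by rewrite mulf_neq0// gt_eqF// sqrtr_gt0 f0.
by apply: continuousM; [exact: cst_continuous | exact: sqrt_continuous].
Qed.

Lemma C1_eq U f g : open U -> C1 U f -> (forall x, U x -> f x = g x) -> C1 U g.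
Proof.
move=> oU hf E; apply: (@C1_intro _ _ (fun i => partial i f)) => // x Ux i.
split; last exact: C1_partial_continuous hf Ux.
apply: (near_eq_is_derive _ (C1_is_derive i hf Ux)).
by have := open_nbhs_nbhs (conj oU Ux); apply: filterS => y /E.
Qed.

Lemma C1_det m (A : V -> 'M[R]_m) U : open U -> (forall i j, C1 U (fun x => A x i j)) -> C1 U (fun x => \det (A x)).
Proof.
move=> oU hA; rewrite /determinant; apply: C1_sum => // s _.
by apply: C1M => //; [exact: C1_cst | apply: C1_prod].
Qed.

Lemma C1_adj m (A : V -> 'M[R]_m) U i j : open U -> (forall i j, C1 U (fun x => A x i j)) -> C1 U (fun x => (\adj (A x)) i j).
Proof.
move=> oU hA; under eq_fun do rewrite mxE /cofactor.
apply: C1M => //; first exact: C1_cst.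
by apply: (@C1_det _ (fun y => row' j (col' i (A y)))) => // k l; under eq_fun do rewrite !mxE; exact: hA.
Qed.

End C1Functions.

Section C2Functions.
Variables (R : realType) (n : nat).
Notation V := 'rV[R]_n.
Implicit Types (f : V -> R) (x y z v p d : V) (U : set V).

Lemma smooth_on_C1 U f : smooth_on U f -> C1 U f.
Proof.
move=> h x Ux i; have [_ /(_ i)[dx _]] := h 1%N.
by have [_ /(_ i)[_ [cx _]]] := h 1%N; split; [exact: dx | exact: cx].
Qed.

Lemma smooth_on_partial U f i : smooth_on U f -> smooth_on U (partial i f).
Proof. by move=> h k; have [_ /(_ i)[]] := h k.+1. Qed.

Lemma smooth_on_continuous U f x : smooth_on U f -> U x -> {for x, continuous f}.
Proof. by move=> /(_ 0%N)[h _]; exact: h. Qed.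

Lemma is_derive_shift f x w v (l : R) : is_derive (x + w) v f l -> is_derive x v (fun y => f (y + w)) l.
Proof.
move=> h; apply: line_is_deriveP.
have h0 : derivable f (x + w + (0 : R) *: v) v by rewrite scale0r addr0; case: h.
have := line_is_derive h0; rewrite scale0r addr0; have [_ ->] := h.
have -> // : (fun s : R => f (x + w + s *: v)) = (fun s : R => f (x + s *: v + w)).
by apply/funext => s; rewrite addrAC.
Qed.

Lemma coord_mvt f x i (t : R) :
  (forall s : R, 0 <= s <= 1 -> derivable f (x + (s * t) *: delta_mx 0 i) (delta_mx 0 i)) ->
  exists2 s : R, 0 <= s <= 1 & f (x + t *: delta_mx 0 i) - f x = t * partial i f (x + (s * t) *: delta_mx 0 i).
Proof.
move=> df; have [s s01|s /andP[s0 s1] ->] := @segment_mvt _ _ f x (t *: delta_mx 0 i).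
  by have := derivable_scale t (df s s01); rewrite scalerA => -[].
have s01 : 0 <= s <= 1 by rewrite !ltW.
exists s => //; have := derivable_scale t (df s s01); rewrite scalerA => -[_ ->].
by [].
Qed.

(** The mean value theorem in direction i for the difference in direction j, and then in direction j
    for [partial i f]. The left side is symmetric in i and j, which is how mixed derivatives are
    shown to commute. *)
Lemma second_difference U f x i j (t : R) : C1 U f -> C1 U (partial i f) -> 0 <= t ->
  (forall y, `|y - x| <= 2 * t -> U y) ->
  exists2 y, `|y - x| <= 2 * t &
   f (x + t *: delta_mx 0 i + t *: delta_mx 0 j) - f (x + t *: delta_mx 0 i)
   - (f (x + t *: delta_mx 0 j) - f x) = t ^+ 2 * partial j (partial i f) y.
Proof.
move=> hf hif t0 hU.
have bd (s : R) k : 0 <= s <= 1 -> `|(s * t) *: (delta_mx 0 k : V)| <= t.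
  move=> /andP[s0 s1]; rewrite normrZ ger0_norm ?mulr_ge0//.
  apply: le_trans (_ : s * t * 1 <= _); first by rewrite ler_wpM2l ?mulr_ge0 ?norm_delta_mx.
  by rewrite mulr1 ler_piMl.
have bd1 k : `|t *: (delta_mx 0 k : V)| <= t.
  by have := @bd 1 k; rewrite mul1r; apply; rewrite ler01 lexx.
have bd2 (a b : V) : `|a| <= t -> `|b| <= t -> `|x + a + b - x| <= 2 * t.
  move=> ha hb; have -> : x + a + b - x = a + b by rewrite (addrC _ (- x)) !addrA addNr add0r.
  apply: le_trans (ler_normD _ _) _.
  by rewrite mulr_natl mulr2n lerD.
pose g y := f (y + t *: delta_mx 0 j) - f y.
have gd (s : R) : 0 <= s <= 1 -> is_derive (x + (s * t) *: delta_mx 0 i) (delta_mx 0 i) g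
    (partial i f (x + (s * t) *: delta_mx 0 i + t *: delta_mx 0 j) - partial i f (x + (s * t) *: delta_mx 0 i)).
  move=> s01; have h1 : U (x + (s * t) *: delta_mx 0 i + t *: delta_mx 0 j) by apply: hU; apply: bd2; [exact: bd | exact: bd1].
  have h2 : U (x + (s * t) *: delta_mx 0 i).
    by apply: hU; have := @bd2 _ 0 (bd s i s01); rewrite addr0; apply; rewrite normr0.
  exact: is_deriveB (is_derive_shift (C1_is_derive i hf h1)) (C1_is_derive i hf h2).
have [s s01|s s01] := @coord_mvt g x i t; first by have [] := gd s s01.
rewrite /partial; have [_ ->] := gd s s01 => E.
have [s' s'01|s' s'01 E'] := @coord_mvt (partial i f) (x + (s * t) *: delta_mx 0 i) j t.
  by apply: (proj1 (hif _ _ j)); apply: hU; apply: bd2; apply: bd.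
exists (x + (s * t) *: delta_mx 0 i + (s' * t) *: delta_mx 0 j).
  by apply: bd2; apply: bd.
by move: E; rewrite /g => ->; rewrite E' mulrA expr2.
Qed.

Lemma eq_of_nearby_values (G H : V -> R) x :
  {for x, continuous G} -> {for x, continuous H} ->
  (forall r : R, 0 < r -> exists y1 y2, [/\ `|y1 - x| < r, `|y2 - x| < r & G y1 = H y2]) ->
  G x = H x.
Proof.
move=> cG cH hr; apply/eqP; rewrite -subr_eq0 -normr_le0; apply/ler_addgt0Pl => e e0.
rewrite addr0; have e2 : 0 < e / 2 by rewrite divr_gt0.
have nG : \forall y \near x, `|G x - G y| < e / 2.
  exact: (proj1 (@cvgrPdist_lt _ _ _ (nbhs x) (nbhs_filter x) G (G x)) cG _ e2).
have nH : \forall y \near x, `|H x - H y| < e / 2.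
  exact: (proj1 (@cvgrPdist_lt _ _ _ (nbhs x) (nbhs_filter x) H (H x)) cH _ e2).
have [r /= r0 hb] := (nbhs_ballP _ _).1 (filterI nG nH).
have [y1 [y2 [y1r y2r E]]] := hr r r0.
have [|h1 _] := hb y1; first by rewrite -ball_normE /= distrC.
have [|_ h2] := hb y2; first by rewrite -ball_normE /= distrC.
apply: le_trans (ler_distD (G y1) _ _) _; rewrite {2}E (distrC (H y2)) (splitr e).
by rewrite lerD// ltW.
Qed.

Lemma partialC U f x i j : open U -> C1 U f -> (forall i, C1 U (partial i f)) -> U x ->
  partial i (partial j f) x = partial j (partial i f) x.
Proof.
move=> oU hf hif Ux.
have swap (a b c d : R) : a - b - (c - d) = a - c - (b - d) by ring.
apply: (@eq_of_nearby_values (partial i (partial j f)) (partial j (partial i f))).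
- exact: C1_partial_continuous (hif j) Ux.
- exact: C1_partial_continuous (hif i) Ux.
move=> r r0; have [r' /= r'0 hr] := (nbhs_ballP _ _).1 (open_nbhs_nbhs (conj oU Ux)).
pose t := Num.min r r' / 4; have m0 : 0 < Num.min r r' by rewrite lt_min r0.
have t0 : 0 < t by rewrite divr_gt0.
have t2 : 2 * t < Num.min r r' by rewrite /t; clear -m0; move: (Num.min _ _) m0 => q; lra.
have hU y : `|y - x| <= 2 * t -> U y.
  move=> h; apply: hr; rewrite -ball_normE /= distrC; apply: le_lt_trans h (lt_le_trans t2 _).
  by rewrite ge_min lexx orbT.
have hr' y : `|y - x| <= 2 * t -> `|y - x| < r.
  by move=> h; apply: le_lt_trans h (lt_le_trans t2 _); rewrite ge_min lexx.
have [y1 y1x E1] := @second_difference U f x i j t hf (hif i) (ltW t0) hU.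
have [y2 y2x E2] := @second_difference U f x j i t hf (hif j) (ltW t0) hU.
exists y2, y1; split; [exact: hr' | exact: hr' |].
apply: (@mulfI _ (t ^+ 2)); first by rewrite expf_neq0// gt_eqF.
apply: etrans (etrans (esym E2) _) E1.
rewrite (addrAC x (t *: delta_mx 0 j)); exact: swap.
Qed.

Lemma is_derive_row (s : R -> V) (t : R) (w : V) :
  (forall k, is_derive t (1 : R) (fun r => s r 0 k) (w 0 k)) -> is_derive t (1 : R) s w.
Proof.
move=> h; have ds : derivable s t 1 by apply/derivable_mxP => i k; rewrite ord1; case: (h k).
apply: DeriveDef => //; rewrite derive_mx//; apply/rowP => k; rewrite mxE.
by have [_ <-] := h k.
Qed.

Lemma is_derive_coord (s : R -> V) (t : R) (w : V) k :
  is_derive t (1 : R) s w -> is_derive t (1 : R) (fun r => s r 0 k) (w 0 k).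
Proof.
case=> ds <-; apply: DeriveDef; first by move/derivable_mxP : ds; apply.
by rewrite derive_mx// mxE.
Qed.

Lemma is_derive_line x p (t : R) : is_derive t (1 : R) (fun s : R => x + s *: p) p.
Proof.
apply: is_derive_row => k.
have -> : (fun r : R => (x + r *: p) 0 k) = (fun r : R => x 0 k + r * p 0 k).
  by apply/funext => r; rewrite !mxE.
have h : is_derive t (1 : R) (fun r : R => r * p 0 k) (1 * p 0 k + t * 0).
  exact: is_derive_mul (is_derive_id _ _) (is_derive_cst _ _ _).
have := is_deriveD (is_derive_cst (x 0 k) t (1 : R)) h.
by move=> h'; apply: is_derive_eq; rewrite mulr0 addr0 mul1r add0r.
Qed.

Lemma jet_C2 U f x : open U -> C1 U f -> (forall i, C1 U (partial i f)) -> U x ->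
  jet f x (grad f x) (\matrix_(i, j) partial i (partial j f) x).
Proof.
move=> oU hf hif Ux p.
have lin (g : V -> R) (t : R) : C1 U g -> U (x + t *: p) ->
    is_derive t (1 : R) (fun s : R => g (x + s *: p)) (dot (grad g (x + t *: p)) p).
  by move=> hg Uy; apply: (@chain_rule _ _ g (fun s : R => x + s *: p)) (C1_frechet oU hg Uy) (is_derive_line _ _ _).
exists (fun t => dot (grad f (x + t *: p)) p).
  have := nbhs_line p (open_nbhs_nbhs (conj oU Ux)); apply: filterS => t Ut.
  exact: lin.
split; first by rewrite scale0r addr0.
have h j : is_derive (0 : R) (1 : R) (fun s : R => grad f (x + s *: p) 0 j * p 0 j)
    (dot (grad (partial j f) x) p * p 0 j).
  have -> : (fun s : R => grad f (x + s *: p) 0 j * p 0 j) = (fun s : R => partial j f (x + s *: p) * p 0 j).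
    by apply/funext => s; rewrite mxE.
  have U0 : U (x + (0 : R) *: p) by rewrite scale0r addr0.
  have := is_derive_mul (lin _ _ (hif j) U0) (is_derive_cst (p 0 j) (0 : R) (1 : R)).
  by rewrite mulr0 addr0 scale0r addr0.
have := is_derive_sumf (index_enum 'I_n) h; rewrite /dot => h'; apply: is_derive_eq.
rewrite /quad exchange_big; apply: eq_bigr => j _ /=.
by rewrite mulr_suml; apply: eq_bigr => i _; rewrite !mxE; ring.
Qed.

End C2Functions.

(** * The Laplace-Beltrami operator in charts *)

Section PositiveDefinite.
Variable R : rcfType.

Definition posdef n (G : 'M[R]_n) : Prop :=
  forall v : 'rV[R]_n, v != 0 -> 0 < (v *m G *m v^T) 0 0.

(** Block elimination: the positive entry [al] clears its row and column through [m], the Schur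
    complement [S] is again symmetric and positive definite, and the induction hypothesis applies to
    it. *)
Lemma posdef_normal_form n (G : 'M[R]_n) : G^T = G -> posdef G ->
  exists P : 'M[R]_n, P *m G *m P^T = 1%:M.
Proof.
elim: n G => [|n IH] G GT pG.
  by exists 1%:M; apply/matrixP => -[].
move: G GT pG; rewrite -[n.+1]/(1 + n)%N => G GT pG.
pose al := G 0 0; pose b : 'rV_n := ursubmx G.
have al0 : 0 < al.
  have := pG (delta_mx 0 0); rewrite -rowE trmx_delta -colE !mxE; apply.
  by apply/eqP => /matrixP/(_ 0 0)/eqP; rewrite !mxE !eqxx oner_eq0.
have GE : G = block_mx al%:M b b^T (drsubmx G).
  rewrite -[LHS]submxK; congr block_mx.
    by rewrite [LHS]mx11_scalar; congr _%:M; rewrite !mxE; congr (G _ _); apply/val_inj.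
  by rewrite /b trmx_ursub GT.
pose m := - (al^-1 *: b^T); pose S := m *m b + drsubmx G.
have m0 : m *m al%:M + b^T = 0.
  by rewrite mul_mx_scalar /m scalerN scalerA mulfV ?gt_eqF// scale1r addNr.
have ST : S^T = S.
  rewrite /S !linearD /= trmx_drsub GT; congr (_ + _).
  by rewrite /m mulNmx linearN /= -scalemxAl linearZ /= trmx_mul trmxK.
have pS : posdef S.
  move=> v v0; pose w := row_mx (v *m m) v.
  have w0 : w != 0.
    by apply: contraNneq v0 => /(congr1 rsubmx); rewrite row_mxKr linear0 => ->.
  have := pG w w0.
  rewrite GE mul_row_block -!mulmxA -mulmxDr m0 mulmx0 -mulmxDr -/S.
  by rewrite tr_row_mx mul_row_col mul0mx add0r mulmxA.
have [P' hP] := IH S ST pS.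
exists (block_mx (Num.sqrt al)^-1%:M 0 (P' *m m) P').
rewrite {1}GE mulmx_block tr_block_mx mulmx_block -!mulmxA -!mulmxDr m0 -/S.
rewrite !mul0mx !addr0 trmx0 !mulmx0 !mul0mx !addr0 !add0r tr_scalar_mx.
have m0' : al%:M *m m^T + b = 0.
  by move/(congr1 trmx): m0; rewrite linearD /= trmx_mul trmxK tr_scalar_mx trmx0.
rewrite hP trmx_mul mulmxA -mulmxDl -(mulmxA _ al%:M m^T) -mulmxDr m0' mulmx0 mul0mx.
rewrite -!scalar_mxM [RHS](scalar_mx_block 1 n 1); congr (block_mx _%:M _ _ _).
by rewrite mulrAC -invfM -expr2 sqr_sqrtr ?(ltW al0)// mulVf// gt_eqF.
Qed.

Lemma posdef_det_gt0 n (G : 'M[R]_n) : G^T = G -> posdef G -> 0 < \det G.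
Proof.
move=> GT /(posdef_normal_form GT)[P /(congr1 (fun A => \det A))].
rewrite !det_mulmx det_tr det1 mulrAC -expr2 => h.
have P0 : 0 < (\det P) ^+ 2.
  rewrite exprn_even_gt0//=; apply/eqP => P0.
  by move/eqP : h; rewrite P0 expr0n mul0r eq_sym oner_eq0.
by rewrite -(pmulr_rgt0 _ P0) h.
Qed.

End PositiveDefinite.

(** * Divergences under a change of coordinates *)

Section Divergence.
Variables (R : realType) (n : nat).
Notation V := 'rV[R]_n.
Implicit Types (x y : V) (O U : set V).
Variables (T : 'I_n -> V -> R) (O : set V).
Hypothesis oO : open O.
Hypothesis T1 : forall k, C1 O (T k).
Hypothesis T2 : forall k i, C1 O (partial i (T k)).

Definition jacobian x : 'M[R]_n := \matrix_(i, k) partial i (T k) x.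
Definition Tvec x : V := \row_k T k x.

Lemma jacobian_C1 i k : C1 O (fun x => jacobian x i k).
Proof. by under eq_fun do rewrite mxE; exact: T2. Qed.

Lemma adj_jacobian_C1 l i : C1 O (fun x => (\adj (jacobian x)) l i).
Proof. exact: (C1_adj l i oO jacobian_C1). Qed.

Lemma det_jacobian_C1 : C1 O (fun x => \det (jacobian x)).
Proof. exact: (C1_det oO jacobian_C1). Qed.

Lemma is_derive_along f x i (t : R) : C1 O f -> O (x + t *: delta_mx 0 i) ->
  is_derive t (1 : R) (fun s : R => f (x + s *: delta_mx 0 i)) (partial i f (x + t *: delta_mx 0 i)).
Proof.
move=> hf Ox; have := @chain_rule _ _ f (fun s : R => x + s *: delta_mx 0 i) _ _ _ (C1_frechet oO hf Ox) (is_derive_line _ _ _).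
by rewrite dot_delta mxE.
Qed.

Lemma is_derive_comp_vec (X : V -> R) d x i : O x -> frechet X (Tvec x) d ->
  is_derive x (delta_mx 0 i) (fun y => X (Tvec y)) (\sum_k jacobian x i k * d 0 k).
Proof.
move=> Ox fX; apply: line_is_deriveP.
have fX' : frechet X ((fun s : R => Tvec (x + s *: delta_mx 0 i)) 0) d by rewrite scale0r addr0.
have h : is_derive (0 : R) (1 : R) (fun s : R => Tvec (x + s *: delta_mx 0 i)) (\row_k jacobian x i k).
  apply: is_derive_row => k; have Ox0 : O (x + (0 : R) *: delta_mx 0 i) by rewrite scale0r addr0.
  have := is_derive_along (T1 k) Ox0; rewrite !mxE scale0r addr0.
  by have -> : (fun r : R => Tvec (x + r *: delta_mx 0 i) 0 k) = (fun r : R => T k (x + r *: delta_mx 0 i)) by apply/funext => r; rewrite mxE.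
have := chain_rule fX' h; rewrite /comp => h'; apply: is_derive_eq.
by apply: eq_bigr => k _; rewrite !mxE mulrC.
Qed.

(* Differentiate [adj J * J = det J] and multiply by [adj J] on the right: by
   Jacobi's formula the terms in [d (det J)] cancel those in [dJ], because
   second derivatives commute. *)
Lemma piola x l : O x -> \det (jacobian x) != 0 ->
  \sum_i partial i (fun y => (\adj (jacobian y)) l i) x = 0.
Proof.
move=> Ox d0.
have sch a i k : partial a (partial i (T k)) x = partial i (partial a (T k)) x.
  exact: (@partialC R n O (T k) x a i oO (T1 k) (T2 k) Ox).
pose J := jacobian x; pose dJ a := \matrix_(i, k) partial a (partial i (T k)) x.
pose dA a := \matrix_(m, i) partial a (fun y => (\adj (jacobian y)) m i) x.
pose dd a := \sum_i \sum_j dJ a i j * cofactor J i j.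
have hJ a i k : is_derive x (delta_mx 0 a) (fun y => jacobian y i k) (dJ a i k).
  have := C1_is_derive a (jacobian_C1 i k) Ox; rewrite mxE.
  by have -> : (fun y => jacobian y i k) = partial i (T k) by apply/funext => y; rewrite mxE.
have hA a m i : is_derive x (delta_mx 0 a) (fun y => (\adj (jacobian y)) m i) (dA a m i).
  by rewrite mxE; exact: (C1_is_derive a (adj_jacobian_C1 m i) Ox).
have hd a := @is_derive_det R _ n jacobian (dJ a) x (delta_mx 0 a) (hJ a).
have sym a i k : dJ a i k = dJ i a k.
  have dJE b i' : dJ b i' k = partial b (partial i' (T k)) x by rewrite mxE.
  exact: etrans (dJE a i) (etrans (sch a i k) (esym (dJE i a))).
have E a : dA a *m J + (\adj J) *m dJ a = (dd a)%:M.
  apply/matrixP => m k; rewrite !mxE.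
  have h1 : is_derive x (delta_mx 0 a) (fun y => \sum_i (\adj (jacobian y)) m i * jacobian y i k)
     (\sum_i (dA a m i * J i k + (\adj J) m i * dJ a i k)).
    by apply: is_derive_sumf => i; exact: is_derive_mul.
  have h2 : is_derive x (delta_mx 0 a) (fun y => \sum_i (\adj (jacobian y)) m i * jacobian y i k) (dd a *+ (m == k)).
    have -> : (fun y => \sum_i (\adj (jacobian y)) m i * jacobian y i k) = (fun y => \det (jacobian y) *+ (m == k)).
      by apply/funext => y; have := mul_adj_mx (jacobian y) => /matrixP/(_ m k); rewrite !mxE.
    case: eqP => _ /=; first by rewrite /= mulr1n; exact: hd.
    by rewrite mulr0n; exact: is_derive_cst.
  by have [_ <-] := h2; have [_ ->] := h1; rewrite big_split.
have E2 a : \det J *: dA a = dd a *: \adj J - \adj J *m dJ a *m \adj J.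
  rewrite -mul_scalar_mx -scalar_mxC -mul_mx_adj mulmxA.
  have -> : dA a *m J = (dd a)%:M - \adj J *m dJ a by rewrite -E addrK.
  by rewrite mulmxBl mul_scalar_mx.
apply: (mulfI d0); rewrite mulr0 mulr_sumr.
transitivity (\sum_i (\det J *: dA i) l i).
  by apply: eq_bigr => i _; rewrite !mxE.
transitivity (\sum_i (dd i * (\adj J) l i - (\adj J *m dJ i *m \adj J) l i)).
  by apply: eq_bigr => i _; rewrite E2 mxE; congr (_ + _); rewrite mxE.
rewrite sumrB; apply/eqP; rewrite subr_eq0; apply/eqP.
have -> : \sum_i (\adj J *m dJ i *m \adj J) l i =
    \sum_i \sum_a \sum_m (\adj J) l a * dJ i a m * (\adj J) m i.
  apply: eq_bigr => i _; rewrite mxE exchange_big; apply: eq_bigr => m _.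
  by rewrite mxE mulr_suml.
rewrite exchange_big /=; apply: eq_bigr => a _.
rewrite mulr_suml; apply: eq_bigr => i _; rewrite mulr_suml; apply: eq_bigr => m _.
have -> : (\adj J) m i = cofactor J i m by rewrite mxE.
rewrite [LHS]mulrC [LHS]mulrA; congr (_ * _); congr (_ * _); exact: sym.
Qed.

(** The rows of the adjugate are divergence-free by [piola], so the product rule leaves only
    derivatives of [X], and the chain rule contracts the adjugate with the Jacobian matrix to the
    determinant. *)
Lemma divergence_pullback (X : 'I_n -> V -> R) x : O x -> \det (jacobian x) != 0 ->
  (forall l, frechet (X l) (Tvec x) (grad (X l) (Tvec x))) ->
  \sum_i partial i (fun y => \sum_l (\adj (jacobian y)) l i * X l (Tvec y)) x =
  \det (jacobian x) * \sum_l partial l (X l) (Tvec x).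
Proof.
move=> Ox d0 fX; pose J := jacobian x.
have hA m i a : is_derive x (delta_mx 0 a) (fun y => (\adj (jacobian y)) m i) (partial a (fun y => (\adj (jacobian y)) m i) x).
  exact: (C1_is_derive a (adj_jacobian_C1 m i) Ox).
have h i : partial i (fun y => \sum_l (\adj (jacobian y)) l i * X l (Tvec y)) x =
   \sum_l (partial i (fun y => (\adj (jacobian y)) l i) x * X l (Tvec x)
      + (\adj J) l i * \sum_k J i k * partial k (X l) (Tvec x)).
  have : is_derive x (delta_mx 0 i) (fun y => \sum_l (\adj (jacobian y)) l i * X l (Tvec y))
     (\sum_l (partial i (fun y => (\adj (jacobian y)) l i) x * X l (Tvec x)
      + (\adj J) l i * \sum_k J i k * (grad (X l) (Tvec x)) 0 k)).
    by apply: is_derive_sumf => l; apply: is_derive_mul => //; exact: is_derive_comp_vec.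
  rewrite /partial; case=> _ ->; apply: eq_bigr => l _; congr (_ + _ * _).
  by apply: eq_bigr => k _; congr (_ * _); rewrite mxE.
under eq_bigr do rewrite h.
rewrite exchange_big /= mulr_sumr; apply: eq_bigr => l _.
rewrite big_split /= -mulr_suml piola// mul0r add0r.
under eq_bigr do rewrite mulr_sumr.
rewrite exchange_big /=.
transitivity (\sum_k (\adj J *m J) l k * partial k (X l) (Tvec x)).
  by apply: eq_bigr => k _; rewrite mxE mulr_suml; apply: eq_bigr => i _; rewrite mulrA.
rewrite mul_adj_mx (bigD1 l)//= mxE eqxx mulr1n big1 ?addr0// => k kl.
by rewrite mxE eq_sym (negbTE kl) mulr0n mul0r.
Qed.

End Divergence.

Lemma sgr_near (R : realDomainType) (a b : R) : `|a - b| < `|a| -> Num.sg b = Num.sg a.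
Proof.
have [->|a0] := eqVneq a 0; first by rewrite normr0 normr_lt0.
have [a1|a1] : (0 < a) \/ (a < 0) by move: a0; rewrite neq_lt => /orP[]; [right | left].
  by rewrite (gtr0_norm a1) ltr_norml => /andP[_ h]; rewrite !gtr0_sg//; lra.
by rewrite (ltr0_norm a1) ltr_norml => /andP[h _]; rewrite !ltr0_sg//; lra.
Qed.

(** * Independence of the chart *)

Section ManifoldLaplacian.
Variables (R : realType) (n : nat) (M : topologicalType) (A : smooth_manifold R n M).
Variable g : riemannian_metric A.
Notation V := 'rV[R]_n.
Implicit Types (c d : chart R n M) (p q : M) (x y : V) (u : M -> R) (W : set M).

Lemma chart_image_openI c W : open W -> open (c @` (cdom c `&` W)).
Proof.
move=> oW; rewrite openE => _ [p [cp Wp] <-].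
have ip : (c @` cdom c) (c p) by exists p.
have h1 : \forall y \near c p, (c @` cdom c) y.
  by apply: open_nbhs_nbhs; split => //; exact: chart_open_image.
have h2 : \forall y \near c p, W (cinv c y).
  have := chart_inv_continuous ip; apply; rewrite chart_cancel//.
  exact: open_nbhs_nbhs.
have h : nbhs (c p) [set y | (c @` cdom c) y /\ W (cinv c y)] by exact: filterI h1 h2.
rewrite /interior; move: h; apply: filterS => y [[q cq <-]].
by rewrite chart_cancel// => Wq; exists q.
Qed.

Lemma cimage_open c : open (cimage c).
Proof. exact: chart_open_image. Qed.

Lemma cimageP c p : cdom c p -> cimage c (c p).
Proof. by move=> cp; exists p. Qed.

Lemma metric_unit c x : atlas A c -> cimage c x -> metric g c x \in unitmx.
Proof.
move=> Ac cx; rewrite unitmxE unitfE gt_eqF// posdef_det_gt0//.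
- exact: (Defs.metric_sym g Ac cx).
- exact: (metric_posdef g Ac cx).
Qed.

Lemma metric_C1 c i j : atlas A c -> C1 (cimage c) (fun x => metric g c x i j).
Proof. by move=> Ac; apply: smooth_on_C1; exact: metric_smooth. Qed.

Definition vol c x : R := Num.sqrt (\det (metric g c x)).

Lemma metric_det_gt0 c x : atlas A c -> cimage c x -> 0 < \det (metric g c x).
Proof. by move=> Ac cx; apply: posdef_det_gt0; [exact: (Defs.metric_sym g Ac cx) | exact: (metric_posdef g Ac cx)]. Qed.

Lemma vol_gt0 c x : atlas A c -> cimage c x -> 0 < vol c x.
Proof. by move=> Ac cx; rewrite sqrtr_gt0 metric_det_gt0. Qed.

Lemma vol_C1 c : atlas A c -> C1 (cimage c) (vol c).
Proof.
move=> Ac; apply: C1_sqrt; [exact: cimage_open | | by move=> x cx; exact: metric_det_gt0].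
by apply: C1_det; [exact: cimage_open | move=> i j; exact: metric_C1].
Qed.

Lemma ginv_C1 c i j : atlas A c -> C1 (cimage c) (fun x => invmx (metric g c x) i j).
Proof.
move=> Ac; have oc := @cimage_open c.
apply: (@C1_eq _ _ _ (fun x => (\det (metric g c x))^-1 * (\adj (metric g c x)) i j)) => //.
  apply: C1M => //; last by apply: (@C1_adj _ _ _ (metric g c)) => // *; exact: metric_C1.
  apply: C1V => //; first by apply: (@C1_det _ _ _ (metric g c)) => // *; exact: metric_C1.
  by move=> x cx; rewrite gt_eqF// metric_det_gt0.
by move=> x cx; rewrite /invmx; have := metric_unit Ac cx; move=> ->; rewrite [RHS]mxE.
Qed.

(** The gradient of [u] as a vector density: its plain divergence divided by [vol] is the
    Laplace-Beltrami operator, and between charts it changes by the adjugate alone, up to a sign. *)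
Definition flux c u (i : 'I_n) x : R :=
  vol c x * \sum_j invmx (metric g c x) i j * partial j (u \o cinv c) x.

Lemma laplace_flux c u x :
  laplace_in_chart g c u x = (vol c x)^-1 * \sum_i partial i (flux c u i) x.
Proof. by []. Qed.

Lemma flux_C1 c u i : atlas A c -> smooth A u -> C1 (cimage c) (flux c u i).
Proof.
move=> Ac su; have oc := @cimage_open c.
apply: C1M => //; first exact: vol_C1.
apply: C1_sum => // j _; apply: C1M => //; first exact: ginv_C1.
by apply/smooth_on_C1/smooth_on_partial; exact: su.
Qed.

Section TwoCharts.
Variables c d : chart R n M.
Hypotheses (Ac : atlas A c) (Ad : atlas A d).
Let O := c @` (cdom c `&` cdom d).
Let J := jacobian (transition c d).
Let T := Tvec (transition c d).

Let oO : open O. Proof. exact: (@chart_image_openI c _ (chart_open_dom d)). Qed.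
Let T1 k : C1 O (transition c d k). Proof. by apply: smooth_on_C1; exact: (atlas_smooth Ac Ad). Qed.
Let T2 k i : C1 O (partial i (transition c d k)).
Proof. by apply/smooth_on_C1/smooth_on_partial; exact: (atlas_smooth Ac Ad). Qed.

Lemma transition_vecE p : cdom c p -> T (c p) = d p.
Proof. by move=> cp; apply/rowP => k; rewrite mxE /transition chart_cancel. Qed.

Lemma metric_jacobian x : O x -> metric g c x = J x *m metric g d (T x) *m (J x)^T.
Proof.
by case=> p [cp dp] <-; rewrite transition_vecE//; exact: (metric_compatible g Ac Ad cp dp).
Qed.

Lemma transition_image x : O x -> cimage d (T x).
Proof. by case=> p [cp dp] <-; rewrite transition_vecE//; exact: cimageP. Qed.

Lemma overlap_image x : O x -> cimage c x.
Proof. by case=> p [cp _] <-; exact: cimageP. Qed.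

Lemma jacobian_det_neq0 x : O x -> \det (J x) != 0.
Proof.
move=> Ox; have := metric_det_gt0 Ac (overlap_image Ox).
rewrite metric_jacobian// !det_mulmx; apply: contraTN => /eqP ->.
by rewrite !mul0r ltxx.
Qed.

Lemma vol_transition x : O x -> vol c x = `|\det (J x)| * vol d (T x).
Proof.
move=> Ox; rewrite /vol metric_jacobian// !det_mulmx det_tr mulrAC -expr2.
by rewrite sqrtrM ?sqr_ge0// sqrtr_sqr.
Qed.

Lemma partial_transition u x j : smooth A u -> O x ->
  partial j (u \o cinv c) x = \sum_k J x j k * partial k (u \o cinv d) (T x).
Proof.
move=> su Ox.
have fr : frechet (u \o cinv d) (T x) (grad (u \o cinv d) (T x)).
  apply: C1_frechet (@cimage_open d) _ (transition_image Ox).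
  by apply: smooth_on_C1; exact: su.
have := is_derive_comp_vec oO T1 j Ox fr; rewrite -/T -/J => h.
transitivity (\sum_k J x j k * grad (u \o cinv d) (T x) 0 k); last first.
  by apply: eq_bigr => k _; congr (_ * _); rewrite mxE.
have [_ <-] := h; apply: near_eq_derive.
have := open_nbhs_nbhs (conj oO Ox); apply: filterS => _ [p [cp dp] <-] /=.
by rewrite transition_vecE// !chart_cancel.
Qed.

(** The density contributes [|det J|], and the inverse metric applied to the gradient contributes
    the inverse transpose of [J]; their product is the transposed adjugate up to the sign of the
    determinant. *)
Lemma flux_transition u x i : smooth A u -> O x ->
  flux c u i x = Num.sg (\det (J x)) * \sum_l (\adj (J x)) l i * flux d u l (T x).
Proof.
move=> su Ox; have dJ := jacobian_det_neq0 Ox.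
have uJ : J x \in unitmx by rewrite unitmxE unitfE.
have uG := metric_unit Ad (transition_image Ox).
pose G := metric g d (T x); pose D : 'cV[R]_n := \col_k partial k (u \o cinv d) (T x).
have Ec : flux c u i x = vol c x * (invmx (metric g c x) *m (J x *m D)) i 0.
  congr (_ * _); rewrite mxE; apply: eq_bigr => j _; congr (_ * _).
  by rewrite partial_transition// mxE; apply: eq_bigr => k _; congr (_ * _); rewrite mxE.
have Ed l : flux d u l (T x) = vol d (T x) * (invmx G *m D) l 0.
  by congr (_ * _); rewrite mxE; apply: eq_bigr => j _; congr (_ * _); rewrite mxE.
have Einv : invmx (metric g c x) *m J x = (\det (J x))^-1 *: ((\adj (J x))^T *m invmx G).
  have E1 : metric g c x *m ((\det (J x))^-1 *: ((\adj (J x))^T *m invmx G)) = J x.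
    rewrite metric_jacobian// -scalemxAr -!mulmxA (mulmxA (J x)^T) -trmx_mul mul_adj_mx tr_scalar_mx.
    by rewrite mul_scalar_mx -!scalemxAr scalerA mulVf// scale1r mulmxV// mulmx1.
  by rewrite -[X in invmx _ *m X]E1 mulKmx// metric_unit//; exact: overlap_image.
rewrite Ec mulmxA Einv vol_transition// -scalemxAl mxE.
have -> : ((\adj (J x))^T *m invmx G *m D) i 0 = \sum_l (\adj (J x)) l i * (invmx G *m D) l 0.
  by rewrite -mulmxA mxE; apply: eq_bigr => l _; congr (_ * _); rewrite mxE.
transitivity ((`|\det (J x)| * (\det (J x))^-1) * (\sum_l \adj (J x) l i * flux d u l (T x))).
  rewrite -!mulrA; congr (_ * _); rewrite [LHS]mulrCA; congr (_ * _).
  by rewrite mulr_sumr; apply: eq_bigr => l _; rewrite Ed mulrCA.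
by congr (_ * _); rewrite normrEsg mulfK.
Qed.

(** The determinant of the Jacobian matrix is continuous and nonzero on the overlap, so its sign is
    constant near the point and passes through the derivatives; what remains is the transformation
    of a divergence. *)
Lemma laplace_in_chart_invariant u p : smooth A u -> cdom c p -> cdom d p ->
  laplace_in_chart g c u (c p) = laplace_in_chart g d u (d p).
Proof.
move=> su cp dp; have Ox : O (c p) by exists p.
have dJ := jacobian_det_neq0 Ox.
pose s := Num.sg (\det (J (c p))).
have sgn : \forall y \near c p, Num.sg (\det (J y)) = s.
  have cd : {for c p, continuous (fun y => \det (J y))}.
    exact: (C1_continuous oO (det_jacobian_C1 oO T2) Ox).
  have := (proj1 (@cvgrPdist_lt _ _ _ (nbhs (c p)) (nbhs_filter _) _ _)) cd `|\det (J (c p))|.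
  rewrite normr_gt0 => /(_ dJ); apply: filterS => y; exact: sgr_near.
have fr l : frechet (flux d u l) (T (c p)) (grad (flux d u l) (T (c p))).
  rewrite transition_vecE//; apply: C1_frechet (@cimage_open d) _ (cimageP dp).
  exact: flux_C1.
have E i : partial i (flux c u i) (c p) = s * partial i (fun y => \sum_l (\adj (J y)) l i * flux d u l (T y)) (c p).
  have h : derivable (fun y => \sum_l (\adj (J y)) l i * flux d u l (T y)) (c p) (delta_mx 0 i).
    have cA l : C1 O (fun y => (\adj (J y)) l i).
      exact: (adj_jacobian_C1 oO T2).
    have hl l := is_derive_mul (C1_is_derive i (cA l) Ox) (is_derive_comp_vec oO T1 i Ox (fr l)).
    by case: (is_derive_sumf (index_enum 'I_n) hl).
  transitivity (partial i (fun y => s * \sum_l (\adj (J y)) l i * flux d u l (T y)) (c p)).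
    apply: near_eq_derive.
    have hn : nbhs (c p) [set y | Num.sg (\det (J y)) = s /\ O y].
      exact: filterI sgn (open_nbhs_nbhs (conj oO Ox)).
    move: hn; apply: filterS => y [sy Oy].
    by apply: etrans (flux_transition i su Oy) _; rewrite sy.
  exact: (deriveZ s h).
have S : \sum_i partial i (flux c u i) (c p) =
    s * (\det (J (c p)) * \sum_l partial l (flux d u l) (T (c p))).
  transitivity (\sum_i s * partial i (fun y => \sum_l (\adj (J y)) l i * flux d u l (T y)) (c p)).
    by apply: eq_bigr => i _; exact: E.
  by rewrite -mulr_sumr; congr (_ * _); exact: (divergence_pullback oO T1 T2 Ox dJ fr).
have fin (D v a : R) : D != 0 -> (`|D| * v)^-1 * (Num.sg D * (D * a)) = v^-1 * a.
  by move=> D0; rewrite (mulrA (Num.sg D)) -normrEsg invfM -mulrA mulrCA mulKf ?normr_eq0.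
transitivity ((vol c (c p))^-1 * (s * (\det (J (c p)) * \sum_l partial l (flux d u l) (T (c p))))).
  exact: (congr1 _ S).
have -> : vol c (c p) = `|\det (J (c p))| * vol d (T (c p)) by exact: vol_transition.
apply: etrans (fin _ _ _ dJ) _.
by have -> : T (c p) = d p by exact: transition_vecE.
Qed.

End TwoCharts.

End ManifoldLaplacian.

Lemma continuous_at_sum (R : realType) (T : topologicalType) (I : Type) (r : seq I) (f : I -> T -> R) (x : T) :
  (forall i, {for x, continuous (f i)}) -> {for x, continuous (fun y => \sum_(i <- r) f i y)}.
Proof.
move=> hf; elim: r => [|i r IH].
  have -> : (fun y => \sum_(i <- [::]) f i y) = cst 0 by apply/funext => y; rewrite big_nil.
  exact: cst_continuous.
have -> : (fun y => \sum_(j <- i :: r) f j y) = (fun y => f i y + \sum_(j <- r) f j y).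
  by apply/funext => y; rewrite big_cons.
exact: (cvgD (hf i) IH).
Qed.

(** * Coordinates in which the metric is nearly Euclidean *)

Section LinearChange.
Variables (R : realType) (n : nat).
Notation V := 'rV[R]_n.
Implicit Types (f : V -> R) (x y z v p d : V) (U : set V) (P Q a H : 'M[R]_n).

Lemma dotE x y : dot x y = (x *m y^T) 0 0.
Proof. by rewrite mxE; apply: eq_bigr => i _; rewrite mxE. Qed.

Lemma mxdotE a H : mxdot a H = \tr (a *m H^T).
Proof. by apply: eq_bigr => i _; rewrite mxE; apply: eq_bigr => j _; rewrite mxE. Qed.

Lemma quadE H p : quad H p = (p *m H *m p^T) 0 0.
Proof.
rewrite mxE /quad exchange_big; apply: eq_bigr => j _; rewrite !mxE mulr_suml.
by apply: eq_bigr => i _.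
Qed.

Lemma Lop_linear_change a (b : V) d H P Q : Q *m P = 1%:M ->
  Lop (Q^T *m a *m Q) (b *m Q) (d *m P^T) (P *m H *m P^T) = Lop a b d H.
Proof.
move=> QP; rewrite /Lop !mxdotE !dotE !trmx_mul !trmxK; congr (_ + _ 0 0).
  rewrite -(mulmxA _ Q) (mulmxA Q P) QP mul1mx -!mulmxA mxtrace_mulC -!mulmxA.
  by rewrite -trmx_mul QP trmx1 mulmx1.
by rewrite -mulmxA (mulmxA Q) QP mul1mx.
Qed.

Lemma jet_linear_change f x0 z P d H : jet f (x0 + z *m P) d H ->
  jet (fun z => f (x0 + z *m P)) z (d *m P^T) (P *m H *m P^T).
Proof.
move=> jf p.
have -> : dot (d *m P^T) p = dot d (p *m P) by rewrite !dotE trmx_mul mulmxA.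
have -> : quad (P *m H *m P^T) p = quad H (p *m P) by rewrite !quadE trmx_mul !mulmxA.
apply: D2_ext (jf (p *m P)) => t.
by rewrite mulmxDl -scalemxAl addrA.
Qed.

Lemma frechet_is_derive f x d v : frechet f x d -> is_derive x v f (dot d v).
Proof.
move=> fr; apply: line_is_deriveP.
have fr' : frechet f ((fun s : R => x + s *: v) 0) d by rewrite scale0r addr0.
exact: chain_rule fr' (is_derive_line _ _ _).
Qed.

(** When conditions are stated for all sufficiently small radii, finitely many of them are met by
    one radius through intersections in the filter. *)
Lemma near_box (S : V -> Prop) x : (\forall y \near x, S y) ->
  \forall r \near (0 : R)^'+, forall y, `|y - x| <= r -> S y.
Proof.
move=> /nbhs_ballP[e /= e0 he]; near=> r => y yx; apply: he.
rewrite -ball_normE /= distrC; apply: le_lt_trans yx _; near: r.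
exact: nbhs_right_lt.
Unshelve. all: by end_near. Qed.

Lemma C1_lipschitz U f x : open U -> C1 U f -> U x -> exists2 K : R, 0 <= K &
  \forall r \near (0 : R)^'+, forall y y', `|y - x| <= r -> `|y' - x| <= r ->
    `|f y - f y'| <= K * `|y - y'|.
Proof.
move=> oU hf Ux; pose B := \sum_i (`|partial i f x| + 1).
have B0 : 0 <= B by apply: sumr_ge0 => i _; rewrite addr_ge0.
exists (n%:R * B); first by rewrite mulr_ge0.
have near1 : \forall y \near x, U y /\ `|grad f y| <= B.
  have nU : \forall y \near x, U y by exact: open_nbhs_nbhs.
  have ng : nbhs x (fun y => forall i : 'I_n, `|partial i f x - partial i f y| < 1).
    apply: (@filter_forall _ _ (fun (i : 'I_n) y => `|partial i f x - partial i f y| < 1) (nbhs x)) => i.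
     have cf := C1_partial_continuous (i := i) hf Ux.
    exact: (proj1 (@cvgrPdist_lt _ _ _ (nbhs x) (nbhs_filter x) _ _) cf 1 ltr01).
  have h : nbhs x [set y | U y /\ forall i, `|partial i f x - partial i f y| < 1] by exact: filterI nU ng.
  move: h; apply: filterS => y [Uy gy]; split => //.
  apply: mx_norm_leP => // i; rewrite mxE.
  apply: le_trans (_ : `|partial i f x| + 1 <= _).
    rewrite -(subKr (partial i f x) (partial i f y)); apply: le_trans (ler_normB _ _) _.
    by rewrite lerD2l ltW.
  by rewrite /B (bigD1 i)//= lerDl sumr_ge0// => j _; rewrite addr_ge0.
have := near_box near1; apply: filterS => r hr y y' yr y'r.
have seg (s : R) : 0 <= s <= 1 -> U (y' + s *: (y - y')) /\ `|grad f (y' + s *: (y - y'))| <= B.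
  move=> /andP[s0 s1]; apply: hr.
  have -> : y' + s *: (y - y') - x = (1 - s) *: (y' - x) + s *: (y - x).
    by apply/rowP => i; rewrite !mxE; ring.
  apply: le_trans (ler_normD _ _) _; rewrite !normrZ !ger0_norm ?subr_ge0//.
  have -> : r = (1 - s) * r + s * r by ring.
  by rewrite lerD// ler_wpM2l// subr_ge0.
have fd s (s01 : 0 <= s <= 1) := frechet_is_derive (y - y') (C1_frechet oU hf (proj1 (seg s s01))).
have [s s01|s /andP[s0 s1]] := @segment_mvt _ _ f y' (y - y').
  by case: (fd s s01).
have s01 : 0 <= s <= 1 by rewrite !ltW.
rewrite subrKC => ->; have [_ ->] := fd s s01.
apply: le_trans (dot_norm_le _ _) _; rewrite ler_wpM2r// ler_wpM2l//.
by case: (seg s s01).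
Qed.

Lemma mulmx_norm_le (z : V) P : `|z *m P| <= n%:R * `|z| * `|P|.
Proof.
apply: mx_norm_leP => [|i]; first by rewrite !mulr_ge0.
rewrite mxE; apply: le_trans (ler_norm_sum _ _ _) _.
rewrite -mulrA -sum_ord_const; apply: ler_sum => j _.
rewrite normrM ler_pM ?coord_norm_le// [`|P|]mx_normrE.
exact: (le_bigmax _ (fun ij => `|P ij.1 ij.2|) (j, i)).
Qed.

Lemma mx_entry_norm_le P i j : `|P i j| <= `|P|.
Proof. rewrite [`|P|]mx_normrE; exact: (le_bigmax _ (fun ij => `|P ij.1 ij.2|) (i, j)). Qed.

Lemma congruence_entry_le (a Q : 'M[R]_n) (t : R) i j : 0 <= t -> (forall k l, `|a k l| <= t) ->
  `|(Q^T *m a *m Q) i j| <= n%:R ^+ 2 * `|Q| ^+ 2 * t.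
Proof.
move=> t0 ha; rewrite mxE; apply: le_trans (ler_norm_sum _ _ _) _.
have -> : n%:R ^+ 2 * `|Q| ^+ 2 * t = n%:R * (n%:R * (`|Q| * t) * `|Q|) by ring.
rewrite -sum_ord_const; apply: ler_sum => l _; rewrite normrM ler_pM ?mx_entry_norm_le//.
rewrite mxE; apply: le_trans (ler_norm_sum _ _ _) _.
rewrite -sum_ord_const; apply: ler_sum => k _.
by rewrite normrM mxE ler_pM ?mx_entry_norm_le.
Qed.

End LinearChange.

Section ChartLaplacian.
Variables (R : realType) (n : nat) (M : topologicalType) (A : smooth_manifold R n M).
Variable g : riemannian_metric A.
Notation V := 'rV[R]_n.
Variable c : chart R n M.
Hypothesis Ac : atlas A c.
Implicit Types (u : M -> R) (x : V).

Definition weighted_ginv (i j : 'I_n) x : R := vol g c x * invmx (metric g c x) i j.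

Lemma weighted_ginv_C1 i j : C1 (cimage c) (weighted_ginv i j).
Proof. by apply: C1M; [exact: cimage_open | exact: vol_C1 | exact: ginv_C1]. Qed.

Definition drift x : V := \row_j ((vol g c x)^-1 * \sum_i partial i (weighted_ginv i j) x).

Definition hess f x : 'M[R]_n := \matrix_(i, j) partial i (partial j f) x.

(** The outer derivative is carried out: falling on [partial j] of the function it gives the inverse
    metric as leading part, and falling on the coefficients it gives [drift]. *)
Lemma laplace_in_chart_Lop u x : smooth A u -> cimage c x ->
  laplace_in_chart g c u x =
  Lop (invmx (metric g c x)) (drift x) (grad (u \o cinv c) x) (hess (u \o cinv c) x).
Proof.
move=> su cx; set f := u \o cinv c.
have sf : smooth_on (cimage c) f by exact: su.
have v0 : vol g c x != 0 by rewrite gt_eqF// vol_gt0.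
have E i : partial i (flux g c u i) x =
   \sum_j (partial i (weighted_ginv i j) x * partial j f x + weighted_ginv i j x * partial i (partial j f) x).
  have hj j := is_derive_mul (C1_is_derive i (weighted_ginv_C1 i j) cx) (C1_is_derive i (smooth_on_C1 (smooth_on_partial j sf)) cx).
  have -> : flux g c u i = (fun y => \sum_j weighted_ginv i j y * partial j f y).
    by apply/funext => y; rewrite /flux mulr_sumr; apply: eq_bigr => j _; rewrite mulrA.
  by have [_ <-] := is_derive_sumf (index_enum 'I_n) hj.
rewrite laplace_flux; under eq_bigr do rewrite E big_split.
rewrite big_split /= mulrDr addrC; congr (_ + _).
  rewrite mulr_sumr; apply: eq_bigr => i _; rewrite mulr_sumr; apply: eq_bigr => j _.
  by rewrite mxE /weighted_ginv mulrA mulrA mulVf// mul1r.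
rewrite exchange_big mulr_sumr; apply: eq_bigr => j _ /=.
by rewrite !mxE -mulr_suml mulrA.
Qed.

Lemma drift_continuous x j : cimage c x -> {for x, continuous (fun y => drift y 0 j)}.
Proof.
move=> cx.
have -> : (fun y => drift y 0 j) = (fun y => (vol g c y)^-1 * \sum_i partial i (weighted_ginv i j) y).
  by apply/funext => y; rewrite mxE.
have h1 : {for x, continuous (fun y => (vol g c y)^-1)}.
  apply: continuousV; first by rewrite gt_eqF// vol_gt0.
  by apply: C1_continuous (vol_C1 g Ac) cx; exact: cimage_open.
have h2 : {for x, continuous (fun y => \sum_i partial i (weighted_ginv i j) y)}.
  have hi i := C1_partial_continuous (i := i) (weighted_ginv_C1 i j) cx.
  exact: continuous_at_sum.
exact: (cvgM h1 h2).
Qed.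

End ChartLaplacian.

Section ChartFrame.
Variables (R : realType) (n : nat) (M : topologicalType) (A : smooth_manifold R n M).
Variable g : riemannian_metric A.
Notation V := 'rV[R]_n.
Implicit Types (u : M -> R) (x z w : V) (P Q : 'M[R]_n).

Lemma sym_invmx m (G : 'M[R]_m) : G^T = G -> (invmx G)^T = invmx G.
Proof. by move=> GT; rewrite trmx_inv GT. Qed.

(** [P] brings the metric at the centre to the identity, so in the coordinates [z] the leading
    coefficients are the identity at 0 and deviate from it by at most [K * R0]. The last clause
    compares the metric with the sup norm; it turns lengths of curves into distances of
    coordinates. *)
Lemma chart_frame_exists c p0 : (3 <= n)%N -> atlas A c -> cdom c p0 ->
  exists P Q, exists R0 K : R, [/\ P *m Q = 1%:M, 0 < R0 <= 1, 0 <= K & 4 * n%:R ^+ 2 * K * R0 <= 1] /\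
  [/\ forall z, `|z| <= R0 -> cimage c (c p0 + z *m P),
      elliptic (eps0 R n) R0 K (fun z => Q^T *m invmx (metric g c (c p0 + z *m P)) *m Q)
        (fun z => drift g c (c p0 + z *m P) *m Q) &
      forall z, `|z| <= R0 -> forall w,
        `|w| ^+ 2 / 4 <= ((w *m P) *m metric g c (c p0 + z *m P) *m (w *m P)^T) 0 0].
Proof.
move=> n3 Ac cp0; pose x0 := c p0; pose G := metric g c x0.
have n0 : (0 < n)%N by exact: leq_trans n3.
have nR : 1 <= n%:R :> R by rewrite ler1n.
have Cx0 : cimage c x0 := cimageP cp0.
have GT : G^T = G := Defs.metric_sym g Ac Cx0.
have [P PG] := posdef_normal_form GT (metric_posdef g Ac Cx0).
pose Q := G *m P^T.
have PQ : P *m Q = 1%:M by rewrite mulmxA.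
have QP : Q *m P = 1%:M by exact: mulmx1C.
have GiE : invmx G = P^T *m P.
  have e : G *m (P^T *m P) = 1%:M by rewrite mulmxA.
  by rewrite -[LHS]mulmx1 -e mulKmx// metric_unit.
clearbody Q; pose p := `|P| + `|P^T|; pose q := `|Q|.
have px (z : V) : `|z *m P| <= n%:R * p * `|z|.
  rewrite mulrAC; apply: le_trans (mulmx_norm_le _ _) _.
  by rewrite ler_wpM2l ?mulr_ge0// lerDl.
have qx (z : V) : `|z *m Q| <= n%:R * q * `|z| by rewrite mulrAC; exact: mulmx_norm_le.
have p0' : 0 <= p by rewrite addr_ge0.
have q0 : 0 <= q by exact: normr_ge0.
pose f (ij : 'I_n * 'I_n) x := invmx (metric g c x) ij.1 ij.2.
have /choice[k kP] : forall ij, exists k : R, 0 <= k /\ \forall r \near (0 : R)^'+,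
    forall y y', `|y - x0| <= r -> `|y' - x0| <= r -> `|f ij y - f ij y'| <= k * `|y - y'|.
  move=> ij; have [k k0 hk] := C1_lipschitz (@cimage_open _ _ _ c) (ginv_C1 g ij.1 ij.2 Ac) Cx0.
  by exists k.
pose K1 := \sum_ij k ij; pose B := \sum_j (`|drift g c x0 0 j| + 1).
have K10 : 0 <= K1 by apply: sumr_ge0 => ij _; case: (kP ij).
have B0 : 0 <= B by apply: sumr_ge0 => ij _; rewrite addr_ge0.
(* Keeps the deviation of the metric from its value at the centre, as a quadratic form in [w], at
   most [|w|^2 / 4]. *)
pose de := (4 * n%:R ^+ 2 * (n%:R ^+ 2 * p ^+ 2 + 1))^-1.
have de0 : 0 < de by rewrite invr_gt0 !mulr_gt0 ?exprn_gt0 ?ltr0n// ltr_wpDl// mulr_ge0 ?sqr_ge0// exprn_ge0.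
have [r1 r10 [h1 h2 h3 h4]] : exists2 r1 : R, 0 < r1 & [/\ (forall y, `|y - x0| <= r1 -> cimage c y),
    (forall ij y y', `|y - x0| <= r1 -> `|y' - x0| <= r1 -> `|f ij y - f ij y'| <= K1 * `|y - y'|),
    (forall y, `|y - x0| <= r1 -> forall j, `|drift g c y 0 j| <= B) &
    (forall y, `|y - x0| <= r1 -> forall ij : 'I_n * 'I_n, `|metric g c y ij.1 ij.2 - G ij.1 ij.2| <= de)].
  have n1 : \forall r \near (0 : R)^'+, forall y, `|y - x0| <= r -> cimage c y.
    by apply: near_box; apply: open_nbhs_nbhs; split => //; exact: cimage_open.
  have n2 : \forall r \near (0 : R)^'+, forall ij y y', `|y - x0| <= r -> `|y' - x0| <= r -> `|f ij y - f ij y'| <= k ij * `|y - y'|.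
    by apply: filter_forall => ij; case: (kP ij).
  have n3' : \forall r \near (0 : R)^'+, forall j y, `|y - x0| <= r -> `|drift g c y 0 j - drift g c x0 0 j| <= 1.
    apply: filter_forall => j; apply: (@near_box _ _ (fun y => `|drift g c y 0 j - drift g c x0 0 j| <= 1)).
    have cd := @drift_continuous _ _ _ _ g c Ac x0 j Cx0.
    have := (proj1 (@cvgrPdist_le _ _ _ (nbhs x0) (nbhs_filter x0) _ _)) cd 1 ltr01.
    by apply: filterS => y; rewrite distrC.
  have n4 : \forall r \near (0 : R)^'+, forall (ij : 'I_n * 'I_n) y, `|y - x0| <= r -> `|metric g c y ij.1 ij.2 - G ij.1 ij.2| <= de.
    apply: filter_forall => ij; apply: (@near_box _ _ (fun y => `|metric g c y ij.1 ij.2 - G ij.1 ij.2| <= de)).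
    have cd := C1_continuous (@cimage_open _ _ _ c) (metric_C1 g ij.1 ij.2 Ac) Cx0.
    have := (proj1 (@cvgrPdist_le _ _ _ (nbhs x0) (nbhs_filter x0) _ _)) cd de de0.
    by apply: filterS => y; rewrite distrC.
  have n5 : \forall r \near (0 : R)^'+, 0 < r by exact: nbhs_right_gt.
  have [r [r0 [r1 [r2 [r3 r4]]]]] := filter_ex (filterI n5 (filterI n1 (filterI n2 (filterI n3' n4)))).
  exists r => //; split=> //.
  - move=> ij y y' yr yr'; apply: le_trans (r2 ij y y' yr yr') _; rewrite ler_wpM2r//.
    by rewrite /K1 (bigD1 ij)//= lerDl sumr_ge0// => l _; case: (kP l).
  - move=> y yr j; apply: le_trans (_ : `|drift g c x0 0 j| + 1 <= _).
      rewrite -(subrK (drift g c x0 0 j) (drift g c y 0 j)) addrC.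
      by apply: le_trans (ler_normD _ _) _; rewrite lerD2l; exact: r3.
    by rewrite /B (bigD1 j)//= lerDl sumr_ge0// => l _; rewrite addr_ge0.
  - by move=> y yr ij; exact: r4.
pose K := n%:R ^+ 2 * q ^+ 2 * (K1 * (n%:R * p)) + n%:R * q * B.
have K0 : 0 <= K by rewrite addr_ge0// !mulr_ge0// ?exprn_ge0.
(* In this order: a radius of at most 1, a box inside the region where the bounds above hold,
   smallness of [4 * n^2 * K * R0], and leading coefficients within [eps0] of the identity. *)
pose R0 := Num.min (Num.min 1 (r1 / (n%:R * p + 1))) (Num.min (4 * n%:R ^+ 2 * K + 1)^-1 (eps0 R n / (K + 1))).
have np1 : 0 < n%:R * p + 1 by rewrite ltr_wpDl// mulr_ge0.
have K4 : 0 < 4 * n%:R ^+ 2 * K + 1 by rewrite ltr_wpDl// !mulr_ge0// exprn_ge0.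
have eps0_gt0 : 0 < eps0 R n by rewrite invr_gt0 mulr_gt0// exprn_gt0// ltr0n.
have R00 : 0 < R0.
  by rewrite !lt_min ltr01 divr_gt0// invr_gt0 K4 divr_gt0// ltr_wpDl.
have R01 : R0 <= 1 by rewrite !ge_min lexx.
have R02 : R0 <= r1 / (n%:R * p + 1) by rewrite !ge_min lexx !orbT.
have R03 : R0 <= (4 * n%:R ^+ 2 * K + 1)^-1 by rewrite !ge_min lexx !orbT.
have R04 : R0 <= eps0 R n / (K + 1) by rewrite !ge_min lexx !orbT.
have inb (z : V) : `|z| <= R0 -> `|(x0 + z *m P) - x0| <= r1.
  move=> zR; rewrite addrAC subrr add0r; apply: le_trans (px z) _.
  apply: le_trans (_ : (n%:R * p + 1) * R0 <= _).
    by rewrite ler_pM// ?mulr_ge0// lerDl.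
  by rewrite mulrC -ler_pdivlMr.
exists P, Q, R0, K; split; split => //.
- by rewrite R00.
- apply: le_trans (ler_wpM2l _ R03) _; first by rewrite !mulr_ge0// exprn_ge0.
  by rewrite ler_pdivrMr// mul1r lerDl.
- by move=> z zR; apply: h1; exact: inb.
- pose a z := Q^T *m invmx (metric g c (x0 + z *m P)) *m Q.
  have aL z z' i j : `|z| <= R0 -> `|z'| <= R0 -> `|a z i j - a z' i j| <= K * `|z - z'|.
    move=> zR zR'.
    have -> : a z i j - a z' i j = (Q^T *m (invmx (metric g c (x0 + z *m P)) - invmx (metric g c (x0 + z' *m P))) *m Q) i j.
      by rewrite mulmxBr mulmxBl [RHS]mxE; congr (_ + _); rewrite [RHS]mxE.
    apply: le_trans (@congruence_entry_le R n _ Q (K1 * (n%:R * p * `|z - z'|)) i j _ _) _.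
    + by rewrite !mulr_ge0.
    + move=> k' l; rewrite 2!mxE; apply: le_trans (h2 (k', l) _ _ (inb _ zR) (inb _ zR')) _.
      rewrite ler_wpM2l//; have -> : x0 + z *m P - (x0 + z' *m P) = (z - z') *m P.
        by rewrite opprD addrACA subrr add0r mulmxBl.
      exact: px.
    rewrite (mulrA K1) mulrA ler_wpM2r// /K lerDl; apply: mulr_ge0 => //; exact: mulr_ge0.
  have a0 : a 0 = 1%:M.
    rewrite /a mul0mx addr0 -/G GiE !mulmxA -trmx_mul -mulmxA PQ trmx1 mul1mx.
    by [].
  split; last by move=> z z' zR zR' i j; exact: aL.
  move=> z zR; split.
  + have mT : (metric g c (x0 + z *m P))^T = metric g c (x0 + z *m P).
      exact: (Defs.metric_sym g Ac (h1 _ (inb _ zR))).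
    by rewrite !trmx_mul trmxK (sym_invmx mT) mulmxA.
  + move=> i j; have := aL z 0 i j zR; rewrite normr0 => /(_ (ltW R00)).
    have -> : a 0 i j = (i == j)%:R by rewrite a0 mxE.
    rewrite subr0 => h; apply: le_trans h _.
    apply: le_trans (_ : (K + 1) * R0 <= _); first by rewrite ler_pM// lerDl.
    by rewrite mulrC -ler_pdivlMr// ltr_wpDl.
  + apply: le_trans (qx _) _; apply: le_trans (_ : n%:R * q * B <= _).
      rewrite ler_wpM2l ?mulr_ge0//; apply: mx_norm_leP => // j.
      by apply: h3; exact: inb.
    by rewrite /K lerDr !mulr_ge0// ?exprn_ge0.
- move=> z zR w.
  have E : (w *m P *m metric g c (x0 + z *m P) *m (w *m P)^T) 0 0 =
    sqn w + quad (P *m (metric g c (x0 + z *m P) - G) *m P^T) w.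
    rewrite quadE mulmxBr mulmxBl PG mulmxBr mulmx1 mulmxBl.
    have e0 (X : 'M[R]_1) : (X - w *m w^T) 0 0 = X 0 0 - sqn w.
      by rewrite mxE; congr (_ + _); rewrite mxE -dotE -sqn_dot.
    by rewrite e0 [RHS]addrC subrK trmx_mul !mulmxA.
  rewrite E.
  have hq : `|quad (P *m (metric g c (x0 + z *m P) - G) *m P^T) w| <= n%:R ^+ 2 * `|w| ^+ 2 * (n%:R ^+ 2 * p ^+ 2 * de).
    apply: le_trans (ler_norm_sum _ _ _) _.
    have -> : n%:R ^+ 2 * `|w| ^+ 2 * (n%:R ^+ 2 * p ^+ 2 * de) = n%:R * (n%:R * (`|w| * (n%:R ^+ 2 * p ^+ 2 * de) * `|w|)) by ring.
    rewrite -sum_ord_const; apply: ler_sum => i _.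
    apply: le_trans (ler_norm_sum _ _ _) _; rewrite -sum_ord_const; apply: ler_sum => j _.
    rewrite !normrM ler_pM ?mulr_ge0 ?coord_norm_le// ler_pM ?coord_norm_le//.
    have := @congruence_entry_le R n (metric g c (x0 + z *m P) - G) P^T de i j (ltW de0).
    rewrite trmxK => hc; apply: le_trans (hc _) _; last first.
      apply: ler_wpM2r; first exact: ltW de0.
      apply: ler_wpM2l; first exact: exprn_ge0.
      by apply: lerXn2r; rewrite ?nnegrE// lerDr.
    move=> k' l; rewrite !mxE; exact: (h4 _ (inb _ zR) (k', l)).
  have hs := sqn_ge w n0.
  have hd : n%:R ^+ 2 * (n%:R ^+ 2 * p ^+ 2 * de) <= 4^-1.
    have D0 : 0 < n%:R ^+ 2 * p ^+ 2 + 1 by rewrite ltr_wpDl// mulr_ge0 ?sqr_ge0// exprn_ge0.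
    rewrite /de -(ler_pM2r D0).
    have -> : n%:R ^+ 2 * (n%:R ^+ 2 * p ^+ 2 * (4 * n%:R ^+ 2 * (n%:R ^+ 2 * p ^+ 2 + 1))^-1) * (n%:R ^+ 2 * p ^+ 2 + 1) = 4^-1 * (n%:R ^+ 2 * p ^+ 2).
      have ff (N X : R) : 0 < N -> 0 < X + 1 -> N * (X * (4 * N * (X + 1))^-1) * (X + 1) = 4^-1 * X.
        by move=> N0 X0; field; rewrite !gt_eqF.
      by apply: ff => //; rewrite exprn_gt0// ltr0n.
    by rewrite ler_wpM2l// lerDl.
  have hq2 : n%:R ^+ 2 * `|w| ^+ 2 * (n%:R ^+ 2 * p ^+ 2 * de) <= 4^-1 * `|w| ^+ 2.
    by rewrite mulrAC ler_wpM2r// exprn_ge0.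
  have w2 : 0 <= `|w| ^+ 2 by rewrite exprn_ge0.
  move: hq; rewrite ler_norml => /andP[hq _].
  move: (quad _ w) (sqn w) (`|w| ^+ 2) (n%:R ^+ 2 * p ^+ 2 * de) hq hs hq2 w2 => a1 a2 a3 a4.
  clear; move: (n%:R ^+ 2 * a3 * a4) => a5; lra.
Qed.

End ChartFrame.

(** * Lengths of curves *)

Section PathLength.
Variable R : realType.
Notation mu := (@lebesgue_measure R).
Implicit Types (f G H : R -> R) (h : R -> \bar R).

(* The integral of a nonnegative function is a supremum over simple functions,
   hence monotone without any measurability. *)
Lemma ge0_le_integral_nonmeasurable (D : set R) (h1 h2 : R -> \bar R) :
  (forall t, D t -> (0 <= h1 t)%E) -> (forall t, D t -> (h1 t <= h2 t)%E) ->
  (\int[mu]_(t in D) h1 t <= \int[mu]_(t in D) h2 t)%E.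
Proof.
move=> h10 h12; have h20 t : D t -> (0 <= h2 t)%E by move=> Dt; exact: le_trans (h10 t Dt) (h12 t Dt).
rewrite !ge0_integralE//; apply: ereal_sup_le => _ [k hk <-]; exists k => // t.
by apply: le_trans (hk t) _; exact: lee_restrict.
Qed.

Lemma abs_increment_le_integral f f' (a b : R) : a < b ->
  (forall t, is_derive t (1 : R) f (f' t)) -> continuous f' ->
  (`|f b - f a|%:E <= \int[mu]_(t in `]a, b[) `|f' t|%:E)%E.
Proof.
move=> ab df cf'.
have mf' D : measurable_fun D f'.
  by apply: measurable_funS (continuous_measurable_fun cf').
have FTC : (\int[mu]_(t in `[a, b]) (f' t)%:E = (f b)%:E - (f a)%:E)%E.
  apply: continuous_FTC2 => //.
  - exact: continuous_subspaceT.
  - have cf t : {for t, continuous f}.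
      by apply: differentiable_continuous; apply/derivable1_diffP; case: (df t).
    by split; [move=> t _; case: (df t) | apply: cvg_at_right_filter; exact: cf | apply: cvg_at_left_filter; exact: cf].
  - by move=> t _; rewrite derive1E; case: (df t).
have := @le_abse_integral _ _ _ mu `[a, b] (EFin \o f') (measurable_itv _).
rewrite FTC => /(_ _)/= h; rewrite -(@integral_itv_bndoo _ a b _ true false).
  by apply: h; apply/measurable_EFinP; exact: mf'.
by apply/measurable_EFinP; apply: measurableT_comp => //; exact: normr_measurable.
Qed.

(** Additivity of the integral asks for measurable functions, and [H] is not assumed to be one.
    Hence a measurable minorant [h], equal to [|f'|] on each open piece and to 0 elsewhere: the
    pieces are added for [h], and [H] enters only through [h <= H]. *)
Lemma abs_increment_le_path G H (a b : R) (s : seq R) : itv_partition a b s ->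
  (forall i, (i < size s)%N -> exists f f', [/\ forall t, is_derive t (1 : R) f (f' t), continuous f',
     forall t, nth 0 (a :: s) i <= t <= nth 0 (a :: s) i.+1 -> G t = f t &
     forall t, nth 0 (a :: s) i < t < nth 0 (a :: s) i.+1 -> `|f' t| <= H t]) ->
  exists h, [/\ measurable_fun setT h, forall t, (0 <= h t)%E,
    forall t, (h t = 0)%E \/ (a < t < b) && (h t <= (H t)%:E)%E &
    (`|G b - G a|%:E <= \int[mu]_t h t)%E].
Proof.
elim: s a => [|s1 s IH] a [/= pa /eqP lb] hs.
  exists (fun=> 0%E); split => //; first by left.
  by rewrite lb subrr normr0 integral0.
move: pa => /andP[as1 ps].
have [|h2 [mh2 h20 h2s h2i]] := IH s1 (conj ps (introT eqP lb)).
  by move=> i si; have := hs i.+1; rewrite ltnS; apply.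
have s1b : s1 <= b.
  have al : all (fun y => s1 < y) s := order_path_min (@lt_trans _ R) ps.
  rewrite -lb; case: (s) al => [|x s'] /=; first by [].
  by rewrite -/(all _ (x :: s')) => /(@allP _ _ (x :: s')) al; apply/ltW/al; exact: mem_last.
have [f [f' [df cf' Gf fH]]] := hs 0%N isT; rewrite /= in Gf fH.
have mf' : measurable_fun setT (fun t => `|f' t|%:E).
  apply/measurable_EFinP; apply: measurableT_comp; first exact: normr_measurable.
  exact: continuous_measurable_fun.
pose h1 := (fun t => `|f' t|%:E) \_ `]a, s1[.
have h10 t : (0 <= h1 t)%E by rewrite /h1 patchE; case: ifP.
have mh1 : measurable_fun setT h1.
  by apply/(measurable_restrictT _ (measurable_itv _)); exact: measurable_funS mf'.
have h1s t : (h1 t = 0)%E \/ (a < t < s1) && (h1 t <= (H t)%:E)%E.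
  rewrite /h1 patchE; case: ifPn => [|_]; last by left.
  rewrite inE /= in_itv /= => ts; right; rewrite ts lee_fin; exact: fH.
exists (fun t => h1 t + h2 t)%E; split.
- exact: emeasurable_funD.
- by move=> t; rewrite adde_ge0.
- move=> t; case: (h1s t) (h2s t) => [->|/andP[/andP[t1 t2] h]] [->|/andP[/andP[t3 t4] h']].
  + by left; rewrite adde0.
  + by right; rewrite add0e h' (lt_trans as1 t3) t4.
  + by right; rewrite adde0 h t1 (lt_le_trans t2 s1b).
  + by have := lt_trans t2 t3; rewrite ltxx.
rewrite ge0_integralD//; apply: le_trans (_ : `|f s1 - f a|%:E + `|G b - G s1|%:E <= _)%E; last first.
  apply: leeD => //; rewrite /h1 -integral_mkcond.
  exact: abs_increment_le_integral.
rewrite -Gf ?lexx ?(ltW as1)// -Gf ?lexx ?(ltW as1)// -EFinD lee_fin [leRHS]addrC.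
exact: ler_distD.
Qed.

End PathLength.

(** * Speed of curves and cutoff functions *)

Section Curves.
Variables (R : realType) (n : nat) (M : topologicalType) (A : smooth_manifold R n M).
Variable g : riemannian_metric A.
Notation V := 'rV[R]_n.
Implicit Types (sigma gamma : R -> M) (c d : chart R n M) (t : R) (y z w : V).

Lemma chart_atP p : atlas A (chart_at A p) /\ cdom (chart_at A p) p.
Proof. by rewrite /chart_at; case: cid2. Qed.

Lemma C1_curve_is_derive sigma c t : C1_curve A sigma -> atlas A c -> cdom c (sigma t) ->
  is_derive t (1 : R) (c \o sigma) (derive1 (c \o sigma) t).
Proof. by move=> [_ h] Ac ct; have [dt _] := h c Ac t ct; exact: (DeriveDef dt (esym (derive1E _ _))). Qed.

Lemma curve_near_cdom sigma c t : C1_curve A sigma -> cdom c (sigma t) -> \forall s \near t, cdom c (sigma s).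
Proof.
move=> [cs _] ct; have oc : nbhs (sigma t) (cdom c) by apply: open_nbhs_nbhs; split => //; exact: chart_open_dom.
exact: (cs t _ oc).
Qed.

(** [speed] uses a chart that changes along the curve, while estimates need a fixed one. Velocities
    change by the Jacobian matrix and the metric by congruence with it, so the norm is the same. *)
Lemma speed_in_chart sigma c t : C1_curve A sigma -> atlas A c -> cdom c (sigma t) ->
  speed g sigma t = Num.sqrt ((derive1 (c \o sigma) t *m metric g c (c (sigma t)) *m (derive1 (c \o sigma) t)^T) 0 0).
Proof.
move=> hs Ac ct; have [Ad dt] := chart_atP (sigma t); rewrite /speed.
set d := chart_at A (sigma t) in Ad dt *; set v := derive1 (d \o sigma) t.
pose O := d @` (cdom d `&` cdom c).
have oO : open O := @chart_image_openI _ _ _ d _ (chart_open_dom c).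
have Ot : O (d (sigma t)) by exists (sigma t).
have dv : is_derive t (1 : R) (d \o sigma) v by exact: C1_curve_is_derive.
have h : is_derive t (1 : R) (fun s => Tvec (transition d c) (d (sigma s))) (v *m jacobian_mx d c (sigma t)).
  apply: is_derive_row => k.
  have -> : (fun r => Tvec (transition d c) (d (sigma r)) 0 k) = (fun r => transition d c k (d (sigma r))).
    by apply/funext => r; rewrite mxE.
  have fr := C1_frechet oO (smooth_on_C1 (atlas_smooth Ad Ac k)) Ot.
  have := chain_rule (s := d \o sigma) fr dv; rewrite /comp => h'; apply: is_derive_eq.
  by rewrite mxE; apply: eq_bigr => i _; rewrite !mxE mulrC.
have E : derive1 (c \o sigma) t = v *m jacobian_mx d c (sigma t).
  rewrite derive1E; have [_ <-] := h; apply: near_eq_derive.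
  have := curve_near_cdom hs dt; apply: filterS => s ds.
  by rewrite transition_vecE.
by rewrite E (metric_compatible g Ad Ac dt ct) trmx_mul !mulmxA.
Qed.

Lemma speed_near gamma sigma t : (\forall s \near t, gamma s = sigma s) -> speed g gamma t = speed g sigma t.
Proof.
move=> E; have Et := nbhs_singleton E; rewrite /speed Et.
have -> : derive1 (chart_at A (sigma t) \o gamma) t = derive1 (chart_at A (sigma t) \o sigma) t.
  by rewrite !derive1E; apply: near_eq_derive; apply: filterS E => s /= ->.
by [].
Qed.

(** The error of the linear approximation is at most [h^2] wherever [x] and [h + x] lie. The square
    removes the corner of the positive part, which makes the cutoff below of class C^1. *)
Lemma is_derive_pos_part_sqr (x : R) :
  is_derive x (1 : R) (fun s : R => Num.max 0 s ^+ 2) (2 * Num.max 0 x).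
Proof.
have bound (h : R) : `|Num.max 0 (h + x) ^+ 2 - Num.max 0 x ^+ 2 - h * (2 * Num.max 0 x)| <= h ^+ 2.
  rewrite ler_norml; case: (lerP 0 (h + x)) => h1; case: (lerP 0 x) => h2; apply/andP; split; nra.
suff main : (fun h : R => h^-1 *: (Num.max 0 (h + x) ^+ 2 - Num.max 0 x ^+ 2)) @ 0^' --> 2 * Num.max 0 x.
  have E : (fun h : R => h^-1 *: (((fun s : R => Num.max 0 s ^+ 2) \o shift x) (h *: (1 : R)) - (fun s : R => Num.max 0 s ^+ 2) x)) =
      (fun h : R => h^-1 *: (Num.max 0 (h + x) ^+ 2 - Num.max 0 x ^+ 2)).
    by apply/funext => h; rewrite /= /GRing.scale/= mulr1.
  by apply: DeriveDef; [rewrite /derivable E; apply/cvg_ex; exists (2 * Num.max 0 x) | rewrite /derive E; exact/cvg_lim].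
apply/cvgrPdist_le => e e0; near=> h.
have h0 : h != 0 by near: h; exact: nbhs_dnbhs_neq.
have he : `|h| <= e by near: h; apply: nbhs_dnbhs; apply/nbhs_ballP; exists e => //= k; rewrite /ball/= sub0r normrN => /ltW.
have := bound h; set D := _ ^+ 2 - _ => hb.
have -> : 2 * Num.max 0 x - h^-1 *: D = - (h^-1 * (D - h * (2 * Num.max 0 x))).
  by rewrite mulrBr mulKf// opprB.
rewrite normrN normrM normfV mulrC ler_pdivrMr ?normr_gt0//; apply: le_trans hb _.
by rewrite -real_normK ?num_real// expr2 ler_wpM2r.
Unshelve. all: by end_near. Qed.

Lemma max0_continuous : continuous (fun s : R => Num.max 0 s).
Proof. by move=> s; apply: continuous_max; [exact: cst_continuous | exact: cvg_id]. Qed.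

End Curves.

Section FrameMaps.
Variables (R : realType) (n : nat) (M : topologicalType) (A : smooth_manifold R n M).
Variable g : riemannian_metric A.
Notation V := 'rV[R]_n.
Implicit Types (sigma gamma : R -> M) (t : R) (y z w : V) (p q : M).

Lemma mulmx_continuous (P : 'M[R]_n) : continuous (fun z : V => z *m P).
Proof.
move=> z; apply: (proj2 (@cvgrPdist_le _ _ _ (nbhs z) (nbhs_filter z) _ _)) => e e0.
have k0 : 0 < n%:R * `|P| + 1 by rewrite ltr_wpDl// mulr_ge0.
apply/nbhs_ballP; exists (e / (n%:R * `|P| + 1)) => /=; first exact: divr_gt0.
move=> y; rewrite -ball_normE /= => zy; rewrite -mulmxBl; apply: le_trans (mulmx_norm_le _ _) _.
rewrite mulrAC; apply: le_trans (_ : (n%:R * `|P| + 1) * `|z - y| <= _).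
  by rewrite ler_wpM2r// lerDl.
by rewrite mulrC -ler_pdivlMr// ltW.
Qed.

Variables (c : chart R n M) (x0 : V) (P Q : 'M[R]_n) (R0 : R).
Hypotheses (Ac : atlas A c) (PQ : P *m Q = 1%:M).
Hypothesis hin : forall z, `|z| <= R0 -> cimage c (x0 + z *m P).

Definition psi z : M := cinv c (x0 + z *m P).
Definition chi p : V := (c p - x0) *m Q.

Lemma psi_dom z : `|z| <= R0 -> cdom c (psi z).
Proof. by move=> /hin[p cp E]; rewrite /psi -E chart_cancel. Qed.

Lemma chart_psi z : `|z| <= R0 -> c (psi z) = x0 + z *m P.
Proof. by move=> /hin[p cp E]; rewrite /psi -E chart_cancel. Qed.

Lemma psiK z : `|z| <= R0 -> chi (psi z) = z.
Proof. by move=> zR; rewrite /chi chart_psi// addrAC subrr add0r -mulmxA PQ mulmx1. Qed.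

Lemma chiK p : cdom c p -> psi (chi p) = p.
Proof.
by move=> cp; rewrite /psi /chi -mulmxA (mulmx1C PQ) mulmx1 addrC subrK chart_cancel.
Qed.

Lemma psi_continuous z : `|z| <= R0 -> {for z, continuous psi}.
Proof.
move=> zR; apply: (@continuous_comp _ _ _ (fun z => x0 + z *m P) (cinv c)).
  by apply: (@cvgD _ _ _ (nbhs z)); [exact: cvg_cst | exact: mulmx_continuous].
exact: chart_inv_continuous (hin zR).
Qed.

Lemma chi_continuous p : cdom c p -> {for p, continuous chi}.
Proof.
move=> cp; apply: (@continuous_comp _ _ _ (fun p => c p - x0) (fun z => z *m Q)).
  by apply: (@cvgB _ _ _ (nbhs p)); [exact: chart_continuous cp | exact: cvg_cst].
exact: mulmx_continuous.
Qed.

Lemma near_psi z (e : R) : `|z| <= R0 -> 0 < e ->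
  \forall q \near psi z, [/\ cdom c q, psi (chi q) = q & `|chi q - z| < e].
Proof.
move=> zR e0.
have n1 : nbhs (psi z) (cdom c).
  by apply: open_nbhs_nbhs; split; [exact: chart_open_dom | exact: psi_dom].
have n2 : nbhs (psi z) [set q | `|chi q - z| < e].
  apply: (@chi_continuous _ (psi_dom zR) [set y | `|y - z| < e]).
  by rewrite psiK//; apply: box_nbhs; rewrite subrr normr0.
have h : nbhs (psi z) [set q | cdom c q /\ `|chi q - z| < e] by exact: filterI n1 n2.
by move: h; apply: filterS => q [cq hq]; split => //; exact: chiK.
Qed.

Lemma is_derive_chi_curve sigma t : C1_curve A sigma -> cdom c (sigma t) ->
  is_derive t (1 : R) (chi \o sigma) (derive1 (c \o sigma) t *m Q).
Proof.
move=> hs ct; apply: is_derive_row => k.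
have dk (i : 'I_n) := is_derive_coord i (C1_curve_is_derive hs Ac ct).
have hk (i : 'I_n) : is_derive t (1 : R) (fun r => ((c \o sigma) r 0 i - x0 0 i) * Q i k) (derive1 (c \o sigma) t 0 i * Q i k).
  have := is_derive_mul (is_deriveB (dk i) (is_derive_cst (x0 0 i) t (1 : R))) (is_derive_cst (Q i k) t (1 : R)).
  by rewrite mulr0 addr0 subr0.
have := is_derive_sumf (index_enum 'I_n) hk => h.
have -> : (fun r => (chi \o sigma) r 0 k) = (fun r => \sum_i ((c \o sigma) r 0 i - x0 0 i) * Q i k).
  by apply/funext => r; rewrite /chi /= mxE; apply: eq_bigr => i _; rewrite !mxE.
by apply: is_derive_eq; rewrite mxE.
Qed.

Hypothesis hmet : forall z, `|z| <= R0 -> forall w,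
  `|w| ^+ 2 / 4 <= ((w *m P) *m metric g c (x0 + z *m P) *m (w *m P)^T) 0 0.
Hypothesis hT2 : hausdorff_space M.
Hypothesis n0 : (0 < n)%N.

(** A compact set in a Hausdorff space. It makes the cutoff, extended by 0, vanish on a
    neighbourhood of each point where the extension is used, even outside the chart. *)
Lemma psi_box_closed z (r : R) : (forall y, `|y - z| <= r -> `|y| <= R0) ->
  closed (psi @` [set y | `|y - z| <= r]).
Proof.
move=> zr; apply: compact_closed => //; apply: continuous_compact; last exact: box_compact.
by apply: continuous_in_subspaceT => y; rewrite inE /= => /zr; exact: psi_continuous.
Qed.

Section Cutoff.
Variables (z : V) (rho : R).
Hypotheses (rho0 : 0 < rho) (hz : forall y, `|y - z| <= rho -> `|y| < R0).

(* The cutoff is C^1 on M and varies along a curve at most by its length; its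
   value at the centre is [rho / (8 n)], so a curve leaving the box is at least
   that long. *)
Definition profile y : R := (8 * n%:R * rho ^+ 3)^-1 * Num.max 0 (rho ^+ 2 - sqn (y - z)) ^+ 2.

Definition cutoff p : R := if `[< cdom c p /\ `|chi p| < R0 >] then profile (chi p) else 0.

Lemma profile_out y : rho < `|y - z| -> profile y = 0.
Proof.
move=> h; rewrite /profile (_ : Num.max _ _ = 0) ?expr0n ?mulr0//.
apply/max_idPl; rewrite subr_le0; apply: le_trans (sqn_ge _ n0).
by rewrite lerXn2r ?nnegrE// ltW.
Qed.

(** In coordinates the derivative is at most [(8 * n * rho^3)^-1 * 2 * rho^2 * 2 * n * rho * |y'|],
    that is [|y'| / 2], and by the lower bound on the metric the speed is at least this. *)
Lemma cutoff_curve sigma t : C1_curve A sigma -> exists2 D : R -> R,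
  (\forall s \near t, is_derive s (1 : R) (cutoff \o sigma) (D s)) &
  {for t, continuous D} /\ `|D t| <= speed g sigma t.
Proof.
move=> hs; have cs : {for t, continuous sigma} by case: hs => cs _; exact: cs.
have k0 : 0 < 8 * n%:R * rho ^+ 3 by rewrite !mulr_gt0// ?exprn_gt0// ltr0n.
have [[ct tR]|out] := pselect (cdom c (sigma t) /\ `|chi (sigma t)| < R0); last first.
  exists (fun=> 0); last by split; [exact: cst_continuous | rewrite normr0 sqrtr_ge0].
  have nC : \forall s \near t, ~ (psi @` [set y | `|y - z| <= rho]) (sigma s).
    apply: (cs (~` (psi @` [set y | `|y - z| <= rho]))); apply: open_nbhs_nbhs; split.
      by apply: closed_openC; apply: psi_box_closed => y /hz; exact: ltW.
    move=> [y /= yz E]; apply: out; rewrite -E; have yR := hz yz.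
    by split; [apply: psi_dom; exact: ltW | rewrite psiK// ltW].
  have n0' : \forall s \near t, cutoff (sigma s) = 0.
    apply: filterS nC => s nC; rewrite /cutoff; case: asboolP => // -[cs' _].
    apply: profile_out; rewrite ltNge; apply/negP => h; apply: nC.
    by exists (chi (sigma s)) => //; exact: chiK.
  have := near_join n0'; apply: filterS => s hs'.
  apply: (near_eq_is_derive _ (is_derive_cst (0 : R) s (1 : R))).
  by apply: filterS hs' => r /= ->.
pose y s := chi (sigma s); pose y' s := derive1 (c \o sigma) s *m Q.
pose D s := (8 * n%:R * rho ^+ 3)^-1 * ((2 * Num.max 0 (rho ^+ 2 - sqn (y s - z))) * - (2 * dot (y s - z) (y' s))).
exists D; last split.
- have nW : \forall s \near t, cdom c (sigma s) /\ `|chi (sigma s)| < R0.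
    have n1 := curve_near_cdom hs ct.
    have n2 : \forall s \near t, `|chi (sigma s)| < R0.
      have cc : {for t, continuous (chi \o sigma)} := @continuous_comp _ _ _ sigma chi t cs (chi_continuous ct).
      apply: (cc [set x | `|x| < R0]); have := @box_nbhs R n 0 (chi (sigma t)) R0; rewrite subr0 => /(_ tR).
      by apply: filterS => x; rewrite subr0.
    exact: filterI n1 n2.
  have := near_join nW; apply: filterS => s hW; have [cs' _] := nbhs_singleton hW.
  apply: (@near_eq_is_derive _ _ _ (fun r => profile (y r))).
    by apply: filterS hW => r hr; rewrite /= /cutoff asboolT.
  have dy k := is_derive_coord k (is_derive_chi_curve hs cs').
  have dq k : is_derive s (1 : R) (fun r => (y r 0 k - z 0 k) * (y r 0 k - z 0 k)) (2 * ((y s 0 k - z 0 k) * y' s 0 k)).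
    have h : is_derive s (1 : R) (fun r => y r 0 k - z 0 k) (y' s 0 k).
      by have := is_deriveB (dy k) (is_derive_cst (z 0 k) s (1 : R)); rewrite subr0.
    have h' := is_derive_mul h h; apply: is_derive_eq.
    by rewrite [X in X + _]mulrC -mulr2n mulr_natl.
  have dS := is_derive_sumf (index_enum 'I_n) dq.
  have dI : is_derive s (1 : R) (fun r => rho ^+ 2 - sqn (y r - z)) (- (2 * dot (y s - z) (y' s))).
    have := is_deriveB (is_derive_cst (rho ^+ 2) s (1 : R)) dS.
    rewrite sub0r -mulr_sumr => h.
    have -> : (fun r => rho ^+ 2 - sqn (y r - z)) = (cst (rho ^+ 2) - (fun r => \sum_i (y r 0 i - z 0 i) * (y r 0 i - z 0 i))).
      apply/funext => r; rewrite fctE; congr (_ - _).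
      by apply: eq_bigr => i _; rewrite !mxE expr2.
    apply: is_derive_eq; congr (- (2 * _)).
    by apply: eq_bigr => i _; rewrite !mxE.
  have dM := @is_derive1_comp _ (fun s : R => Num.max 0 s ^+ 2) (fun r => rho ^+ 2 - sqn (y r - z)) s _ _ (is_derive_pos_part_sqr (rho ^+ 2 - sqn (y s - z))) dI.
  have := is_derive_mul (is_derive_cst ((8 * n%:R * rho ^+ 3)^-1) s (1 : R)) dM.
  by rewrite mul0r add0r.
- have cy : {for t, continuous y} := @continuous_comp _ _ _ sigma chi t cs (chi_continuous ct).
  have cy' : {for t, continuous y'}.
    have cd : {for t, continuous (derive1 (c \o sigma))} by case: hs => _ hs; case: (hs c Ac t ct).
    exact: (@continuous_comp _ _ _ (derive1 (c \o sigma)) (fun z => z *m Q) t cd (@mulmx_continuous Q _)).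
  have cyz : {for t, continuous (fun s => y s - z)}.
    exact: (cvgB cy (cvg_cst z)).
  have co k (f : R -> V) : {for t, continuous f} -> {for t, continuous (fun s => f s 0 k)}.
    by move=> cf; exact: (@continuous_comp _ _ _ f (fun x : V => x 0 k) t cf (@coord_continuous _ _ _ 0 k (f t))).
  have cdot : {for t, continuous (fun s => dot (y s - z) (y' s))}.
    apply: continuous_at_sum => k; exact: (cvgM (co k _ cyz) (co k _ cy')).
  have csq : {for t, continuous (fun s => sqn (y s - z))}.
    exact: (@continuous_comp _ _ _ (fun s => y s - z) (@sqn R n) t cyz (@sqn_continuous R n _)).
  have cm : {for t, continuous (fun s => Num.max 0 (rho ^+ 2 - sqn (y s - z)))}.
    have cb : {for t, continuous (fun s => rho ^+ 2 - sqn (y s - z))} by exact: (cvgB (cvg_cst _) csq).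
    exact: (@continuous_comp _ _ _ (fun s => rho ^+ 2 - sqn (y s - z)) (fun s => Num.max 0 s) t cb (@max0_continuous R _)).
  exact: (cvgM (cvg_cst _) (cvgM (cvgM (cvg_cst _) cm) (cvgN (cvgM (cvg_cst _) cdot)))).
- rewrite (speed_in_chart g hs Ac ct).
  have Ey : derive1 (c \o sigma) t = y' t *m P by rewrite /y' -mulmxA (mulmx1C PQ) mulmx1.
  have Ex : c (sigma t) = x0 + y t *m P.
    by rewrite /y /chi -mulmxA (mulmx1C PQ) mulmx1 addrC subrK.
  rewrite Ey Ex; have hm := hmet (ltW tR) (y' t).
  have sp : `|y' t| / 2 <= Num.sqrt ((y' t *m P *m metric g c (x0 + y t *m P) *m (y' t *m P)^T) 0 0).
    rewrite -[leLHS]ger0_norm ?divr_ge0// -sqrtr_sqr; apply: ler_wsqrtr; apply: le_trans hm.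
    by rewrite le_eqVlt; apply/orP; left; apply/eqP; field.
  apply: le_trans sp; rewrite /D.
  have [m0|m0] := leP (rho ^+ 2 - sqn (y t - z)) 0.
    by rewrite mulr0 mul0r mulr0 normr0 divr_ge0.
  have yz : `|y t - z| <= rho.
    rewrite -(ler_pXn2r (n := 2))// ?nnegrE ?(ltW rho0)//; apply: le_trans (sqn_ge _ n0) _.
    by rewrite ltW// -subr_gt0.
  rewrite normrM ger0_norm ?invr_ge0 ?(ltW k0)// mulrC ler_pdivrMr//.
  rewrite normrM normrN !normrM !(ger0_norm (_ : 0 <= 2))// (ger0_norm (ltW m0)).
  have d1 : `|dot (y t - z) (y' t)| <= n%:R * rho * `|y' t|.
    by apply: le_trans (dot_norm_le _ _) _; rewrite ler_wpM2r// ler_wpM2l.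
  have d2 : rho ^+ 2 - sqn (y t - z) <= rho ^+ 2 by rewrite gerBl sqn_ge0.
  have -> : `|y' t| / 2 * (8 * n%:R * rho ^+ 3) = 2 * rho ^+ 2 * (2 * (n%:R * rho * `|y' t|)) by field.
  by rewrite ler_pM ?ler_wpM2l// mulr_ge0// ltW.
Qed.

End Cutoff.

(** For the radius [8 * n * r] the cutoff has the value [r] at the centre; along a curve shorter
    than [r] it changes by less than [r], so it is still positive at [q]. The conditions on [z] and
    [r] keep the box strictly inside the frame, its radius being at most [R0 / 4]. *)
Lemma geodesic_distance_chart z q (r : R) : `|z| <= R0 / 2 -> 32 * n%:R * r <= R0 ->
  (geodesic_distance g (psi z) q < r%:E)%E ->
  exists2 z', q = psi z' & `|z' - z| <= 8 * n%:R * r.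
Proof.
move=> zR rR /ereal_inf_lt[_ [gamma [[s ps hs] g0 g1] <-] hl].
have nR : 1 <= n%:R :> R by rewrite ler1n.
have r0 : 0 < r.
  have : (0 <= curve_length g gamma)%E by apply: integral_ge0 => t _; rewrite lee_fin sqrtr_ge0.
  by move=> h; have := le_lt_trans h hl; rewrite lte_fin.
pose rho := 8 * n%:R * r.
have rho0 : 0 < rho by rewrite !mulr_gt0// ltr0n.
have hz y : `|y - z| <= rho -> `|y| < R0.
  move=> yz; have := ler_normD (y - z) z; rewrite subrK => h; apply: le_lt_trans h _.
  have : rho <= R0 / 4 by rewrite /rho; lra.
  have R00 : 0 < R0 by apply: lt_le_trans rR; rewrite !mulr_gt0// ltr0n.
  move=> rh; apply: le_lt_trans (lerD (le_trans yz rh) zR) _.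
  have -> : R0 / 4 + R0 / 2 = (3 / 4) * R0 by field.
  by rewrite gtr_pMl// ltr_pdivrMr// mul1r ltr_nat.
have zR0 : `|z| <= R0 by apply/ltW/hz; rewrite subrr normr0 ltW.
have /(_ (cutoff z rho \o gamma) (speed g gamma) 0 1 s ps)[] := @abs_increment_le_path R.
  move=> i si; have [sigma c1 E] := hs i si.
  exists (cutoff z rho \o sigma), (derive1 (cutoff z rho \o sigma)).
  have cd t := cutoff_curve rho0 hz t c1.
  split.
  - move=> t; have [D /nbhs_singleton nD _] := cd t.
    by apply: DeriveDef; [case: nD | rewrite derive1E].
  - move=> t; have [D nD [cD _]] := cd t.
    have e : \forall s \near t, D s = derive1 (cutoff z rho \o sigma) s.
      by apply: filterS nD => s' [_ <-]; rewrite derive1E.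
    change (derive1 (cutoff z rho \o sigma) y @[y --> t] --> derive1 (cutoff z rho \o sigma) t).
    by rewrite -(nbhs_singleton e); apply: cvg_trans cD; exact: near_eq_cvg e.
  - by move=> t ht; rewrite /= E.
  - move=> t ht; have [D /nbhs_singleton[_ nD] [_ hD]] := cd t.
    rewrite (@speed_near _ _ _ _ _ gamma sigma t).
      by rewrite derive1E nD.
    have : t \in `](nth 0 (0 :: s) i), (nth 0 (0 :: s) i.+1)[ by rewrite in_itv.
    move=> /near_in_itvoo; apply: filterS => u; rewrite in_itv /= => /andP[u1 u2].
    by apply: E; rewrite !ltW.
move=> h [mh h0 hh hi].
(* [h] vanishes outside the open unit interval, so its integral over the line is compared with that
   of the speed over [[0, 1]]. *)
have le1 : (\int[lebesgue_measure]_t h t <= curve_length g gamma)%E.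
  rewrite /curve_length [leRHS]integral_mkcond.
  apply: ge0_le_integral_nonmeasurable => // t _; rewrite patchE.
  have [t01|t01] := boolP (t \in `[0, 1]%classic).
    by case: (hh t) => [->|/andP[_ ]//]; rewrite lee_fin sqrtr_ge0.
  case: (hh t) => [->//|/andP[/andP[t0 t1] _]].
  by exfalso; move/negP : t01; apply; rewrite inE /= in_itv /= !ltW.
have lt1 : `|cutoff z rho q - cutoff z rho (psi z)| < r.
  have := le_lt_trans hi (le_lt_trans le1 hl); rewrite /= g0 g1 lte_fin.
  by [].
have c0 : cutoff z rho (psi z) = r.
  rewrite /cutoff asboolT; last by split; [exact: psi_dom | rewrite psiK//; apply: hz; rewrite subrr normr0 ltW].
  rewrite psiK// /profile subrr sqn0 subr0 (max_idPr _) ?sqr_ge0// /rho.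
  by field; rewrite !gt_eqF// ltr0n.
have cq : 0 < cutoff z rho q.
  move: lt1; rewrite c0 ltr_norml => /andP[lt1 _].
  by move: lt1; rewrite ltrBrDr addNr.
move: cq; rewrite /cutoff; case: asboolP => [[cq _]|]; last by rewrite ltxx.
move=> pq; exists (chi q); first by rewrite chiK.
rewrite leNgt; apply/negP => h'; have E : profile z rho (chi q) = 0 by exact: profile_out.
by rewrite E ltxx in pq.
Qed.

End FrameMaps.

(** * Local frames, null sets and sup norms *)

Section LocalFrame.
Variables (R : realType) (n : nat) (M : topologicalType) (A : smooth_manifold R n M).
Variable g : riemannian_metric A.
Notation V := 'rV[R]_n.
Implicit Types (u : M -> R) (z : V) (p q : M).

Lemma smooth_continuous u : smooth A u -> continuous u.
Proof.
move=> su p; have [Ac cp] := chart_atP A p; set c := chart_at A p in Ac cp.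
have h : {for p, continuous ((u \o cinv c) \o c)}.
  apply: continuous_comp; first exact: chart_continuous cp.
  exact: (smooth_on_continuous (su c Ac) (cimageP cp)).
have E : \forall q \near p, (u \o cinv c) (c q) = u q.
  have : nbhs p (cdom c) by apply: open_nbhs_nbhs; split => //; exact: chart_open_dom.
  by apply: filterS => q cq /=; rewrite chart_cancel.
change (u q @[q --> p] --> u p); rewrite -(nbhs_singleton E).
by apply: cvg_trans h; exact: near_eq_cvg E.
Qed.

(* Coordinates around a point in which the metric is nearly Euclidean; [fa] and
   [fb] are the coefficients of the Laplace-Beltrami operator in them. *)
Record local_frame (p0 : M) := LocalFrame {
  fpsi : V -> M ;
  fchi : M -> V ;
  fR : R ;
  fK : R ;
  fa : V -> 'M[R]_n ;
  fb : V -> V ;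
  fR_gt0 : 0 < fR ;
  fR_le1 : fR <= 1 ;
  fK_ge0 : 0 <= fK ;
  fK_small : 4 * n%:R ^+ 2 * fK * fR <= 1 ;
  f_elliptic : elliptic (eps0 R n) fR fK fa fb ;
  fpsi0 : fpsi 0 = p0 ;
  fpsi_continuous : forall z, `|z| <= fR -> {for z, continuous fpsi} ;
  fpsiK : forall z, `|z| <= fR -> fchi (fpsi z) = z ;
  f_near : forall z (e : R), `|z| <= fR -> 0 < e ->
    \forall q \near fpsi z, fpsi (fchi q) = q /\ `|fchi q - z| < e ;
  f_smooth : forall u, smooth A u -> exists du Hu, regular (u \o fpsi) du Hu 0 fR /\
    forall z, `|z| <= fR -> laplace_beltrami g u (fpsi z) = Lop (fa z) (fb z) (du z) (Hu z) ;
  f_geodesic : forall z q (r : R), `|z| <= fR / 2 -> 32 * n%:R * r <= fR ->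
    (geodesic_distance g (fpsi z) q < r%:E)%E ->
    exists2 z', q = fpsi z' & `|z' - z| <= 8 * n%:R * r }.

Lemma local_frame_exists p0 : (3 <= n)%N -> inhabited (local_frame p0).
Proof.
move=> n3; have n0 : (0 < n)%N by exact: leq_trans n3.
have [Ac cp] := chart_atP A p0; set c := chart_at A p0 in Ac cp.
have [P [Q [R0 [K [[PQ /andP[R00 R01] K0 KR] [hin hell hmet]]]]]] := chart_frame_exists g n3 Ac cp.
have QP := mulmx1C PQ.
constructor; apply: (@LocalFrame p0 (psi c (c p0) P) (chi c (c p0) Q) R0 K
  (fun z => Q^T *m invmx (metric g c (c p0 + z *m P)) *m Q) (fun z => drift g c (c p0 + z *m P) *m Q)) => //.
- by rewrite /psi mul0mx addr0 chart_cancel.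
- by move=> z zR; exact: (psi_continuous hin).
- by move=> z zR; exact: (psiK PQ hin).
- move=> z e zR e0; have := near_psi PQ hin zR e0.
  by apply: filterS => q [_ h1 h2].
- move=> u su; pose f := u \o cinv c; have sf : smooth_on (cimage c) f by exact: su.
  exists (fun z => grad f (c p0 + z *m P) *m P^T), (fun z => P *m hess f (c p0 + z *m P) *m P^T).
  split.
    move=> z; rewrite subr0 => zR; split.
      exact: (@continuous_comp _ _ _ (psi c (c p0) P) u z (psi_continuous hin zR) (@smooth_continuous u su _)).
    apply: (@jet_linear_change _ _ f); apply: jet_C2 (@cimage_open _ _ _ c) _ _ (hin z zR).
      exact: smooth_on_C1.
    by move=> i; apply/smooth_on_C1/smooth_on_partial.
  move=> z zR; have cz := psi_dom hin zR.
  have [Ad dz] := chart_atP A (psi c (c p0) P z); rewrite /laplace_beltrami.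
  rewrite (laplace_in_chart_invariant g Ad Ac su dz cz) (chart_psi hin zR).
  by rewrite (laplace_in_chart_Lop g Ac su (hin z zR)) Lop_linear_change.
- move=> z q r zR rR hd.
  exact: (geodesic_distance_chart Ac PQ hin hmet (manifold_hausdorff A) n0 zR rR hd).
Qed.

End LocalFrame.

(** * Nonempty open sets are not null *)

Section NullSets.
Variable R : realType.
Notation mu := (@lebesgue_measure R).

Definition in_segment (a b x : R) : R := (a <= x <= b)%R%:R.

Lemma in_segment_ge0 a b x : 0 <= in_segment a b x.
Proof. by rewrite /in_segment ler0n. Qed.

Lemma measurable_in_segment (be a b : R) : measurable_fun setT (fun t => (be * in_segment a b t)%:E).
Proof.
apply/measurable_EFinP; apply: measurable_funM => //.
have -> : in_segment a b = \1_`[a, b].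
  apply/funext => t; rewrite indicE /in_segment; congr (_%:R).
  by congr nat_of_bool; apply/idP/idP; rewrite inE /= in_itv.
exact: measurable_indic.
Qed.

Lemma integral_in_segment (be a b : R) : a <= b -> 0 <= be ->
  (\int[mu]_t (be * in_segment a b t)%:E = (be * (b - a))%:E)%E.
Proof.
move=> ab be0.
have E t : (be * in_segment a b t)%:E = (be%:E * (\1_`[a, b] t)%:E)%E.
  rewrite -EFinM indicE /in_segment; congr (_ * _)%:E; congr (_%:R).
  by congr nat_of_bool; apply/idP/idP; rewrite inE /= in_itv.
under eq_integral do rewrite E.
rewrite ge0_integralZl//; last exact/measurable_EFinP/measurable_indic.
have hm : mu (`[a, b]%classic : set R) = (b - a)%:E.
  rewrite lebesgue_measure_itv /= lte_fin; case: ltgtP ab => // -> _.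
  by rewrite subrr.
by rewrite integral_indic// setIT EFinM; congr (_ * _)%E.
Qed.

(* Integrating out one coordinate at a time. *)
Lemma box_cover_volume (m : nat) (c d : nat -> R) (a b : nat -> nat -> R) (al : R) (be : nat -> R) :
  (forall i, c i <= d i) -> (forall k i, a k i <= b k i) -> 0 <= al -> (forall k, 0 <= be k) ->
  (forall x : nat -> R, ((al * \prod_(i < m) in_segment (c i) (d i) (x i))%:E <=
     \sum_(0 <= k <oo) (be k * \prod_(i < m) in_segment (a k i) (b k i) (x i))%:E)%E) ->
  ((al * \prod_(i < m) (d i - c i))%:E <=
     \sum_(0 <= k <oo) (be k * \prod_(i < m) (b k i - a k i))%:E)%E.
Proof.
move=> cd ab; elim: m al be => [|m IH] al be al0 be0 h.
  have := h (fun=> 0); rewrite !big_ord0.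
  by under eq_eseriesr do rewrite big_ord0; move=> h'; under eq_eseriesr do rewrite big_ord0.
rewrite big_ord_recr /= [X in (al * X)%R]mulrC mulrA.
under eq_eseriesr do rewrite big_ord_recr /= [X in (_ * X)%R]mulrC mulrA.
apply: IH.
- by rewrite mulr_ge0// subr_ge0.
- by move=> k; rewrite mulr_ge0// subr_ge0.
move=> x.
have p0 (f g : nat -> R) : 0 <= \prod_(i < m) in_segment (f i) (g i) (x i).
  by apply: prodr_ge0 => i _; exact: in_segment_ge0.
have -> : (al * (d m - c m) * \prod_(i < m) in_segment (c i) (d i) (x i))%:E =
    (\int[mu]_t ((al * \prod_(i < m) in_segment (c i) (d i) (x i)) * in_segment (c m) (d m) t)%:E)%E.
  by rewrite integral_in_segment ?mulr_ge0// mulrAC.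
have -> : (\sum_(0 <= k <oo) (be k * (b k m - a k m) * \prod_(i < m) in_segment (a k i) (b k i) (x i))%:E)%E =
   (\int[mu]_t \sum_(0 <= k <oo) ((be k * \prod_(i < m) in_segment (a k i) (b k i) (x i)) * in_segment (a k m) (b k m) t)%:E)%E.
  rewrite integral_nneseries//.
  - by apply: eq_eseriesr => k _; rewrite integral_in_segment ?mulr_ge0// mulrAC.
  - by move=> k; exact: measurable_in_segment.
  - by move=> k t _; rewrite lee_fin !mulr_ge0// in_segment_ge0.
apply: ge0_le_integral_nonmeasurable => t _.
  by rewrite lee_fin !mulr_ge0// in_segment_ge0.
pose x' i := if i == m then t else x i.
have E (f g : nat -> R) : \prod_(i < m.+1) in_segment (f i) (g i) (x' i) = (\prod_(i < m) in_segment (f i) (g i) (x i)) * in_segment (f m) (g m) t.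
  rewrite big_ord_recr /= /x' eqxx; congr (_ * _); apply: eq_bigr => i _.
  by rewrite ltn_eqF.
have := h x'; rewrite E mulrA; under eq_eseriesr do rewrite E mulrA.
by [].
Qed.

Lemma nneseries_term_le (u : nat -> R) k : (forall i, 0 <= u i) -> ((u k)%:E <= \sum_(0 <= i <oo) (u i)%:E)%E.
Proof.
move=> u0; apply: (@le_trans _ _ (\sum_(0 <= i < k.+1) (u i)%:E)%E).
  by rewrite big_nat_recr//= leeDr// sume_ge0// => i _; rewrite lee_fin.
by apply: nneseries_lim_ge => i _ _; rewrite lee_fin.
Qed.

Lemma prod_in_segment_in m (a b x : nat -> R) : (forall i, (i < m)%N -> a i <= x i <= b i) ->
  \prod_(i < m) in_segment (a i) (b i) (x i) = 1.
Proof. by move=> h; apply: big1 => i _; rewrite /in_segment h. Qed.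

Lemma prod_in_segment_out m (a b x : nat -> R) i : (i < m)%N -> ~~ (a i <= x i <= b i) ->
  \prod_(j < m) in_segment (a j) (b j) (x j) = 0.
Proof.
move=> im h; apply/eqP; rewrite prodf_seq_eq0; apply/hasP; exists (Ordinal im); first by rewrite mem_index_enum.
by rewrite /in_segment (negbTE h) /=.
Qed.

(** A cube of side [r] inside [W], of volume [r^n], would be covered by boxes of total volume at
    most [r^n / 2]; the covering provides the inequality between indicators that [box_cover_volume]
    integrates. Coordinates are functions on all natural numbers there, whence [inord]. *)
Lemma open_not_null n (W : set 'rV[R]_n) x : (0 < n)%N -> open W -> W x -> ~ Defs.null_set W.
Proof.
case: n W x => // n W x _ oW Wx nW.
have /nbhs_ballP[r /= r0 hr] : nbhs x W by exact: open_nbhs_nbhs.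
pose cc i := x 0 (inord i) - r / 2; pose dd i := x 0 (inord i) + r / 2.
have e0 : 0 < r ^+ n.+1 / 2 by rewrite divr_gt0// exprn_gt0.
have [a [b [ab cov vol]]] := nW _ e0.
pose an k i := a k 0 (inord i : 'I_n.+1); pose bn k i := b k 0 (inord i : 'I_n.+1).
have := @box_cover_volume n.+1 cc dd an bn 1 (fun=> 1).
have h1 i : cc i <= dd i by rewrite /cc /dd; lra.
have h2 k i : an k i <= bn k i by exact: ab.
move=> /(_ h1 h2 ler01 (fun=> ler01)) h.
have : ((r ^+ n.+1)%:E <= (r ^+ n.+1 / 2)%:E)%E.
  apply: le_trans (le_trans (h _) _).
  - rewrite mul1r lee_fin (eq_bigr (fun=> r)).
      by rewrite prodr_const card_ord.
    by move=> i _; rewrite /cc /dd; field.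
  - move=> y; have [hy|/existsNP[i /not_implyP[iN /negP hy]]] := pselect (forall i, (i < n.+1)%N -> cc i <= y i <= dd i); last first.
      rewrite (prod_in_segment_out iN hy) mulr0; apply: nneseries_ge0 => k _ _.
      by rewrite lee_fin mul1r prodr_ge0// => j _; exact: in_segment_ge0.
    have Wy : W (\row_i y i).
      apply: hr; rewrite -ball_normE /=; apply: le_lt_trans (_ : r / 2 < r); last by lra.
      apply: mx_norm_leP => [|i]; first by lra.
      have := hy i (ltn_ord i); rewrite /cc /dd inord_val !mxE => /andP[y1 y2].
      by rewrite ler_norml; apply/andP; split; lra.
    have [k _ /= hk] := cov _ Wy.
    rewrite (prod_in_segment_in hy) mulr1.
    apply: le_trans (nneseries_term_le k _); last first.
      by move=> i; rewrite mul1r prodr_ge0// => j _; exact: in_segment_ge0.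
    rewrite prod_in_segment_in ?mulr1// => i iN.
    by have := hk (inord i); rewrite mxE inordK.
  - apply: le_trans vol; rewrite le_eqVlt; apply/orP; left; apply/eqP.
    apply: eq_eseriesr => k _; rewrite mul1r; congr _%:E.
    by apply: eq_bigr => i _; rewrite /an /bn inord_val.
rewrite lee_fin; apply/negP; rewrite -ltNge.
have : 0 < r ^+ n.+1 by rewrite exprn_gt0.
move: (r ^+ n.+1) => t t0; lra.
Qed.

End NullSets.

(** * Pointwise bounds by the essential supremum *)

Section SupNorm.
Variables (R : realType) (n : nat) (M : topologicalType) (A : smooth_manifold R n M).
Hypotheses (n0 : (0 < n)%N) (M_compact : compact [set: M]).
Implicit Types (u : M -> R) (B : set M) (p q : M).

Lemma continuous_bounded u : continuous u -> exists2 m : R, 0 <= m & forall p, `|u p| <= m.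
Proof.
move=> cu; have cc : compact ((fun p => `|u p|) @` [set: M]).
  apply: continuous_compact => //; apply: continuous_subspaceT => p.
  by apply: (@continuous_comp _ _ _ u (fun t => `|t|)); [exact: cu | exact: norm_continuous].
have [m [_ hm]] := compact_bounded cc.
exists (`|m| + 1); first by rewrite addr_ge0.
move=> p; have := hm (`|m| + 1) (ltr_pwDr ltr01 (ler_norm m)) `|u p|.
by rewrite /= normr_id; apply; exists p.
Qed.

Lemma negligible_set0 : negligible_set A set0.
Proof.
move=> c _ e e0; exists (fun=> 0), (fun=> 0); split.
- by move=> k i.
- by move=> _ [p [[]]].
- rewrite eseries0 ?lee_fin ?ltW// => k _ _.
  by case: (n) n0 => // n' _; rewrite big_ord_recl /= subrr mul0r.
Qed.

Lemma negligible_not_nbhs B p : nbhs p B -> ~ negligible_set A B.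
Proof.
move=> pB nB; have [Ac cp] := chart_atP A p; set c := chart_at A p in Ac cp.
have oW : open (c @` (cdom c `&` B°)) by apply: chart_image_openI; exact: open_interior.
have Wp : (c @` (cdom c `&` B°)) (c p) by exists p.
apply: (open_not_null n0 oW Wp) => e e0.
have [a [b [h1 h2 h3]]] := nB c Ac e e0; exists a, b; split => //.
apply: subset_trans h2 => _ [q [cq Bq] <-]; exists q => //; split => //.
exact: interior_subset.
Qed.

(** If [|u p|] exceeded an essential bound [k], then [|u| > k] would hold on a neighbourhood of [p]
    within [B], which is not negligible. Compactness makes the set of essential bounds nonempty, so
    that its infimum is not the default value. *)
Lemma abs_le_Linfty_norm B u p : continuous u -> nbhs p B -> `|u p| <= Linfty_norm A B u.
Proof.
move=> cu pB; have [m m0 hm] := continuous_bounded cu.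
apply: lb_le_inf.
  exists m; split => //; rewrite (_ : [set _ | _] = set0); first exact: negligible_set0.
  by apply/seteqP; split => // q [_]; rewrite ltNge hm.
move=> k [k0 nk]; rewrite leNgt; apply/negP => ku; apply: (negligible_not_nbhs _ nk).
apply: filterI pB _.
have cn : {for p, continuous (fun q => `|u q|)}.
  by apply: (@continuous_comp _ _ _ u (fun t => `|t|)); [exact: cu | exact: norm_continuous].
by apply: (cn [set t | k < t]); exact: lt_nbhsr.
Qed.

End SupNorm.

(** * Nodal domains and the spectral gap *)

Section NodalDomains.
Variables (R : realType) (n : nat) (M : topologicalType) (A : smooth_manifold R n M).
Variable g : riemannian_metric A.
Hypothesis n3 : (3 <= n)%N.
Notation V := 'rV[R]_n.
Implicit Types (u phi : M -> R) (p q : M) (Omega : set M).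

Lemma near_ne0 u p : continuous u -> u p != 0 -> \forall q \near p, u q != 0.
Proof.
move=> cu u0; have cn : {for p, continuous (fun q => `|u q|)}.
  exact: (@continuous_comp _ _ _ u (fun t => `|t|) p (cu p) (@norm_continuous _ _ (u p))).
have u1 : 0 < `|u p| by rewrite normr_gt0.
have h : \forall q \near p, 0 < `|u q| by exact: (cn [set t | 0 < t] (lt_nbhsr u1)).
by move: h; apply: filterS => q; rewrite normr_gt0.
Qed.

(** Points near [p] are joined to it by straight segments in the coordinates of a frame, on which
    [phi] does not vanish. This local connectedness makes nodal domains open. *)
Lemma near_component phi p : continuous phi -> phi p != 0 ->
  \forall q \near p, connected_component [set q | phi q != 0] p q.
Proof.
move=> cphi p0; have [F] := local_frame_exists g p n3.
have R0 := fR_gt0 F; have z0 : `|0 : V| <= fR F by rewrite normr0 ltW.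
have n1 : \forall y \near (0 : V), phi (fpsi F y) != 0.
  have := near_ne0 cphi p0; rewrite -{1}(fpsi0 F); exact: (fpsi_continuous z0).
have /nbhs_ballP[e /= e0 he] := n1.
pose r := Num.min e (fR F); have r0 : 0 < r by rewrite lt_min e0.
have := f_near z0 r0; rewrite fpsi0; apply: filterS => q [Eq]; rewrite subr0 => qr.
pose s (t : R) := fpsi F (t *: fchi F q).
have bd (t : R) : 0 <= t <= 1 -> `|t *: fchi F q| < r.
  move=> /andP[t0 t1]; rewrite normrZ ger0_norm//; apply: le_lt_trans qr.
  by rewrite ler_piMl.
apply: (@connected_component_max _ _ (s @` `[0, 1])).
- by exists 0; [rewrite /= in_itv /= lexx ler01 | rewrite /s scale0r fpsi0].
- move=> _ [t t01 <-]; move: t01; rewrite /= in_itv /= => /bd tr; apply: he.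
  by rewrite -ball_normE /= sub0r normrN; apply: lt_le_trans tr _; rewrite ge_min lexx.
- apply: connected_continuous_connected; first exact: segment_connected.
  apply: continuous_in_subspaceT => t; rewrite inE /= in_itv /= => /bd tr.
  have tR : `|t *: fchi F q| <= fR F by rewrite ltW// (lt_le_trans tr)// ge_min lexx orbT.
  have ct : {for t, continuous (fun t : R => t *: fchi F q)} by exact: scalel_continuous.
  exact: (@continuous_comp _ _ _ (fun t : R => t *: fchi F q) (fpsi F) t ct (fpsi_continuous tR)).
- by exists 1; [rewrite /= in_itv /= lexx ler01 | rewrite /s scale1r].
Qed.

(** The component of [p] is a neighbourhood of [p], hence meets [Omega], and two components that
    meet coincide. *)
Lemma nodal_domain_nbhs phi Omega p : continuous phi -> nodal_domain phi Omega ->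
  closure Omega p -> phi p != 0 -> nbhs p Omega.
Proof.
move=> cphi [x x0 ->] cl p0; have nc := near_component cphi p0.
have [q [hq pq]] := cl _ nc.
apply: filterS nc => q' pq'; apply: connected_component_trans pq'.
by apply: connected_component_trans hq _; exact: connected_component_sym.
Qed.

Lemma nodal_domain_ne0 phi Omega p : nodal_domain phi Omega -> Omega p -> phi p != 0.
Proof. by move=> [x _ ->] /connected_component_sub. Qed.

Lemma nodal_domain_pos phi Omega p q : continuous phi -> nodal_domain phi Omega ->
  Omega p -> Omega q -> 0 < phi p -> 0 < phi q.
Proof.
move=> cphi nd Op Oq p0; rewrite ltNge; apply/negP => q0.
have cO : connected Omega by case: nd => x _ ->; exact: component_connected.
have : connected (phi @` Omega).
  by apply: connected_continuous_connected => //; exact: continuous_subspaceT.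
move/connected_intervalP => /(_ (phi q) (phi p)) h.
have [x Ox x0] : (phi @` Omega) 0.
  by apply: h; [exists q | exists p | rewrite q0 ltW].
by have := nodal_domain_ne0 nd Ox; rewrite x0 eqxx.
Qed.

End NodalDomains.

(** * Harnack chains and the lower bound for eigenvalues *)

Section SpectralGap.
Variables (R : realType) (n : nat) (M : topologicalType) (A : smooth_manifold R n M).
Variable g : riemannian_metric A.
Hypothesis n3 : (3 <= n)%N.
Hypotheses (M_compact : compact [set: M]) (M_connected : connected [set: M]).
Notation V := 'rV[R]_n.
Implicit Types (u phi w : M -> R) (p q : M).

Lemma partial_addc (f : V -> R) (k : R) i : partial i (fun x => f x + k) = partial i f.
Proof.
apply/funext => x; rewrite /partial /derive.
have -> // : (fun h : R => h^-1 *: (((fun x => f x + k) \o shift x) (h *: delta_mx 0 i) - (f x + k))) =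
   (fun h : R => h^-1 *: ((f \o shift x) (h *: delta_mx 0 i) - f x)).
by apply/funext => h /=; congr (_ *: _); rewrite opprD addrACA subrr addr0.
Qed.

Lemma smooth_addc u (k : R) : smooth A u -> smooth A (fun p => u p + k).
Proof.
move=> su c Ac m; have := su c Ac m; case: m => [|m] [h1 h2]; split.
- by move=> x cx; apply: (cvgD (h1 x cx)); exact: cvg_cst.
- by [].
- by move=> x cx; apply: (cvgD (h1 x cx)); exact: cvg_cst.
move=> i; have [d1 d2] := h2 i.
have -> : partial i ((fun p => u p + k) \o cinv c) = partial i (u \o cinv c) by exact: partial_addc.
split; last exact: d2.
move=> x cx; rewrite /derivable.
have -> : (fun h : R => h^-1 *: ((((fun p => u p + k) \o cinv c) \o shift x) (h *: delta_mx 0 i) - ((fun p => u p + k) \o cinv c) x)) =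
   (fun h : R => h^-1 *: (((u \o cinv c) \o shift x) (h *: delta_mx 0 i) - (u \o cinv c) x)).
  by apply/funext => h /=; congr (_ *: _); rewrite opprD addrACA subrr addr0.
exact: d1.
Qed.

Lemma laplace_addc u (k : R) p : laplace_beltrami g (fun p => u p + k) p = laplace_beltrami g u p.
Proof.
have E c : flux g c (fun p => u p + k) = flux g c u.
  apply/funext => i; apply/funext => y; rewrite /flux; congr (_ * _); apply: eq_bigr => j _.
  have -> // : partial j ((fun p => u p + k) \o cinv c) = partial j (u \o cinv c) by exact: partial_addc.
by rewrite /laplace_beltrami !laplace_flux E.
Qed.

(** The factor [n^-2] is the one in the local Harnack inequality, which is used with radii of at
    most 1. *)
Definition almost_harmonic w : Prop :=
  [/\ smooth A w, forall p, 0 < w p & forall p, `|laplace_beltrami g w p| <= n%:R ^- 2 * w p].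

Lemma local_harnack p0 : exists2 C : R, 1 <= C & exists2 W : set M, nbhs p0 W &
  forall w, almost_harmonic w -> forall p q, W p -> W q -> w p <= C * w q.
Proof.
have [F] := local_frame_exists g p0 n3.
have n0 : (0 < n)%N by exact: leq_trans n3.
have nR : 1 <= n%:R :> R by rewrite ler1n.
have R0 := fR_gt0 F; have R1 := fR_le1 F; have z0 : `|0 : V| <= fR F by rewrite normr0 ltW.
have [C C1 hC] := harnack n3 (fK_ge0 F); exists C => //.
(* Two points of the neighbourhood differ in coordinates by less than [(fR F / 2) / (8 * n)], the
   range of Harnack's inequality of radius [fR F / 2]. *)
pose de := fR F / (32 * n%:R); have de0 : 0 < de by rewrite divr_gt0// mulr_gt0// ltr0n.
exists [set q | fpsi F (fchi F q) = q /\ `|fchi F q - 0| < de].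
  by have := f_near z0 de0; rewrite fpsi0.
move=> w [sw w0 wL] p q [Ep hp] [Eq hq]; rewrite !subr0 in hp hq.
have [dw [Hw [reg Lw]]] := f_smooth F sw.
have r0 : 0 < fR F / 2 by rewrite divr_gt0.
have deR : de <= fR F / 2.
  rewrite /de ler_pdivrMr ?mulr_gt0 ?ltr0n//; clear -R0 nR; nra.
have inb x : `|x - fchi F q| <= fR F / 2 -> `|x| <= fR F.
  move=> hx; have := ler_normD (x - fchi F q) (fchi F q); rewrite subrK => h; apply: le_trans h _.
  by rewrite [leRHS]splitr; apply: lerD => //; apply: le_trans (ltW hq) deR.
have r1 : fR F / 2 <= 1 by clear -R0 R1; move: (fR F) R0 R1 => r; lra.
have r2 : (fR F / 2) ^+ 2 <= 1 by rewrite exprn_ile1// ltW.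
have := hC _ _ _ (fK_small F) (f_elliptic F) (w \o fpsi F) dw Hw (fchi F q) (fR F / 2).
rewrite r0 r1 => /(_ isT inb) h; rewrite -Ep -Eq; apply: h.
- by apply: regular_sub reg _ => x /inb; rewrite subr0.
- by move=> x _; exact: w0.
- move=> x xb; rewrite -Lw ?inb//; apply: le_trans (wL _) _.
  rewrite ler_wpM2l ?invr_ge0 ?exprn_ge0//= ler_pdivlMr ?exprn_gt0//.
  by rewrite ler_piMr// ltW.
- apply: le_trans (ler_normB _ _) _; apply: le_trans (lerD (ltW hp) (ltW hq)) _.
  by rewrite le_eqVlt; apply/orP; left; apply/eqP; rewrite /de; field; rewrite gt_eqF// ltr0n.
Qed.

(** By the local inequality, the points comparable with [p0], with a constant depending on the
    point, form an open and closed set. Compactness then gives a common constant, and comparing two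
    points through [p0] squares it. *)
Lemma global_harnack p0 : exists2 C : R, 1 <= C &
  forall w, almost_harmonic w -> forall p q, w p <= C * w q.
Proof.
pose E := [set q | exists2 C : R, 1 <= C & forall w, almost_harmonic w -> w q <= C * w p0 /\ w p0 <= C * w q].
have step (W : set M) (C : R) p q : 1 <= C -> (forall w, almost_harmonic w -> forall p q, W p -> W q -> w p <= C * w q) ->
    W p -> W q -> E q -> E p.
  move=> C1 hW Wp Wq [D D1 hD]; have C0 : 0 <= C by exact: le_trans C1.
  have D0 : 0 <= D by exact: le_trans D1.
  exists (C * D) => [|w hw]; first by rewrite mulr_ege1.
  have [h1 h2] := hD w hw; split.
    by apply: le_trans (hW w hw _ _ Wp Wq) _; rewrite -mulrA ler_wpM2l.
  by apply: le_trans h2 _; rewrite (mulrC C) -mulrA ler_wpM2l// hW.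
have ET : E = [set: M].
  apply: M_connected.
  - by exists p0, 1 => // w _; rewrite !mul1r.
  - exists E; last by rewrite setTI.
    rewrite openE => q Eq; have [C C1 [W nW hW]] := local_harnack q.
    have Wq := nbhs_singleton nW; rewrite /interior; apply: filterS nW => p Wp.
    exact: step C1 hW Wp Wq Eq.
  - exists E; last by rewrite setTI.
    move=> q cq; have [C C1 [W nW hW]] := local_harnack q.
    have [p [Ep Wp]] := cq _ nW.
    exact: step C1 hW (nbhs_singleton nW) Wp Ep.
(* The comparison constant is the parameter of the near-covering form of compactness, and it tends
   to infinity. *)
have := M_compact; rewrite compact_near_coveringP => /(_ R (pinfty_nbhs R)
  (fun C q => forall w, almost_harmonic w -> w q <= C * w p0 /\ w p0 <= C * w q) _).
case.
  move=> q _; have [C C1 [W nW hW]] := local_harnack q.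
  have [D D1 hD] : E q by rewrite ET.
  exists (W, [set t | C * D <= t]).
    by split => //=; exact: nbhs_pinfty_ge (num_real _).
  move=> [p t] /= [Wp ht] w hw; have [h1 h2] := hD w hw.
  have wp : 0 < w p by case: hw.
  have wp0 : 0 < w p0 by case: hw.
  have Wq := nbhs_singleton nW; have C0 : 0 <= C by exact: le_trans C1.
  have D0 : 0 <= D by exact: le_trans D1.
  split.
    apply: le_trans (hW w hw _ _ Wp Wq) _; apply: le_trans (_ : C * D * w p0 <= _).
      by rewrite -mulrA ler_wpM2l.
    by rewrite ler_wpM2r// ltW.
  apply: le_trans h2 _; apply: le_trans (_ : C * D * w p <= _).
    by rewrite (mulrC C) -mulrA ler_wpM2l// hW.
  by rewrite ler_wpM2r// ltW.
move=> N [_ hN]; pose D := Num.max N 1 + 1.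
have hD : forall q w, almost_harmonic w -> w q <= D * w p0 /\ w p0 <= D * w q.
  by move=> q; apply: (hN D) => //; rewrite ltr_pwDr// le_max lexx.
have D1 : 1 <= D by rewrite /D ler_wpDl// le_max ler01 orbT.
exists (D * D) => [|w hw p q]; first by rewrite mulr_ege1.
have [h1 _] := hD p w hw; have [_ h2] := hD q w hw.
by apply: le_trans h1 _; rewrite -mulrA ler_wpM2l// (le_trans ler01).
Qed.

Lemma laplace_at_min u p : smooth A u -> (forall q, u p <= u q) -> 0 <= laplace_beltrami g u p.
Proof.
move=> su mn; have [F] := local_frame_exists g p n3.
have n0 : (0 < n)%N by exact: leq_trans n3.
have R0 := fR_gt0 F; have z0 : `|0 : V| <= fR F by rewrite normr0 ltW.
have [du [Hu [reg Lu]]] := f_smooth F su.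
have [aT ai _] := (elliptic_offw n3 (f_elliptic F)).1 0 z0.
have := Lu 0 z0; rewrite fpsi0 => ->; have [|_ ju] := reg 0; first by rewrite subrr normr0 ltW.
have hn : nbhs (0 : V) (fun y => (u \o fpsi F) 0 <= (u \o fpsi F) y).
  by apply: filterE => y /=; rewrite fpsi0.
exact: (Lop_min n0 _ aT ai ju hn).
Qed.

Lemma laplace_at_max u p : smooth A u -> (forall q, u q <= u p) -> laplace_beltrami g u p <= 0.
Proof.
move=> su mx; have [F] := local_frame_exists g p n3.
have n0 : (0 < n)%N by exact: leq_trans n3.
have R0 := fR_gt0 F; have z0 : `|0 : V| <= fR F by rewrite normr0 ltW.
have [du [Hu [reg Lu]]] := f_smooth F su.
have [aT ai _] := (elliptic_offw n3 (f_elliptic F)).1 0 z0.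
have := Lu 0 z0; rewrite fpsi0 => ->; have [|_ ju] := reg 0; first by rewrite subrr normr0 ltW.
have hn : nbhs (0 : V) (fun y => (u \o fpsi F) y <= (u \o fpsi F) 0).
  by apply: filterE => y /=; rewrite fpsi0.
exact: (Lop_max n0 _ aT ai ju hn).
Qed.

(** The maximum principle gives [phi pm <= 0 <= phi px], so the oscillation [S] bounds |phi|, and
    the shift [k] makes [phi + k] positive with [|lam * phi| <= n^-2 * (phi + k)]. Harnack's
    inequality between the maximum and the minimum then yields [S <= C * n^2 * lam * S], where
    [S > 0]. *)
Lemma spectral_gap (p0 : M) : exists2 lam0 : R, 0 < lam0 &
  forall lam phi, 0 < lam -> is_eigenfunction g lam phi -> lam0 <= lam.
Proof.
have [C C1 hC] := global_harnack p0.
have n0 : (0 < n)%N by exact: leq_trans n3.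
have nR : 1 <= n%:R :> R by rewrite ler1n.
have N0 : 0 < n%:R ^+ 2 :> R by rewrite exprn_gt0// ltr0n.
have C0 : 0 < C by exact: lt_le_trans C1.
exists (C * n%:R ^+ 2)^-1; first by rewrite invr_gt0 mulr_gt0.
move=> lam phi lam0 [sphi [q0 q0n] eig].
have cphi := smooth_continuous sphi.
have cW : {within [set: M], continuous phi} by exact: continuous_subspaceT.
have [pm _ hm] := compact_EVT_min (ex_intro _ p0 I) M_compact cW.
have [px _ hx] := compact_EVT_max (ex_intro _ p0 I) M_compact cW.
have mn q : phi pm <= phi q by apply: hm; rewrite inE.
have mx q : phi q <= phi px by apply: hx; rewrite inE.
have m0 : phi pm <= 0.
  have := laplace_at_min sphi mn; rewrite -oppr_le0 eig; rewrite pmulr_rle0//.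
have x0 : 0 <= phi px.
  have := laplace_at_max sphi mx; rewrite -oppr_ge0 eig; rewrite pmulr_rge0//.
pose S := phi px - phi pm.
have aS q : `|phi q| <= S.
  have := mn q; have := mx q; rewrite ler_norml /S => h1 h2; apply/andP; split; lra.
have S0 : 0 < S by apply: lt_le_trans (aS q0); rewrite normr_gt0.
pose k := - phi pm + n%:R ^+ 2 * lam * S.
have hw : almost_harmonic (fun q => phi q + k).
  split; first exact: smooth_addc.
    move=> q; rewrite /k addrA ltr_wpDl ?subr_ge0//.
    exact: mulr_gt0 (mulr_gt0 N0 lam0) S0.
  move=> q; rewrite laplace_addc -normrN eig normrM gtr0_norm//.
  rewrite ler_pdivlMl// /k addrA.
  apply: le_trans (_ : n%:R ^+ 2 * lam * S <= _).
    by rewrite -mulrA ler_wpM2l ?(ltW N0)// ler_wpM2l// ltW.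
  by rewrite lerDr subr_ge0.
have := hC _ hw px pm; rewrite /k addrA -/S (addrA (phi pm)) subrr add0r => h.
have h2 : S <= C * (n%:R ^+ 2 * lam * S).
  by apply: le_trans h; rewrite lerDl !mulr_ge0// ltW.
have {}h2 : 1 * S <= (C * n%:R ^+ 2 * lam) * S by rewrite mul1r -!mulrA in h2 *.
rewrite ler_pM2r// in h2.
by rewrite -[leLHS]mulr1 ler_pdivrMl// mulr_gt0.
Qed.

End SpectralGap.

(** * From nearby centres to the whole manifold *)

Section LocalTheorem.
Variables (R : realType) (n : nat) (M : topologicalType) (A : smooth_manifold R n M).
Variable g : riemannian_metric A.
Hypothesis n3 : (3 <= n)%N.
Hypothesis M_compact : compact [set: M].
Notation V := 'rV[R]_n.
Implicit Types (phi : M -> R) (p q : M).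

Lemma geodesic_ball_le p (r r' : R) : r <= r' -> geodesic_ball g p r `<=` geodesic_ball g p r'.
Proof. by move=> rr q /lt_le_trans; apply; rewrite lee_fin. Qed.

(** One constant serves all centres near [p0], as the compactness argument requires. Since [phi x0]
    equals a norm that bounds |phi| on [Omega], [phi] is positive on [Omega], and the preimage of
    [Omega] in the coordinates satisfies the conditions of the local statement. *)
Lemma no_sign_change_near (nu a lam0 : R) (p0 : M) : 0 < nu -> 0 < a -> 0 < lam0 ->
  let mu : R := (2 * n%:R * nu) / ((n%:R - 1) * (n%:R - 2)) in
  exists2 c : R, 0 < c & \forall x0 \near p0, forall (lam : R) phi Omega,
    0 < lam -> lam0 <= lam -> is_eigenfunction g lam phi -> nodal_domain phi Omega -> Omega x0 ->
    phi x0 = Linfty_norm A Omega phi ->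
    a * expR (- (lam `^ mu)) * Linfty_norm A [set: M] phi <= `|phi x0| ->
    forall q, geodesic_ball g x0 (c / (lam `^ (2^-1 + nu))) q -> 0 <= phi q.
Proof.
move=> nu0 a0 lam00 mu; have [F] := local_frame_exists g p0 n3.
have n0 : (0 < n)%N by exact: leq_trans n3.
have R0 := fR_gt0 F; have R1 := fR_le1 F.
have R01 : 0 < fR F <= 1 by rewrite R0.
have z0 : `|0 : V| <= fR F by rewrite normr0 ltW.
have [c1 c10 main] := local_sign n3 (fK_ge0 F) R01 (fK_small F) (f_elliptic F) nu0 a0 lam00.
pose s := 2^-1 + nu; have s0 : 0 <= s by rewrite addr_ge0 ?invr_ge0// ltW.
have l0s : 0 < lam0 `^ s by rewrite powR_gt0.
have N8 : 0 < 8 * n%:R :> R by rewrite mulr_gt0// ltr0n.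
have N32 : 0 < 32 * n%:R :> R by rewrite mulr_gt0// ltr0n.
(* The first bound, with its factor [8 * n], passes from geodesic radii to coordinate boxes; the
   second keeps the ball in the range of that comparison for all [lam >= lam0]. *)
pose c := Num.min (c1 / (8 * n%:R)) (fR F * lam0 `^ s / (32 * n%:R)).
have c0 : 0 < c by rewrite lt_min !divr_gt0// mulr_gt0.
have cc1 : 8 * n%:R * c <= c1 by rewrite mulrC -ler_pdivlMr// ge_min lexx.
have cc2 : 32 * n%:R * c <= fR F * lam0 `^ s by rewrite mulrC -ler_pdivlMr// ge_min lexx orbT.
exists c => //.
have R2 : 0 < fR F / 2 by rewrite divr_gt0.
have := f_near z0 R2; rewrite fpsi0; apply: filterS => x0 [Ex]; rewrite subr0 => xR.
move=> lam phi Omega lam_gt0 lamge eig nd Ox phix hyp q hq.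
have [sphi _ Lphi] := eig; have cphi := smooth_continuous sphi.
have nbO p : Omega p -> nbhs p Omega.
  move=> Op; apply: (nodal_domain_nbhs g n3 cphi nd); first exact: subset_closure.
  exact: nodal_domain_ne0 nd Op.
have le0 p : Omega p -> `|phi p| <= phi x0.
  by move=> Op; rewrite phix; apply: abs_le_Linfty_norm => //; exact: nbO.
have x0pos : 0 < phi x0.
  have h : 0 < `|phi x0| by rewrite normr_gt0; exact: nodal_domain_ne0 nd Ox.
  exact: lt_le_trans h (le0 _ Ox).
have posO p : Omega p -> 0 < phi p by move=> Op; exact: (nodal_domain_pos cphi nd Ox Op).
have hexp p : a * expR (- (lam `^ mu)) * `|phi p| <= phi x0.
  rewrite -[leRHS]gtr0_norm//; apply: le_trans hyp; rewrite ler_wpM2l ?mulr_ge0 ?expR_ge0 ?(ltW a0)//.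
  by apply: abs_le_Linfty_norm => //; exact: filterT.
have [du [Hu [reg Lu]]] := f_smooth F sphi.
pose z := fchi F x0; have zR : `|z| <= fR F / 2 by exact: ltW.
have inb x : `|x - z| <= fR F / 2 -> `|x| <= fR F.
  move=> hx; have := ler_normD (x - z) z; rewrite subrK => h; apply: le_trans h _.
  by rewrite [leRHS]splitr; exact: lerD.
have ls : 0 < lam `^ s by rewrite powR_gt0.
pose r := c / lam `^ s.
have r32 : 32 * n%:R * r <= fR F.
  rewrite /r mulrA ler_pdivrMr//; apply: le_trans cc2 _; rewrite ler_wpM2l ?(ltW R0)//.
  by apply: ge0_ler_powR; rewrite // nnegrE ltW.
have hq' : (geodesic_distance g (fpsi F z) q < r%:E)%E by rewrite /z Ex.
have [z' -> z'z] := f_geodesic zR r32 hq'.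
apply: (main lam (phi \o fpsi F) du Hu z (fpsi F @^-1` Omega)) => //=.
- by apply: regular_sub reg _ => x /inb; rewrite subr0.
- by move=> x xb; rewrite -Lu ?inb// mulNr -Lphi opprK.
- by rewrite /z Ex.
- by move=> x _; rewrite /z Ex; exact: hexp.
- by rewrite /preimage /= /z Ex.
- by move=> x Ox' _; exact: posO.
- move=> x clx xb; rewrite /z Ex leNgt; apply/negP => lt.
  have cx : {for x, continuous (phi \o fpsi F)} by exact: (@continuous_comp _ _ _ (fpsi F) phi x (fpsi_continuous (inb _ xb)) (cphi _)).
  have := clx _ (cx [set t | phi x0 < t] (lt_nbhsr lt)).
  move=> [y [/= Oy]]; rewrite ltNge; move/negP; apply.
  exact: le_trans (ler_norm _) (le0 _ Oy).
- move=> x clx xb px; have cx := fpsi_continuous (inb _ (ltW xb)).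
  apply: (cx); apply: (nodal_domain_nbhs g n3 cphi nd); last by rewrite gt_eqF.
  move=> B nB; have [y [Oy By]] := clx _ (cx _ nB).
  by exists (fpsi F y).
- apply: le_trans z'z _; rewrite /r mulrA ler_wpM2r// invr_ge0 ltW//.
Qed.

End LocalTheorem.

Theorem corollary1p9 (R : realType) (n : nat) (hn : (3 <= n)%N)
    (M : topologicalType) (A : smooth_manifold R n M)
    (g : riemannian_metric A)
    (M_compact : compact [set: M]) (M_connected : connected [set: M])
    (nu a : R) (nu_gt0 : 0 < nu) (a_gt0 : 0 < a) :
  let mu : R := (2 * n%:R * nu) / ((n%:R - 1) * (n%:R - 2)) in
  exists2 c : R, 0 < c &
    forall (lam : R) (phi : M -> R) (Omega : set M) (x0 : M),
      0 < lam -> is_eigenvalue g lam -> is_eigenfunction g lam phi ->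
      nodal_domain phi Omega -> Omega x0 ->
      phi x0 = Linfty_norm A Omega phi ->
      a * expR (- (lam `^ mu)) * Linfty_norm A [set: M] phi <= `|phi x0| ->
      ~ changes_sign_on (geodesic_ball g x0 (c / (lam `^ (2^-1 + nu)))) phi.
Proof.
move=> mu.
(* The spectral gap is anchored at a point; on an empty manifold there is no centre, and any
   constant will do. *)
have [[p0 _]|nM] := pselect (exists p : M, True); last first.
  by exists 1 => // lam phi Omega x0; exfalso; apply: nM; exists x0.
have [lam0 lam00 gap] := spectral_gap g hn M_compact M_connected p0.
pose S c x0 := forall (lam : R) phi Omega,
    0 < lam -> lam0 <= lam -> is_eigenfunction g lam phi -> nodal_domain phi Omega -> Omega x0 ->
    phi x0 = Linfty_norm A Omega phi ->
    a * expR (- (lam `^ mu)) * Linfty_norm A [set: M] phi <= `|phi x0| ->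
    forall q, geodesic_ball g x0 (c / (lam `^ (2^-1 + nu))) q -> 0 <= phi q.
(* A constant may be replaced by any smaller positive one, since this shrinks the ball. So the local
   statement holds near each point for all small [c], and compactness gives one [c] for all
   centres. *)
have : \forall c \near (0 : R)^'+, [set: M] `<=` S c.
  have := M_compact; rewrite compact_near_coveringP; apply => p _.
  have [c c0 hc] := no_sign_change_near g hn M_compact p nu_gt0 a_gt0 lam00.
  exists ([set x0 | S c x0], [set t | t <= c]).
    by split => //=; exact: nbhs_right_le.
  move=> [x0 t] /= [Sx tc] lam phi Omega l0 ll eig nd Ox hx hyp q hq.
  apply: (Sx lam phi Omega) => //; apply: geodesic_ball_le hq.
  by rewrite ler_wpM2r// invr_ge0 powR_ge0.
move=> near_c; have near_pos : \forall c \near (0 : R)^'+, 0 < c by exact: nbhs_right_gt.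
have [c [hc c0]] := filter_ex (filterI near_c near_pos).
exists c => // lam phi Omega x0 l0 _ eig nd Ox hx hyp [p [q [Bp _ p_lt0 _]]].
have := hc x0 I lam phi Omega l0 (gap _ _ l0 eig) eig nd Ox hx hyp p Bp.
by rewrite leNgt p_lt0.
Qed.
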